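(* Assume that $k_1,k_2$ satisfy the assumptions (K) listed in the context. Then for every $y_0\in D(\mathcal A)$ the trajectory $\gamma(y_0):=\bigcup_{t\ge0}\{S(t)y_0\}\subset\mathcal H$ is precompact in $\mathcal H$.
   Context: Fix constants $\rho,\Lambda,L,m,J>0$. Assumptions (K) on $k_1,k_2:\mathbb R\to\mathbb R$: $k_1,k_2\in W^{2,\infty}_{\mathrm{loc}}(\mathbb R)$; $\int_0^z k_1(s)\,ds\ge 0$ for all $z\in\mathbb R$; $k_2'(z)\ge 0$ for all $z\in\mathbb R$ and $k_2(0)=0$; and there are $K>0$ and (small) $\delta>0$ with $|k_2(z)|\ge Kz^2$ for all $z\in(-\delta,\delta)$. For $n\ge2$ let $\tilde H^n_{0,\mathbb R}(0,L)$ be the space of real-valued $f\in H^n(0,L)$ with $f(0)=f'(0)=0$. $\mathcal H$ is the real Hilbert space of $y=[u,v,\xi,\psi]^\top$ with $u\in\tilde H^2_{0,\mathbb R}(0,L)$, $v\in L^2(0,L)$ real-valued, $\xi,\psi\in\mathbb R$, with inner product $$\langle y_1,y_2\rangle_{\mathcal H}=\tfrac{\Lambda}{2}\int_0^L u_1''u_2''\,dx+\tfrac{\rho}{2}\int_0^L v_1v_2\,dx+\tfrac1{2J}\xi_1\xi_2+\tfrac1{2m}\psi_1\psi_2 .$$ Define the linear operator $Ay=[v,\,-\frac{\Lambda}{\rho}u^{(4)},\,-\Lambda u''(L),\,\Lambda u'''(L)]^\top$ on $D(A)=\{y\in\mathcal H: u\in\tilde H^4_{0,\mathbb R}(0,L),\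 v\in\tilde H^2_{0,\mathbb R}(0,L),\ \xi=Jv'(L),\ \psi=mv(L)\}$ (primes are $x$-derivatives), the nonlinear map $\mathcal N y=[0,0,0,-k_1(u(L))-k_2(\psi/m)]^\top$ on $\mathcal H$, and $\mathcal A=A+\mathcal N$ on $D(\mathcal A)=D(A)$. A mild solution of $y_t=\mathcal Ay$, $y(0)=y_0$ on $[0,T)$ is $y\in C([0,T);\mathcal H)$ with $y(t)=e^{tA}y_0+\int_0^te^{(t-s)A}\mathcal Ny(s)\,ds$, where $(e^{tA})_{t\ge0}$ is the $C_0$-semigroup generated by $A$. For every $y_0\in\mathcal H$ there is a unique global mild solution, denoted $S(t)y_0$, $t\ge0$ (a classical solution if $y_0\in D(\mathcal A)$). *)

(* Defs.v *)
From HB Require Import structures.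
From mathcomp Require Import all_boot all_order all_algebra.
From mathcomp Require Import generic_quotient.
From mathcomp Require Import all_classical all_reals all_analysis.
From mathcomp Require Import ring lra.
Set Implicit Arguments.
Unset Strict Implicit.
Unset Printing Implicit Defensive.
Import Order.TTheory GRing.Theory Num.Theory.
Import numFieldNormedType.Exports.
Local Open Scope classical_set_scope.
Local Open Scope ring_scope.

HB.mixin Record isSemiInner (R : realType) E & GRing.Lmodule R E := {
  sip : E -> E -> R ;
  sipC : forall x y, sip x y = sip y x ;
  sipDl : forall x y z, sip (x + y) z = sip x z + sip y z ;
  sipZl : forall (a : R) x y, sip (a *: x) y = a * sip x y ;
  sip_ge0 : forall x, 0 <= sip x x
}.

#[short(type="semiInnerType")]
HB.structure Definition SemiInner (R : realType) :=
  {E of GRing.Lmodule R E & isSemiInner R E}.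

Section semi_inner.
Context (R : realType) (E : semiInnerType R).
Implicit Types x y z : E.

Lemma sipDr x y z : sip x (y + z) = sip x y + sip x z.
Proof. by rewrite sipC sipDl ![sip _ x]sipC. Qed.

Lemma sipZr (a : R) x y : sip x (a *: y) = a * sip x y.
Proof. by rewrite sipC sipZl sipC. Qed.

Lemma sip_CS x y : sip x y ^+ 2 <= sip x x * sip y y.
Proof.
have H (a : R) : 0 <= sip x x + 2 * a * sip x y + a ^+ 2 * sip y y.
  have := sip_ge0 (x + a *: y).
  rewrite !(sipDl, sipDr, sipZl, sipZr) (sipC y x).
  by move=> h; apply: le_trans h _; rewrite le_eqVlt; apply/orP; left; apply/eqP; ring.
have yy := sip_ge0 y; have xx := sip_ge0 x.
have [y0|y0] := eqVneq (sip y y) 0.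
  have [->|xy0] := eqVneq (sip x y) 0; first by rewrite expr0n mulr_ge0.
  have := H (- (sip x x + 1) / (2 * sip x y)).
  rewrite y0 mulr0 addr0.
  have -> : 2 * (- (sip x x + 1) / (2 * sip x y)) * sip x y = - (sip x x + 1).
    by field.
  by lra.
have yp : 0 < sip y y by rewrite lt_def y0.
have := H (- sip x y / sip y y).
have -> : sip x x + 2 * (- sip x y / sip y y) * sip x y +
    (- sip x y / sip y y) ^+ 2 * sip y y
  = (sip x x * sip y y - sip x y ^+ 2) / sip y y by field.
by rewrite pmulr_lge0 ?invr_gt0// subr_ge0.
Qed.

Definition snorm x : R := Num.sqrt (sip x x).

Lemma snormD x y : snorm (x + y) <= snorm x + snorm y.
Proof.
have sx := sqrtr_ge0 (sip x x); have sy := sqrtr_ge0 (sip y y).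
rewrite -(@ler_pXn2r _ 2)// ?nnegrE ?addr_ge0 ?sqrtr_ge0//.
rewrite sqrrD !sqr_sqrtr ?sip_ge0// sipDl !sipDr (sipC y x).
have : sip x y <= snorm x * snorm y.
  rewrite (le_trans (ler_norm _))// -(@ler_pXn2r _ 2)// ?nnegrE ?mulr_ge0//.
  by rewrite -normrX ger0_norm ?sqr_ge0// exprMn !sqr_sqrtr ?sip_ge0 ?sip_CS.
by rewrite /snorm; lra.
Qed.

Lemma snormZ (a : R) x : snorm (a *: x) = `|a| * snorm x.
Proof.
by rewrite /snorm sipZl sipZr mulrA -expr2 sqrtrM ?sqr_ge0// sqrtr_sqr.
Qed.

Definition null_equiv x y : bool := snorm (x - y) == 0.

Lemma snormN x : snorm (- x) = snorm x.
Proof. by rewrite -scaleN1r snormZ normrN normr1 mul1r. Qed.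

Lemma null_equivxx : reflexive null_equiv.
Proof.
move=> x; rewrite /null_equiv subrr -(scale0r (0 : E)) snormZ normr0 mul0r.
exact: eqxx.
Qed.

Lemma null_equivC : symmetric null_equiv.
Proof. by move=> x y; rewrite /null_equiv -snormN opprB. Qed.

Lemma null_equiv_trans : transitive null_equiv.
Proof.
move=> y x z /eqP xy /eqP yz; rewrite /null_equiv eq_le sqrtr_ge0 andbT.
by have := snormD (x - y) (y - z); rewrite xy yz addr0 addrA subrK.
Qed.

Canonical null_equiv_canonical :=
  EquivRel null_equiv null_equivxx null_equivC null_equiv_trans.

(* E modulo the vectors of zero seminorm, as an inner product space *)
Definition hquot : Type := {eq_quot null_equiv}%qT.
HB.instance Definition _ := Choice.on hquot.
HB.instance Definition _ := EqQuotient.on hquot.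

End semi_inner.

Section hquot_theory.
Context (R : realType) (E : semiInnerType R).
Local Open Scope quotient_scope.
Notation H := (hquot E).
Implicit Types (x y z : E) (p q r : H).

Definition hpi x : H := \pi_H x.

Lemma hpi_eqP x y : hpi x = hpi y <-> snorm (x - y) = 0.
Proof. by split=> [/eqP|/eqP h]; [rewrite eqmodE => /eqP|apply/eqP; rewrite eqmodE]. Qed.

Lemma hreprK p : hpi (repr p) = p. Proof. exact: reprK. Qed.

Lemma hpi_ind (P : H -> Prop) : (forall x, P (hpi x)) -> forall p, P p.
Proof. by move=> h p; rewrite -(hreprK p). Qed.

Lemma hpi_repr x : snorm (repr (hpi x) - x) = 0.
Proof. by apply/hpi_eqP; rewrite hreprK. Qed.

Lemma snorm0 : snorm (0 : E) = 0.
Proof. by rewrite -(scale0r (0 : E)) snormZ normr0 mul0r. Qed.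

Lemma snorm_sip0 x y : snorm x = 0 -> sip x y = 0.
Proof.
move=> /eqP; rewrite sqrtr_eq0 => x0.
have {}x0 : sip x x = 0 by apply/eqP; rewrite eq_le x0 sip_ge0.
apply/eqP; rewrite -sqrf_eq0 eq_le sqr_ge0 andbT.
by rewrite (le_trans (sip_CS _ _))// x0 mul0r.
Qed.

Definition hadd p q := hpi (repr p + repr q).
Definition hopp p := hpi (- repr p).
Definition hscale (a : R) p := hpi (a *: repr p).
Definition hip p q : R := sip (repr p) (repr q).

Lemma hadd_pi x y : hadd (hpi x) (hpi y) = hpi (x + y).
Proof.
apply/hpi_eqP/eqP; rewrite eq_le sqrtr_ge0 andbT opprD addrACA.
by rewrite (le_trans (snormD _ _))// !hpi_repr addr0.
Qed.

Lemma hscale_pi (a : R) x : hscale a (hpi x) = hpi (a *: x).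
Proof. by apply/hpi_eqP; rewrite -scalerBr snormZ hpi_repr mulr0. Qed.

Lemma hopp_pi x : hopp (hpi x) = hpi (- x).
Proof. by apply/hpi_eqP; rewrite -opprD snormN hpi_repr. Qed.

Lemma hip_pi x y : hip (hpi x) (hpi y) = sip x y.
Proof.
rewrite /hip.
have -> : repr (hpi x) = (repr (hpi x) - x) + x by rewrite subrK.
rewrite sipDl (snorm_sip0 _ (hpi_repr x)) add0r.
have -> : repr (hpi y) = (repr (hpi y) - y) + y by rewrite subrK.
by rewrite sipDr (sipC x) (snorm_sip0 _ (hpi_repr y)) add0r.
Qed.

Fact haddA : associative hadd.
Proof. by elim/hpi_ind=> x; elim/hpi_ind=> y; elim/hpi_ind=> z; rewrite !hadd_pi addrA. Qed.
Fact haddC : commutative hadd.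
Proof. by elim/hpi_ind=> x; elim/hpi_ind=> y; rewrite !hadd_pi addrC. Qed.
Fact hadd0 : left_id (hpi 0) hadd.
Proof. by elim/hpi_ind=> x; rewrite hadd_pi add0r. Qed.
Fact haddN : left_inverse (hpi 0) hopp hadd.
Proof. by elim/hpi_ind=> x; rewrite hopp_pi hadd_pi addNr. Qed.

HB.instance Definition _ := GRing.isZmodule.Build H haddA haddC hadd0 haddN.

Fact hscaleA (a b : R) p : hscale a (hscale b p) = hscale (a * b) p.
Proof. by elim/hpi_ind: p => x; rewrite !hscale_pi scalerA. Qed.
Fact hscale1 : left_id 1 hscale.
Proof. by elim/hpi_ind=> x; rewrite hscale_pi scale1r. Qed.
Fact hscaleDr : right_distributive hscale +%R.
Proof.
move=> a; elim/hpi_ind=> x; elim/hpi_ind=> y.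
by rewrite /GRing.add/= hadd_pi !hscale_pi hadd_pi scalerDr.
Qed.
Fact hscaleDl p : {morph hscale^~ p : a b / a + b}.
Proof.
move=> a b; elim/hpi_ind: p => x.
by rewrite /= !hscale_pi {2}/GRing.add/= hadd_pi scalerDl.
Qed.

HB.instance Definition _ :=
  GRing.Zmodule_isLmodule.Build R H hscaleA hscale1 hscaleDr hscaleDl.

Definition hnorm p : R := Num.sqrt (hip p p).

Lemma hnorm_pi x : hnorm (hpi x) = snorm x.
Proof. by rewrite /hnorm hip_pi. Qed.

Fact hnormD p q : hnorm (p + q) <= hnorm p + hnorm q.
Proof.
elim/hpi_ind: p => x; elim/hpi_ind: q => y.
by rewrite {1}/GRing.add/= hadd_pi !hnorm_pi snormD.
Qed.
Fact hnormZ (a : R) p : hnorm (a *: p) = `|a| * hnorm p.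
Proof. by elim/hpi_ind: p => x; rewrite /GRing.scale/= hscale_pi !hnorm_pi snormZ. Qed.
Fact hnorm_eq0 p : hnorm p = 0 -> p = 0.
Proof.
elim/hpi_ind: p => x; rewrite hnorm_pi => x0.
by apply/hpi_eqP; rewrite subr0.
Qed.

HB.instance Definition _ :=
  Lmodule_isNormed.Build R H hnormD hnormZ hnorm_eq0.

Lemma hpi_linear : linear hpi.
Proof. by move=> a x y; rewrite -hadd_pi -hscale_pi. Qed.

Lemma hnormE p : `|p| = Num.sqrt (hip p p). Proof. by []. Qed.

End hquot_theory.

Section sobolev.
Context {R : realType}.
Notation mu := (@lebesgue_measure R).
Implicit Types (a b c x : R) (f g : R -> R) (D : nat -> R -> R).

(* f belongs to L^p(a,b); the values of f outside ]a, b[ are irrelevant *)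
Definition Lp_on (p : \bar R) a b f := (f \_ `]a, b[) \in Lfun mu p.

(* f is absolutely continuous on [a, b] with derivative g almost everywhere *)
Definition primitive_on a b f g :=
  mu.-integrable `[a, b] (EFin \o g) /\
  forall x, x \in `[a, b] -> f x = f a + \int[mu]_(t in `[a, x]) g t.

(* f is in W^{n,p}(a,b) and D 0, ..., D n are its derivatives up to order n.
   For k < n, D k is the continuous representative on [a, b], so that its values
   at a and b make sense; D n is defined up to a null set. *)
Definition sobolev_derivs (p : \bar R) n a b f D :=
  [/\ D 0%N = f, forall k, (k < n)%N -> primitive_on a b (D k) (D k.+1)
    & Lp_on p a b (D n)].

Definition sobolev (p : \bar R) n a b f := exists D, sobolev_derivs p n a b f D.

(* a choice of the derivatives of f in H^n(a,b); see wderiv_unique below *)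
Definition wderiv n a b f : nat -> R -> R := get (sobolev_derivs 2%:E n a b f).

Let mitv (i : interval R) : @measurable _ (measurableTypeR R) [set` i].
Proof. exact: measurable_itv. Qed.

Lemma wderivP n a b f : sobolev 2%:E n a b f ->
  sobolev_derivs 2%:E n a b f (wderiv n a b f).
Proof. by move=> [D]; exact: getI. Qed.

Lemma Lp_on_lin (p : \bar R) a b c f g : (1 <= p)%E ->
  Lp_on p a b f -> Lp_on p a b g -> Lp_on p a b (c *: f + g).
Proof.
move=> p1 hf hg; rewrite /Lp_on.
have -> : (c *: f + g) \_ `]a, b[ = c *: (f \_ `]a, b[) + g \_ `]a, b[.
  apply/funext => x; rewrite !fctE !patchE; case: ifPn => // _.
  by rewrite scaler0 addr0.
by have [_] := @Lfun_submod_closed _ _ _ mu p p1; apply.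
Qed.

Lemma Lp_on0 (p : \bar R) a b : (1 <= p)%E -> Lp_on p a b 0.
Proof.
move=> p1; rewrite /Lp_on.
have -> : (0 : R -> R) \_ `]a, b[ = 0.
  by apply/funext => x; rewrite patchE; case: ifPn.
by have [] := @Lfun_submod_closed _ _ _ mu p p1.
Qed.

Lemma primitive_on_lin a b c (f g f' g' : R -> R) :
  primitive_on a b f g -> primitive_on a b f' g' ->
  primitive_on a b (c *: f + f') (c *: g + g').
Proof.
move=> [ig fE] [ig' fE'].
have icg : mu.-integrable `[a, b] (EFin \o (c *: g)).
  have := integrableZl (mitv _) c ig.
  by apply: eq_integrable.
split.
  have := integrableD (mitv _) icg ig'.
  by apply: eq_integrable.
move=> x xab.
have sub : `[a, x] `<=` `[a, b].
  by apply: subset_itvl; rewrite bnd_simp; move: xab; rewrite in_itv/= => /andP[].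
have [ig1 [icg1 ig1']] : mu.-integrable `[a, x] (EFin \o g) /\
    mu.-integrable `[a, x] (EFin \o (c *: g)) /\
    mu.-integrable `[a, x] (EFin \o g').
  by do ![split]; apply: (integrableS (mitv _) (mitv _) sub).
have -> : \int[mu]_(t in `[a, x]) (c *: g + g') t =
   c * \int[mu]_(t in `[a, x]) g t + \int[mu]_(t in `[a, x]) g' t.
  transitivity (\int[mu]_(t in `[a, x]) (c *: g) t + \int[mu]_(t in `[a, x]) g' t).
    exact: (RintegralD (mitv _) icg1 ig1').
  by congr (_ + _); exact: (RintegralZl c (mitv _) ig1).
have -> : (c *: f + f') x = c * f x + f' x by [].
have -> : (c *: f + f') a = c * f a + f' a by [].
by rewrite fE// fE'//; ring.
Qed.

Lemma sobolev_derivs_lin (p : \bar R) n a b c f g D D' : (1 <= p)%E ->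
  sobolev_derivs p n a b f D -> sobolev_derivs p n a b g D' ->
  sobolev_derivs p n a b (c *: f + g) (fun k => c *: D k + D' k).
Proof.
move=> p1 [D0 Dk Dn] [D'0 D'k D'n]; split; first by rewrite D0 D'0.
- by move=> k kn; apply: primitive_on_lin; [exact: Dk|exact: D'k].
- exact: Lp_on_lin.
Qed.

Lemma primitive_on0 a b : primitive_on a b 0 0.
Proof.
split; first by have := @integrable0 _ _ _ mu `[a, b]; apply: eq_integrable.
move=> x _; rewrite (_ : \int[mu]_(t in _) _ = 0) ?addr0//.
by rewrite /Rintegral integral0.
Qed.

Lemma sobolev_derivs0 (p : \bar R) n a b : (1 <= p)%E ->
  sobolev_derivs p n a b 0 (fun=> 0).
Proof.
by move=> p1; split => // [k _|]; [exact: primitive_on0|exact: Lp_on0].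
Qed.

Lemma primitive_on_continuous a b f g x : primitive_on a b f g ->
  x \in `]a, b[ -> {for x, continuous f}.
Proof.
move=> [ig fE] xab; have /andP[ax xb] : a < x < b by move: xab; rewrite in_itv.
have ab := lt_trans ax xb.
have := parameterized_integral_continuous (ltW ab) ig.
move=> /(continuous_within_itvP _ ab)[+ _ _].
move=> /(_ x xab) gx.
have : f a + parameterized_integral mu a y g @[y --> x] --> f a + parameterized_integral mu a x g.
  by apply: cvgD; [exact: cvg_cst|exact: gx].
rewrite /parameterized_integral -fE; last first.
  by move: xab; exact: subset_itv_oo_cc.
apply: cvg_trans; apply: near_eq_cvg.
have : nbhs x `]a, b[%classic by apply: near_in_itvoo.
apply: filterS => y yab; apply/esym/fE.
by move: yab; exact: subset_itv_oo_cc.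
Qed.

Let derive_cst_itv a b c (F : R -> R) x : x \in `]a, b[ ->
  (forall y, y \in `]a, b[ -> F y = c) -> derive1 F x = 0.
Proof.
move=> xab Fc; rewrite derive1E.
rewrite (@near_eq_derive _ _ _ F (cst c)) ?derive_cst//.
have : nbhs x `]a, b[%classic by apply: near_in_itvoo.
by apply: filterS => y yab; exact: Fc.
Qed.

Lemma primitive_cst_ae a b c g : mu.-integrable `[a, b] (EFin \o g) ->
  (forall x, x \in `]a, b[ -> \int[mu]_(t in `[a, x]) g t = c) ->
  {ae mu, forall x, x \in `]a, b[ -> g x = 0}.
Proof.
move=> ig gc; pose h := g \_ `[a, b].
have ih : mu.-integrable setT (EFin \o h).
  move/(integrable_mkcond _ (mitv _)): ig.
  by rewrite restrict_EFin.
have ihy y : mu.-integrable [set` Interval (BLeft a) (BRight y)] (EFin \o h).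
  exact: (integrableS measurableT (mitv _) (@subsetT _ _) ih).
have lh : locally_integrable [set: R] h.
  by have := integrable_locally measurableT ih; rewrite patch_setT.
have := FTC1 ihy lh.
apply: filterS; first exact: (ae_filter_ringOfSetsType mu).
move=> x hx xab.
have /andP[ax xb] : a < x < b by move: xab; rewrite in_itv.
have hE y : y \in `]a, b[ -> \int[mu]_(t in `[a, y]) h t = c.
  move=> yab; rewrite -(gc y)//; apply: eq_Rintegral => t.
  rewrite inE/= in_itv/= => /andP[at_ ty]; rewrite /h patchE mem_set//=.
  rewrite in_itv/= at_ (le_trans ty)//.
  by move: yab; rewrite in_itv/= => /andP[_ /ltW].
have [|_] := hx; first by rewrite /= lte_fin.
rewrite (derive_cst_itv xab hE) /h patchE mem_set//=.
by move: xab; exact: subset_itv_oo_cc.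
Qed.

Lemma primitive_cst_eq0 a b c f g : primitive_on a b f g ->
  mu.-integrable `[a, b] (EFin \o f) ->
  (forall x, x \in `]a, b[ -> \int[mu]_(t in `[a, x]) f t = c) ->
  forall x, x \in `]a, b[ -> f x = 0.
Proof.
move=> fg if_ fc x xab.
have /andP[ax xb] : a < x < b by move: xab; rewrite in_itv.
have [_ <-] := continuous_FTC1_closed xb if_ ax (primitive_on_continuous fg xab).
exact: derive_cst_itv fc.
Qed.

Lemma sobolev_derivs0_eq0 (p : \bar R) n a b D :
  sobolev_derivs p n.+1 a b 0 D ->
  (forall k, (k <= n)%N -> forall x, x \in `]a, b[ -> D k x = 0) /\
  {ae mu, forall x, x \in `]a, b[ -> D n.+1 x = 0}.
Proof.
move=> [D0 Dk _].
have Dcst k : (k <= n)%N -> (forall x, x \in `]a, b[ -> D k x = 0) ->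
    forall x, x \in `]a, b[ -> \int[mu]_(t in `[a, x]) D k.+1 t = - D k a.
  move=> kn Dk0 x xab; have [_ /(_ x)] := Dk k kn.
  by move=> /(_ (subset_itv_oo_cc xab)); rewrite Dk0// => /eqP; rewrite eq_sym addrC addr_eq0 => /eqP.
have H k : (k <= n)%N -> forall x, x \in `]a, b[ -> D k x = 0.
  elim: k => [_ x _|k ih kn]; first by rewrite D0.
  apply: (primitive_cst_eq0 (Dk _ _) (Dk k (ltnW kn)).1) => //.
  exact: (Dcst _ (ltnW kn) (ih (ltnW kn))).
split => //.
exact: (primitive_cst_ae (Dk n (leqnn _)).1 (Dcst _ (leqnn n) (H _ (leqnn n)))).
Qed.

Lemma wderiv_unique n a b f D : sobolev_derivs 2%:E n.+1 a b f D ->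
  (forall k, (k <= n)%N -> forall x, x \in `]a, b[ -> wderiv n.+1 a b f k x = D k x) /\
  {ae mu, forall x, x \in `]a, b[ -> wderiv n.+1 a b f n.+1 x = D n.+1 x}.
Proof.
move=> fD; have fW := wderivP (ex_intro _ D fD).
have p1 : (1 <= 2%:E :> \bar R)%E by rewrite lee_fin ler1n.
have := sobolev_derivs_lin (-1) p1 fD fW.
rewrite scaleN1r addNr => /sobolev_derivs0_eq0[h1 h2]; split.
- move=> k kn x xab; have /eqP := h1 k kn x xab.
  by rewrite scaleN1r addrC subr_eq0 => /eqP.
- move: h2; apply: filterS; first exact: (ae_filter_ringOfSetsType mu).
  move=> x /[apply] /eqP.
  by rewrite scaleN1r addrC subr_eq0 => /eqP.
Qed.

End sobolev.

Section state.
Context {R : realType}.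
Notation mu := (@lebesgue_measure R).

(* u belongs to the space of f in H^n(0,L) with f(0) = f'(0) = 0, and D lists
   its derivatives *)
Definition clamped n (L : R) (u : R -> R) D :=
  [/\ sobolev_derivs 2%:E n 0 L u D, D 0%N 0 = 0 & D 1%N 0 = 0].

Definition state_pred (L : R) : {pred (R -> R) * (R -> R) * R * R} :=
  fun w => `[< (exists D, clamped 2 L w.1.1.1 D) /\ Lp_on 2%:E 0 L w.1.1.2 >].

(* Representatives of the elements of the energy space: the values of u off
   [0, L] and of v off a full-measure subset of ]0, L[ are irrelevant, and are
   forgotten in the quotient H below. The parameters rho, Lam, m, J only enter the
   inner product. *)
Record state (rho Lam L m J : {posnum R}) := State {
  state_val : (R -> R) * (R -> R) * R * R ;
  state_valP : state_val \in state_pred L%:num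
}.

Lemma state_pred_submod_closed L : submod_closed (state_pred L).
Proof.
have p1 : (1 <= 2%:E :> \bar R)%E by rewrite lee_fin ler1n.
split.
  apply/asboolP; split; last exact: Lp_on0.
  by exists (fun=> 0); split => //; exact: sobolev_derivs0.
move=> a [[[u v] xi] psi] [[[u' v'] xi'] psi'].
move=> /asboolP[/= [D [uD D0 D1]] hv] /asboolP[/= [D' [uD' D'0 D'1]] hv'].
apply/asboolP; split; last exact: (Lp_on_lin a p1 hv hv').
exists (fun k => a *: D k + D' k); split.
- exact: (sobolev_derivs_lin a p1 uD uD').
- by rewrite !fctE D0 D'0 scaler0 addr0.
- by rewrite !fctE D1 D'1 scaler0 addr0.
Qed.

HB.instance Definition _ L := GRing.isSubmodClosed.Build R _ (state_pred L)
  (state_pred_submod_closed L).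

Section instances.
Variables rho Lam L m J : {posnum R}.
Notation state := (state rho Lam L m J).

HB.instance Definition _ := [isSub for @state_val rho Lam L m J].
HB.instance Definition _ := [Choice of state by <:].
HB.instance Definition _ := [SubChoice_isSubLmodule of state by <:].

Definition st_u (w : state) : R -> R := (val w).1.1.1.
Definition st_v (w : state) : R -> R := (val w).1.1.2.
Definition st_xi (w : state) : R := (val w).1.2.
Definition st_psi (w : state) : R := (val w).2.

Definition dot_L2 (f g : R -> R) : R := \int[mu]_(x in `]0, L%:num[) (f x * g x).

Definition st_ip (w1 w2 : state) : R :=
  let u'' w := wderiv 2 0 L%:num (st_u w) 2 in
  Lam%:num / 2 * dot_L2 (u'' w1) (u'' w2)
  + rho%:num / 2 * dot_L2 (st_v w1) (st_v w2)
  + (2 * J%:num)^-1 * (st_xi w1 * st_xi w2)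
  + (2 * m%:num)^-1 * (st_psi w1 * st_psi w2).

Let mitv (i : interval R) : @measurable _ (measurableTypeR R) [set` i].
Proof. exact: measurable_itv. Qed.

Let integrable_mul f g : Lp_on 2%:E 0 L%:num f -> Lp_on 2%:E 0 L%:num g ->
  mu.-integrable `]0, L%:num[ (EFin \o (fun x => f x * g x)).
Proof.
move=> hf hg; apply/(integrable_mkcond _ (mitv _)).
have /Lfun1_integrable := Lfun2_mul_Lfun1 hf hg.
apply: eq_integrable => // x _ /=.
by rewrite !patchE; case: ifPn => // _; rewrite mulr0.
Qed.

Lemma dot_L2C f g : dot_L2 f g = dot_L2 g f.
Proof. by apply: eq_Rintegral => x _; rewrite mulrC. Qed.

Lemma dot_L2_ge0 f : 0 <= dot_L2 f f.
Proof. by apply: Rintegral_ge0 => x _; rewrite -expr2 sqr_ge0. Qed.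

Lemma dot_L2_lin (a : R) f g h : Lp_on 2%:E 0 L%:num f ->
  Lp_on 2%:E 0 L%:num g -> Lp_on 2%:E 0 L%:num h ->
  dot_L2 (a *: f + g) h = a * dot_L2 f h + dot_L2 g h.
Proof.
move=> hf hg hh; have fh := integrable_mul hf hh; have gh := integrable_mul hg hh.
rewrite /dot_L2 -(RintegralZl a (mitv _) fh).
have afh : mu.-integrable `]0, L%:num[ (EFin \o (fun x => a * (f x * h x))).
  have := integrableZl (mitv _) a fh.
  by apply: eq_integrable.
rewrite -(RintegralD (mitv _) afh gh); apply: eq_Rintegral => x _ /=.
by rewrite !fctE /= mulrDl mulrA.
Qed.

Lemma dot_L2_ae f f' g : Lp_on 2%:E 0 L%:num f -> Lp_on 2%:E 0 L%:num f' ->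
  Lp_on 2%:E 0 L%:num g ->
  {ae mu, forall x, x \in `]0, L%:num[ -> f x = f' x} ->
  dot_L2 f g = dot_L2 f' g.
Proof.
move=> hf hf' hg ff'; rewrite /dot_L2 /Rintegral; congr fine.
have /integrableP[m1 _] := integrable_mul hf hg.
have /integrableP[m2 _] := integrable_mul hf' hg.
apply: ae_eq_integral => //.
move: ff'; apply: filterS; first exact: (ae_filter_ringOfSetsType mu).
by move=> x h xD /=; rewrite h.
Qed.

Let u''_Lp (w : state) : Lp_on 2%:E 0 L%:num (wderiv 2 0 L%:num (st_u w) 2).
Proof.
have /asboolP[[D [hD _ _]] _] := valP w.
by have [] := wderivP (ex_intro _ D hD).
Qed.

Let v_Lp (w : state) : Lp_on 2%:E 0 L%:num (st_v w).
Proof. by have /asboolP[] := valP w. Qed.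

Let st_ip_lin a w1 w2 w3 :
  st_ip (a *: w1 + w2) w3 = a * st_ip w1 w3 + st_ip w2 w3.
Proof.
have p1 : (1 <= 2%:E :> \bar R)%E by rewrite lee_fin ler1n.
rewrite /st_ip.
have -> : st_v (a *: w1 + w2) = a *: st_v w1 + st_v w2 by [].
have -> : st_u (a *: w1 + w2) = a *: st_u w1 + st_u w2 by [].
have -> : st_xi (a *: w1 + w2) = a * st_xi w1 + st_xi w2 by [].
have -> : st_psi (a *: w1 + w2) = a * st_psi w1 + st_psi w2 by [].
have [D1 [h1 _ _]] := (asboolW (valP w1)).1.
have [D2 [h2 _ _]] := (asboolW (valP w2)).1.
have g1 := wderivP (ex_intro _ D1 h1); have g2 := wderivP (ex_intro _ D2 h2).
have g := sobolev_derivs_lin a p1 g1 g2.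
have [_ ae] := wderiv_unique g.
have [_ _ L1] := g; have [_ _ L2] := wderivP (ex_intro _ _ g).
rewrite (dot_L2_ae L2 L1 (u''_Lp w3) ae).
rewrite dot_L2_lin; [|exact: u''_Lp|exact: u''_Lp|exact: u''_Lp].
rewrite dot_L2_lin; [|exact: v_Lp|exact: v_Lp|exact: v_Lp].
by ring.
Qed.

Fact st_ipC w1 w2 : st_ip w1 w2 = st_ip w2 w1.
Proof.
by rewrite /st_ip dot_L2C (dot_L2C (st_v _)) (mulrC (st_xi _)) (mulrC (st_psi _)).
Qed.

Fact st_ipZl (a : R) w1 w2 : st_ip (a *: w1) w2 = a * st_ip w1 w2.
Proof.
have h0 : st_ip 0 w2 = 0.
  by have := st_ip_lin 1 0 0 w2; rewrite scaler0 addr0 mul1r; lra.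
by rewrite -[a *: w1]addr0 st_ip_lin h0 addr0.
Qed.

Fact st_ipDl w1 w2 w3 : st_ip (w1 + w2) w3 = st_ip w1 w3 + st_ip w2 w3.
Proof. by rewrite -[w1]scale1r st_ip_lin scale1r mul1r. Qed.

Fact st_ip_ge0 w : 0 <= st_ip w w.
Proof.
by rewrite /st_ip -!expr2 !addr_ge0// mulr_ge0// ?dot_L2_ge0// ?sqr_ge0// ?divr_ge0// ?invr_ge0 ?mulr_ge0.
Qed.

HB.instance Definition _ := isSemiInner.Build R state
  st_ipC st_ipDl st_ipZl st_ip_ge0.

End instances.
End state.

Section evolution.
Context {R : realType} {X : normedModType R}.
Implicit Types (T : R -> X -> X) (A : set (X * X)) (N : X -> X) (x z : X).

(* Riemann integral of an X-valued function over [a, b]; p and tau are the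
   points and the tags of a partition into n subintervals *)
Definition is_integral (a b : R) (f : R -> X) (I : X) :=
  forall e : R, 0 < e -> exists2 d : R, 0 < d &
  forall n (p tau : nat -> R), p 0%N = a -> p n = b ->
    (forall i, (i < n)%N -> p i <= tau i <= p i.+1 /\ p i.+1 - p i < d) ->
    `| \sum_(i < n) (p i.+1 - p i) *: f (tau i) - I | < e.

(* only the values of T at times t >= 0 matter *)
Definition C0_semigroup T :=
  [/\ forall t, 0 <= t -> linear (T t) /\ continuous (T t),
      forall x, T 0 x = x,
      forall s t x, 0 <= s -> 0 <= t -> T (s + t) x = T s (T t x)
    & forall x, T t x @[t --> 0^'+] --> x].

(* the (graph of the) infinitesimal generator *)
Definition generator T : set (X * X) :=
  [set xz | h^-1 *: (T h xz.1 - xz.1) @[h --> 0^'+] --> xz.2].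

(* y is a global mild solution of y_t = A y + N y, y(0) = y0, where A generates
   T; on t < 0 the function y is arbitrary *)
Definition mild_solution T N (y0 : X) (y : R -> X) :=
  {within `[0, +oo[, continuous y} /\
  forall t, 0 <= t ->
    is_integral 0 t (fun s => T (t - s) (N (y s))) (y t - T t y0).

End evolution.

Section feedback.
Context {R : realType}.
Notation mu := (@lebesgue_measure R).
Implicit Type k : R -> R.

Definition oriented_integral (a b : R) k : R :=
  if a <= b then \int[mu]_(s in `[a, b]) k s else - \int[mu]_(s in `[b, a]) k s.

Definition W2oo_loc k := forall a b : R, a < b -> sobolev +oo%E 2 a b k.

Definition assumption_K k1 k2 :=
  [/\ W2oo_loc k1, W2oo_loc k2,
      forall z, 0 <= oriented_integral 0 z k1,
      (forall z, 0 <= derive1 k2 z) /\ k2 0 = 0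
    & exists K delta : R, [/\ 0 < K, 0 < delta &
        forall z, z \in `]- delta, delta[ -> K * z ^+ 2 <= `|k2 z|]].

End feedback.

Section beam.
Context {R : realType}.
Variables rho Lam L m J : {posnum R}.

Definition H := hquot (state rho Lam L m J).
HB.instance Definition _ := NormedModule.on H.

(* y = [u, v, xi, psi], with u in H^2(0,L), u(0) = u'(0) = 0, v in L^2(0,L) *)
Definition is_state (y : H) (u v : R -> R) (xi psi : R) :=
  exists2 w : state rho Lam L m J, val w = (u, v, xi, psi) & y = hpi w.

(* y = [u, v, J v'(L), m v(L)] is in D(A), Du and Dv being the derivatives of u
   and v *)
Definition in_domA (y : H) u v Du Dv :=
  [/\ clamped 4 L%:num u Du, clamped 2 L%:num v Dv
    & is_state y u v (J%:num * Dv 1%N L%:num) (m%:num * v L%:num)].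

(* this is also the domain of the nonlinear operator A + N *)
Definition domA : set H := [set y | exists u v Du Dv, in_domA y u v Du Dv].

Definition opA : set (H * H) := [set yz | exists u v Du Dv,
  in_domA yz.1 u v Du Dv /\
  is_state yz.2 v (fun x => - (Lam%:num / rho%:num) * Du 4%N x)
    (- Lam%:num * Du 2%N L%:num) (Lam%:num * Du 3%N L%:num)].

Lemma force_subproof (c : R) : (0, 0, 0, c) \in state_pred L%:num.
Proof.
have p1 : (1 <= 2%:E :> \bar R)%E by rewrite lee_fin ler1n.
apply/asboolP; split; last exact: Lp_on0.
by exists (fun=> 0); split => //; exact: sobolev_derivs0.
Qed.

Definition force (c : R) : H := hpi (State rho Lam m J (force_subproof c)).

(* u(L) and psi do not depend on the representative of y, as u is continuous
   on [0, L] *)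
Definition opN (k1 k2 : R -> R) (y : H) : H :=
  force (- k1 (st_u (repr y) L%:num) - k2 (st_psi (repr y) / m%:num)).

End beam.

Arguments domA {R} rho Lam L m J.
Arguments opA {R} rho Lam L m J.
Arguments opN {R} rho Lam L m J.

(* Main.v *)
(* The generator A is skew, so along y(t) = S(t) y0 the energy
   V = |y|^2 + K1(u(L)), with K1 the primitive of k1, satisfies
   V' <= - p k2(p) <= - C |p|^3, where p = psi/m is the speed of the tip.  Fix h
   and let w = y(. + h) - y.  As k2 is nondecreasing, the squared norm of w plus
   the Taylor remainder of K1 between the tip positions q(s) and q(s + h) grows
   at a rate at most C1 |p| |q(s + h) - q(s)|^2, which the dissipation of V at s
   and over [s, s + h] absorbs.  Hence |y(t + h) - y(t)| <= C h uniformly in t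
   when y0 is in D(A), so that (y(t + h) - y(t)) / h - N y(t) is bounded, and
   its image under the compact operator A^-1 converges to y(t) as h -> 0+. *)
Require Import Defs.
From mathcomp Require Import all_boot all_order all_algebra.
From mathcomp Require Import all_classical all_reals all_analysis.
From HB Require Import structures.
From mathcomp Require Import measurable_realfun ess_sup_inf ring lra.
Set Implicit Arguments.
Unset Strict Implicit.
Unset Printing Implicit Defensive.
Import Order.TTheory GRing.Theory Num.Theory.
Import numFieldNormedType.Exports.
Local Open Scope classical_set_scope.
Local Open Scope ring_scope.

(** The cubic damping has exactly the homogeneity that the difference estimate needs. A Gronwall
    argument on |p| |q(s + h) - q(s)|^2 would only give exponential growth; with x = |q(s + h) -
    q(s)| / h that term is h^2 |p| x^2 <= h^2 (|p|^3 + x^3), and both cubes are dissipated by V with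
    a finite total, uniformly in h. The Taylor remainder is there because k1 is not monotone: it
    trades the force difference times the speed difference for a second-order remainder of k1 times
    p. The hypotheses give the equation in integrated form only, without differentiability of y(t)
    in the phase space. It is therefore replaced by the expansion y(t + h) = T(h) y(t) + h N y(t) +
    o(h), and every differential inequality is a bound on an upper right Dini derivative. The tip
    position is still right differentiable, because q = p o A^-1 and A^-1 y(t) has a right
    derivative. Contractivity of T must be derived from dissipativity; this requires orbits of T to
    be continuous in time from the left as well, which is extracted from the mild solutions. *)

Section interval_integrals.
Context {R : realType}.
Notation mu := (@lebesgue_measure R).
Implicit Types (a b c x y : R) (f g : R -> R).

(** * Lebesgue integrals over intervals *)

Lemma measurable_set_itv (i : interval R) : @measurable _ (measurableTypeR R) [set` i].
Proof. exact: measurable_itv. Qed.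

Lemma integrable_subitv a b x y f : a <= x -> y <= b ->
  mu.-integrable `[a, b] (EFin \o f) -> mu.-integrable `[x, y] (EFin \o f).
Proof.
move=> ax yb; apply: (integrableS (measurable_set_itv _) (measurable_set_itv _)).
by apply: subset_itv; rewrite bnd_simp.
Qed.

Lemma Rintegral_split a x y f : a <= x <= y -> mu.-integrable `[a, y] (EFin \o f) ->
  \int[mu]_(t in `[a, y]) f t = \int[mu]_(t in `[a, x]) f t + \int[mu]_(t in `[x, y]) f t.
Proof.
move=> /andP[ax xy] fi.
have fi' : mu.-integrable `]x, y] (EFin \o f).
  apply: (integrableS (measurable_set_itv _) (measurable_set_itv _) _ fi).
  by apply: subset_itv; rewrite bnd_simp.
have := Rintegral_itvB fi (_ : (BLeft a <= BRight x)%O) (_ : (BRight x <= BRight y)%O).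
rewrite !bnd_simp => /(_ ax xy); rewrite Rintegral_itv_obnd_cbnd// => <-.
by rewrite addrC subrK.
Qed.

Lemma Rintegral_itv1 x f : \int[mu]_(t in `[x, x]) f t = 0.
Proof. by rewrite set_itv1 Rintegral_set1. Qed.

Lemma primitive_onB a b f g x y : primitive_on a b f g -> a <= x -> x <= y -> y <= b ->
  f y - f x = \int[mu]_(t in `[x, y]) g t.
Proof.
move=> [gi fE] ax xy yb.
have ay := le_trans ax xy; have xb := le_trans xy yb.
rewrite (fE y) ?in_itv/= ?ay// (fE x) ?in_itv/= ?ax//.
rewrite (@Rintegral_split a x y) ?ax//; first by ring.
exact: integrable_subitv gi.
Qed.

Lemma Rintegral_itv_cst x y c : x <= y -> \int[mu]_(t in `[x, y]) c = c * (y - x).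
Proof.
move=> xy; rewrite (Rintegral_cst mu (measurable_set_itv _)).
congr (_ * _); have := @lebesgue_measure_itv R `[x, y]; rewrite /= lte_fin => H.
rewrite [X in fine X](_ : _ = if x < y then (y%:E - x%:E)%E else 0%E)//.
by case: ltgtP xy => //= -> _; rewrite subrr.
Qed.

Lemma Rintegral_itv_le x y f (M : R) : x <= y -> mu.-integrable `[x, y] (EFin \o f) ->
  (forall t, x <= t <= y -> `|f t| <= M) -> `|\int[mu]_(t in `[x, y]) f t| <= M * (y - x).
Proof.
move=> xy fi fM; rewrite -(Rintegral_itv_cst _ xy).
apply: (le_trans (le_normr_Rintegral (measurable_set_itv _) fi)).
apply: (le_Rintegral (measurable_set_itv _)).
- by have := integrable_norm fi.
- by have := @continuous_compact_integrable R (cst M) `[x, y]%classic; apply; [exact: segment_compact|exact: cst_continuous].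
- by move=> t /=; rewrite in_itv/=; exact: fM.
Qed.

Lemma continuous_itv_integrable f x y : continuous f -> mu.-integrable `[x, y] (EFin \o f).
Proof.
move=> cf; apply: continuous_compact_integrable; first exact: segment_compact.
exact: continuous_subspaceT.
Qed.

Lemma is_derive_Rintegral f a x : continuous f -> a < x ->
  is_derive x (1 : R) (fun y => \int[mu]_(t in `[a, y]) f t) (f x).
Proof.
move=> cf ax; have xu : x < x + 1 by rewrite ltrDl.
have H := continuous_FTC1_closed xu (continuous_itv_integrable a (x + 1) cf) ax (cf x).
case: H => d1 d2; split; first exact: d1.
by rewrite -d2 derive1E.
Qed.

Lemma is_derive_oriented_integral f x : continuous f ->
  is_derive x (1 : R) (fun z => oriented_integral 0 z f) (f x).
Proof.
(* Starting from a point [a] below both x and 0, the oriented integral is near x one ordinary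
   integral minus a constant, whatever the sign of x. *)
move=> cf; pose a := Num.min x 0 - 1.
have ax : a < x by rewrite /a ltrBlDr gt_min; apply/orP; left; lra.
have a0 : a < 0 by rewrite /a ltrBlDr gt_min; apply/orP; right; lra.
have fi y : mu.-integrable `[a, y] (EFin \o f) by exact: continuous_itv_integrable.
have H := is_deriveB (is_derive_Rintegral cf ax) (is_derive_cst (\int[mu]_(t in `[a, 0]) f t) x (1 : R)).
rewrite subr0 in H; apply: near_eq_is_derive H.
have : nbhs x `]a, (x + 1)[%classic by apply: near_in_itvoo; rewrite in_itv/= ax/=; lra.
apply: filterS => y; rewrite /= in_itv/= => /andP[ay _].
rewrite fctE/= /oriented_integral; case: ifPn => [y0|]; last rewrite -ltNge => y0.
  by rewrite (@Rintegral_split a 0 y) ?y0 ?(ltW a0)// addrC addKr.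
by rewrite (@Rintegral_split a y 0) ?(ltW ay) ?(ltW y0)// opprD addrA subrr add0r.
Qed.

End interval_integrals.

(** * Calculus of right derivatives and Dini bounds *)

Section right_derivative.
Context {R : realType}.
Implicit Types (X : normedModType R) (a b t l e : R).

(** Right differentiability with the quotient multiplied out, for values in any normed space. *)
Definition rderiv X (f : R -> X) t (l : X) :=
  forall e : R, 0 < e -> \forall h \near 0^'+, `|f (t + h) - f t - h *: l| <= e * h.

(** The upper right Dini derivative of f at t is at most l: all that an energy inequality
    provides. *)
Definition dini_le (f : R -> R) t l :=
  forall e : R, 0 < e -> \forall h \near 0^'+, f (t + h) <= f t + (l + e) * h.

Lemma near0_gt0 (P : R -> Prop) : (forall h, 0 < h -> P h) -> \forall h \near (0:R)^'+, P h.
Proof. by move=> H; near=> h; apply: H; near: h; exact: nbhs_right_gt. Unshelve. all: by end_near. Qed.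

Lemma near0_lt e (P : R -> Prop) : 0 < e -> (forall h, 0 < h < e -> P h) ->
  \forall h \near (0:R)^'+, P h.
Proof.
move=> e0 H; near=> h; apply: H; apply/andP; split; near: h.
  exact: nbhs_right_gt.
exact: nbhs_right_lt.
Unshelve. all: by end_near. Qed.

Lemma near0_exists (P : R -> Prop) : (\forall h \near (0:R)^'+, P h) ->
  exists2 d : R, 0 < d & forall h, 0 < h < d -> P h.
Proof.
move=> [d /= d0 H]; exists d => // h /andP[h0 hd]; apply: H => //=.
by rewrite sub0r normrN gtr0_norm.
Qed.

(** For each e > 0 the graph stays below the line of slope e through (a, f a): the supremum of the
    times up to which this holds is attained by continuity, and the Dini bound would prolong it if
    it were less than b. Then e tends to 0. *)
Lemma dini_nonincr (f : R -> R) a b : continuous f -> a <= b ->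
  (forall t, a <= t < b -> dini_le f t 0) -> f b <= f a.
Proof.
move=> cf ab df; apply/ler_addgt0Pr => e e0.
(* The + 1 keeps the rescaled slope meaningful when a = b. *)
have {e e0} [e -> e0] : exists2 e', e = e' * (b - a + 1) & 0 < e'.
  exists (e / (b - a + 1)); last by rewrite divr_gt0//; lra.
  by field; apply/eqP; lra.
suff : f b <= f a + e * (b - a) by move=> /le_trans; apply; rewrite lerD2l; nra.
pose E : set R := [set x | a <= x <= b /\ forall z, a <= z <= x -> f z <= f a + e * (z - a)].
have Ea : E a.
  split; first by rewrite lexx.
  move=> z za; have -> : z = a by lra.
  by rewrite subrr mulr0 addr0.
have hE : has_sup E.
  by split; [exists a|exists b => x [/andP[]]].
set s := sup E.
have as_ : a <= s by exact: sup_ubound hE.2 _ Ea.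
have sb : s <= b by apply: sup_le_ub; [exists a|move=> x [/andP[]]].
have below z : a <= z < s -> f z <= f a + e * (z - a).
  move=> /andP[az zs]; have /(sup_adherent)/(_ hE)[x [xab Ex]] : 0 < s - z by lra.
  rewrite -/s => zx; apply: Ex; lra.
have fs : f s <= f a + e * (s - a).
  have [<-|nas] := eqVneq a s; first by rewrite subrr mulr0 addr0.
  have as' : a < s by rewrite lt_neqAle nas.
  apply/ler_addgt0Pr => d d0.
  have /cvgr_dist_lt/(_ _ d0) := cf s.
  move=> /nbhs_ballP[r r0 Hr].
  have [z zin] : exists z, a <= z < s /\ s - r < z.
    exists (Num.max a (s - r / 2)); move: r0 => /= r0.
    by rewrite le_max lexx gt_max lt_max as'/=; split; [lra|apply/orP; right; lra].
  have zb : ball s r z by rewrite /ball/= ltr_norml; move: r0 => /=; lra.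
  have := below z zin.1; have := Hr z zb; rewrite /= ltr_norml.
  have : 0 <= e * (s - z) by rewrite mulr_ge0//; lra.
  by rewrite !mulrBr; lra.
have [->//|nsb] := eqVneq b s; have {}sb : s < b by rewrite lt_neqAle eq_sym nsb.
have /df/(_ e e0)/near0_exists[d d0 Hd] : a <= s < b by rewrite as_ sb.
pose r := Num.min (d / 2) (b - s).
have r0 : 0 < r by rewrite lt_min; apply/andP; split; lra.
have rd : r < d by rewrite gt_min; apply/orP; left; lra.
have rb : r <= b - s by rewrite ge_min lexx orbT.
have : E (s + r).
  split; first lra.
  move=> z zin; have [zs|sz] := ltP z s; first by apply: below; lra.
  have [->//|nzs] := eqVneq z s.
  have {nzs}sz : s < z by rewrite lt_neqAle eq_sym nzs.
  have := Hd (z - s) ltac:(lra); rewrite (_ : s + (z - s) = z); last by ring.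
  nra.
move=> /(sup_ubound hE.2); rewrite -/s; lra.
Qed.

Lemma rderiv_cvg X (f : R -> X) t (l : X) : rderiv f t l -> f (t + h) @[h --> 0^'+] --> f t.
Proof.
move=> df; apply/cvgrPdist_le => e e0.
have /df : (0 : R) < 1 by [].
move=> /near0_exists[d d0 H].
have M0 : 0 < 1 + `|l| by rewrite ltr_pwDl.
apply: (@near0_lt (Num.min d (e / (1 + `|l|)))); first by rewrite lt_min d0 divr_gt0.
move=> h /andP[h0]; rewrite lt_min ltr_pdivlMr// => /andP[hd he].
rewrite distrC; have -> : f (t + h) - f t = (f (t + h) - f t - h *: l) + h *: l by rewrite subrK.
rewrite (le_trans (ler_normD _ _))// normrZ gtr0_norm//.
have := H h ltac:(by rewrite h0 hd); rewrite mul1r; lra.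
Qed.

Lemma rderivD X (f g : R -> X) t (l k : X) : rderiv f t l -> rderiv g t k ->
  rderiv (fun s => f s + g s) t (l + k).
Proof.
move=> df dg e e0; have e2 : 0 < e / 2 by rewrite divr_gt0.
have := df _ e2; have := dg _ e2; apply: filterS2 => h gh fh.
have -> : f (t + h) + g (t + h) - (f t + g t) - h *: (l + k) =
   (f (t + h) - f t - h *: l) + (g (t + h) - g t - h *: k).
  by rewrite scalerDr !opprD [RHS]addrACA; congr (_ + _); rewrite addrACA.
by rewrite (le_trans (ler_normD _ _))//; lra.
Qed.

Lemma rderivZ X c (f : R -> X) t (l : X) : rderiv f t l ->
  rderiv (fun s => c *: f s) t (c *: l).
Proof.
move=> df e e0; have M0 : 0 < `|c| + 1 by rewrite ltr_wpDl.
have e2 : 0 < e / (`|c| + 1) by rewrite divr_gt0.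
have := df _ e2.
have : \forall h \near (0:R)^'+, 0 < h by exact: near0_gt0.
apply: filterS2 => h h0 fh.
have -> : c *: f (t + h) - c *: f t - h *: (c *: l) = c *: (f (t + h) - f t - h *: l).
  by rewrite !scalerBr !scalerA (mulrC h).
rewrite normrZ (@le_trans _ _ (`|c| * (e / (`|c| + 1) * h)))//.
  by rewrite ler_wpM2l.
rewrite mulrA ler_wpM2r ?(ltW h0)// mulrA ler_pdivrMr//; nra.
Qed.

Lemma rderivN (f : R -> R) t l : rderiv f t l -> rderiv (fun s => - f s) t (- l).
Proof.
move=> /(rderivZ (-1)); rewrite scaleN1r.
by congr rderiv; apply/funext => s; rewrite scaleN1r.
Qed.

Lemma rderivB (f g : R -> R) t l k : rderiv f t l -> rderiv g t k ->
  rderiv (fun s => f s - g s) t (l - k).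
Proof. by move=> df /rderivN; exact: rderivD. Qed.

Lemma rderivM (f g : R -> R) t l k : rderiv f t l -> rderiv g t k ->
  rderiv (fun s => f s * g s) t (l * g t + f t * k).
Proof.
move=> df dg e e0.
have [d0 d00 [dd0 [dd1 dd2]]] : exists2 d, 0 < d &
    d * `|g t| <= e / 4 /\ d * (`|f t| + 1) <= e / 4 /\ d * `|k| <= e / 4.
  have M0 : 0 < `|f t| + `|g t| + `|k| + 1.
    by have := normr_ge0 (f t); have := normr_ge0 (g t); have := normr_ge0 k; lra.
  exists (e / 4 / (`|f t| + `|g t| + `|k| + 1)); first by rewrite !divr_gt0//; lra.
  have e4 : 0 < e / 4 by lra.
  have H x : 0 <= x -> x <= `|f t| + `|g t| + `|k| + 1 ->
     e / 4 / (`|f t| + `|g t| + `|k| + 1) * x <= e / 4.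
    by move=> x0 xM; rewrite mulrAC ler_pdivrMr// ler_wpM2l// ltW.
  by have := normr_ge0 (f t); have := normr_ge0 (g t); have := normr_ge0 k;
    do !split; apply: H; lra.
have c1 : \forall h \near (0:R)^'+, `|f (t + h) - f t| <= Num.min d0 1.
  by have /cvgrPdist_le/(_ (Num.min d0 1)) := rderiv_cvg df; rewrite lt_min d00 ltr01 => /(_ isT);
     apply: filterS => h; rewrite distrC.
have c3 : \forall h \near (0:R)^'+, 0 < h by exact: near0_gt0.
have := df _ d00; have := dg _ d00;
have : \forall h \near (0:R)^'+, `|f (t + h) - f t| <= Num.min d0 1 /\ 0 < h.
  by move: c1 c3; apply: filterS2 => h.
apply: filterS3 => h [+ h0] dgh dfh; rewrite le_min => /andP[c1' c1''].
have -> : f (t + h) * g (t + h) - f t * g t - h *: (l * g t + f t * k) =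
  (f (t + h) - f t - h * l) * g t + f (t + h) * (g (t + h) - g t - h * k)
  + (f (t + h) - f t) * (h * k) by rewrite /GRing.scale/=; ring.
have ft : `|f (t + h)| <= `|f t| + 1.
  by have := ler_normD (f t) (f (t + h) - f t); rewrite addrC subrK; lra.
rewrite (le_trans (ler_normD _ _))// (le_trans (lerD (ler_normD _ _) (lexx _)))// !normrM (gtr0_norm h0).
have H1 : `|f (t + h) - f t - h * l| * `|g t| <= e / 4 * h.
  rewrite (@le_trans _ _ (d0 * h * `|g t|))// ?ler_wpM2r//.
  by rewrite mulrAC ler_wpM2r// ltW.
have H2 : `|f (t + h)| * `|g (t + h) - g t - h * k| <= e / 4 * h.
  apply: (@le_trans _ _ ((`|f t| + 1) * (d0 * h))); first exact: ler_pM.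
  by rewrite mulrA ler_wpM2r ?(ltW h0)// mulrC.
have H3 : `|f (t + h) - f t| * (h * `|k|) <= e / 4 * h.
  apply: (@le_trans _ _ (d0 * (h * `|k|))).
    by rewrite ler_wpM2r// mulr_ge0// ltW.
  by rewrite mulrCA mulrC ler_wpM2r// ltW.
have : 0 < e * h by rewrite mulr_gt0.
lra.
Qed.

(** The outer function needs a two-sided derivative, since [f (t + h)] may lie on either side of
    [f t]. *)
Lemma rderiv_comp (f g : R -> R) t l k : rderiv f t l -> is_derive (f t) 1 g k ->
  rderiv (fun s => g (f s)) t (k * l).
Proof.
move=> df [dg gk].
have {gk}cg : h^-1 *: (g (h + f t) - g (f t)) @[h --> 0^'] --> k.
  rewrite -gk; move: dg; rewrite /derivable /derive.
  suff -> : (fun h : R => h^-1 *: (g (h + f t) - g (f t))) =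
     (fun h : R => h^-1 *: ((g \o shift (f t)) (h *: 1) - g (f t))) by [].
  by apply/funext => h /=; rewrite scaler1.
have {}cg e : 0 < e -> exists2 d : R, 0 < d & forall x, `|x - f t| < d ->
    `|g x - g (f t) - k * (x - f t)| <= e * `|x - f t|.
  move=> e0; have /cvgrPdist_le/(_ _ e0) := cg.
  move=> [d /= d0 H]; exists d => // x xd.
  have [->|xf] := eqVneq x (f t); first by rewrite !subrr mulr0 subrr normr0 mulr0.
  have x0 : x - f t != 0 by rewrite subr_eq0.
  have := H (x - f t); rewrite /= sub0r normrN => /(_ xd x0).
  rewrite subrK => Hx.
  have -> : g x - g (f t) - k * (x - f t) = - ((x - f t) * (k - (x - f t)^-1 * (g x - g (f t)))).
    by field; rewrite x0.
  by rewrite normrN normrM mulrC ler_wpM2r.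
move=> e e0.
(* Near 0 the increment of f is at most A h, so a remainder of g that is small relative to this
   increment is small relative to h. *)
pose A := `|l| + 1; have A0 : 0 < A by rewrite /A ltr_wpDl.
have [d d0 Hd] := cg (e / 2 / A) ltac:(by rewrite !divr_gt0).
have B0 : 0 < `|k| + 1 by rewrite ltr_wpDl.
have e2 : 0 < Num.min 1 (e / 2 / (`|k| + 1)) by rewrite lt_min ltr01 !divr_gt0.
have := df _ e2.
have : \forall h \near (0:R)^'+, `|f (t + h) - f t| < d.
  by have /cvgrPdist_lt/(_ _ d0) := rderiv_cvg df; apply: filterS => h; rewrite distrC.
have : \forall h \near (0:R)^'+, 0 < h by exact: near0_gt0.
apply: filterS3 => h h0 fd dfh.
have fA : `|f (t + h) - f t| <= A * h.
  have -> : f (t + h) - f t = (f (t + h) - f t - h *: l) + h *: l by rewrite subrK.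
  rewrite (le_trans (ler_normD _ _))// normrZ gtr0_norm// /A mulrDl mul1r addrC (mulrC h) lerD2l.
  apply: (le_trans dfh); rewrite ler_piMl// ?(ltW h0)//.
  by rewrite ge_min lexx.
have -> : g (f (t + h)) - g (f t) - h *: (k * l) =
  (g (f (t + h)) - g (f t) - k * (f (t + h) - f t)) + k * (f (t + h) - f t - h * l).
  by rewrite /GRing.scale/=; ring.
rewrite (le_trans (ler_normD _ _))// normrM.
have H1 : `|g (f (t + h)) - g (f t) - k * (f (t + h) - f t)| <= e / 2 * h.
  apply: (le_trans (Hd _ fd)); rewrite (@le_trans _ _ (e / 2 / A * (A * h)))//.
    by rewrite ler_wpM2l// !divr_ge0// ?ltW.
  by rewrite mulrA divfK// ?gt_eqF.
have H2 : `|k| * `|f (t + h) - f t - h * l| <= e / 2 * h.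
  rewrite (@le_trans _ _ ((`|k| + 1) * (e / 2 / (`|k| + 1) * h)))//.
    rewrite ler_pM//; first by lra.
    apply: (le_trans dfh); rewrite ler_wpM2r ?(ltW h0)//.
    by rewrite ge_min lexx orbT.
  by rewrite le_eqVlt; apply/orP; left; apply/eqP; field; rewrite gt_eqF.
lra.
Qed.

Lemma rderiv_shift X (f : R -> X) t a (l : X) : rderiv f (t + a) l -> rderiv (fun s => f (s + a)) t l.
Proof. by move=> df e e0; have := df e e0; apply: filterS => h; rewrite (addrAC t). Qed.

Lemma rderiv_id t : rderiv id t (1 : R).
Proof.
move=> e e0; apply: near0_gt0 => h h0.
by rewrite /= (addrC t) addrK /GRing.scale/= mulr1 subrr normr0 mulr_ge0// ltW.
Qed.

Lemma is_derive_rderiv (f : R -> R) t l : is_derive t 1 f l -> rderiv f t l.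
Proof.
move=> df; have := @rderiv_comp id f t 1 l (rderiv_id t) df.
by rewrite mulr1.
Qed.

Lemma rderiv_dini (f : R -> R) t l : rderiv f t l -> dini_le f t l.
Proof.
move=> df e e0; have := df e e0; apply: filterS => h.
by rewrite /GRing.scale/= => /ler_normlW; nra.
Qed.

Lemma diniW f t l k : dini_le f t l -> l <= k -> dini_le f t k.
Proof.
move=> df lk e e0; have := df e e0.
have : \forall h \near (0:R)^'+, 0 < h by exact: near0_gt0.
apply: filterS2 => h h0 /le_trans; apply; rewrite lerD2l ler_wpM2r ?(ltW h0)//; lra.
Qed.

Lemma diniD f g t l k : dini_le f t l -> dini_le g t k ->
  dini_le (fun s => f s + g s) t (l + k).
Proof.
move=> df dg e e0; have e2 : 0 < e / 2 by rewrite divr_gt0.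
have := df _ e2; have := dg _ e2; apply: filterS2 => h gh fh.
by move: (lerD fh gh) => /le_trans; apply; rewrite le_eqVlt; apply/orP; left; apply/eqP; field.
Qed.

Lemma diniZ c f t l : 0 <= c -> dini_le f t l -> dini_le (fun s => c * f s) t (c * l).
Proof.
move=> c0 df e e0.
have M0 : 0 < c + 1 by rewrite ltr_wpDl.
have e2 : 0 < e / (c + 1) by rewrite divr_gt0.
have := df _ e2.
have : \forall h \near (0:R)^'+, 0 < h by exact: near0_gt0.
apply: filterS2 => h h0 fh.
apply: (le_trans (ler_wpM2l c0 fh)).
rewrite mulrDr lerD2l mulrA mulrDr ler_wpM2r ?(ltW h0)// lerD2l mulrA ler_pdivrMr//; nra.
Qed.

End right_derivative.

(** * Riemann sums of vector-valued functions *)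

Section riemann_sums.
Context {R : realType} {X : normedModType R}.
Implicit Types (a b c d : R) (f g : R -> X) (n : nat).

Lemma cvg_norm_le (u : nat -> X) (l : X) (M : R) : u n @[n --> \oo] --> l ->
  (forall n, `|u n| <= M) -> `|l| <= M.
Proof.
move=> ul uM; apply/ler_addgt0Pr => e e0.
have /cvgrPdist_le/(_ _ e0)[N _ /(_ N (leqnn N)) /= H] := ul.
have := ler_normD (l - u N) (u N); rewrite subrK; have := uM N; lra.
Qed.

Lemma divSn n (x : R) : n.+1%:R * (x / n.+1%:R) = x.
Proof. by rewrite mulrC divfK// pnatr_eq0. Qed.

Definition usum n a b f : X :=
  \sum_(i < n) ((b - a) / n%:R) *: f (a + i%:R * ((b - a) / n%:R)).

(** Specialising [is_integral] to uniform partitions turns it into the limit of a sequence, to which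
    norm bounds and continuous linear maps apply. The breakpoint c allows different estimates on its
    two sides. *)
Lemma is_integral_usum a b c f (I : X) : a <= c <= b -> is_integral a b f I ->
  usum n.+1 a c f + usum n.+1 c b f @[n --> \oo] --> I.
Proof.
move=> /andP[ac cb] fI; apply/cvgrPdist_le => e e0.
have [d d0 {}fI] := fI e e0.
have [N hN] : exists N : nat, (b - a) / d < N%:R.
  by exists (Num.truncn ((b - a) / d)).+1; exact: truncnS_gt.
exists N => // n /= Nn; rewrite distrC.
have n0 : (0 : R) < n.+1%:R by rewrite ltr0n.
have Nn' : N%:R <= n.+1%:R :> R by rewrite ler_nat leqW.
pose h1 := (c - a) / n.+1%:R; pose h2 := (b - c) / n.+1%:R.
have h10 : 0 <= h1 by rewrite divr_ge0 ?ler0n//; lra.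
have h20 : 0 <= h2 by rewrite divr_ge0 ?ler0n//; lra.
have h1d : h1 < d.
  rewrite ltr_pdivrMr// (le_lt_trans (_ : _ <= b - a))//; first by lra.
  by rewrite -ltr_pdivrMl// mulrC (lt_le_trans hN).
have h2d : h2 < d.
  rewrite ltr_pdivrMr// (le_lt_trans (_ : _ <= b - a))//; first by lra.
  by rewrite -ltr_pdivrMl// mulrC (lt_le_trans hN).
(* The minimum counts the steps of length h1 already made, and the truncated difference those of
   length h2. *)
pose p i := a + (minn i n.+1)%:R * h1 + (i - n.+1)%:R * h2.
have p1 i : (i <= n.+1)%N -> p i = a + i%:R * h1.
  by move=> i1; rewrite /p (minn_idPl i1) (eqP (_ : (i - n.+1)%N == 0%N)) ?mul0r ?addr0// subn_eq0.
have p2 i : (n.+1 <= i)%N -> p i = c + (i - n.+1)%:R * h2.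
  by move=> i1; rewrite /p (minn_idPr i1); rewrite /h1 divSn; congr (_ + _); ring.
have dp1 i : (i < n.+1)%N -> p i.+1 - p i = h1.
  by move=> i1; rewrite !p1// ?(ltnW i1)// -[i.+1]addn1 natrD; ring.
have dp2 i : (n.+1 <= i)%N -> p i.+1 - p i = h2.
  by move=> i1; rewrite !p2// ?(leqW i1)// subSn// -[(i - n.+1).+1]addn1 natrD; ring.
have := fI (n.+1 + n.+1)%N p p.
rewrite big_split_ord/=.
have -> : \sum_(i < n.+1) (p i.+1 - p i) *: f (p i) = usum n.+1 a c f.
  by apply: eq_bigr => i _; rewrite dp1// p1 ?(ltnW (ltn_ord i)).
have -> : \sum_(i < n.+1) (p (n.+1 + i)%N.+1 - p (n.+1 + i)%N) *: f (p (n.+1 + i)%N) = usum n.+1 c b f.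
  by apply: eq_bigr => i _; rewrite dp2 ?leq_addr// p2 ?leq_addr// addKn.
move=> H; apply/ltW/H.
- by rewrite p1// mul0r addr0.
- by rewrite p2 ?leq_addr// addKn divSn; ring.
- move=> i _; rewrite lexx/=.
  by case: (ltnP i n.+1) => ni; [have := dp1 _ ni|have := dp2 _ ni] => dp; split; lra.
Qed.

Lemma usum_itv n a b i : a <= b -> (i < n.+1)%N -> a <= a + i%:R * ((b - a) / n.+1%:R) <= b.
Proof.
move=> ab ni; have n0 : (0 : R) < n.+1%:R by rewrite ltr0n.
have : i%:R * ((b - a) / n.+1%:R) <= n.+1%:R * ((b - a) / n.+1%:R).
  by rewrite ler_wpM2r ?ler_nat ?(ltnW ni)// divr_ge0 ?ler0n//; lra.
rewrite divSn.
have : 0 <= i%:R * ((b - a) / n.+1%:R).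
  by rewrite mulr_ge0 ?ler0n// divr_ge0 ?ler0n//; lra.
by move: (i%:R * _) => r; lra.
Qed.

Lemma usum_cst n a b (v : X) : usum n.+1 a b (fun=> v) = (b - a) *: v.
Proof.
by rewrite /usum sumr_const card_ord -scaler_nat scalerA divSn.
Qed.

Lemma usumB n a b f g : usum n a b f - usum n a b g = usum n a b (fun s => f s - g s).
Proof. by rewrite /usum -sumrB; apply: eq_bigr => i _; rewrite scalerBr. Qed.

Lemma usum_le n a b f (M : R) : a <= b -> (forall x, a <= x <= b -> `|f x| <= M) ->
  `|usum n.+1 a b f| <= (b - a) * M.
Proof.
move=> ab fM; rewrite (le_trans (ler_norm_sum _ _ _))//.
have h0 : 0 <= (b - a) / n.+1%:R by rewrite divr_ge0 ?ler0n//; lra.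
rewrite (@le_trans _ _ (\sum_(i < n.+1) (b - a) / n.+1%:R * M))//.
  apply: ler_sum => i _; rewrite normrZ ger0_norm// ler_wpM2l//.
  by apply: fM; exact: usum_itv.
by rewrite sumr_const card_ord -[X in X <= _]mulr_natl mulrA divSn.
Qed.

Lemma eq_usum n a b f g : a <= b -> (forall x, a <= x <= b -> f x = g x) ->
  usum n.+1 a b f = usum n.+1 a b g.
Proof. by move=> ab fg; apply: eq_bigr => i _; rewrite fg//; exact: usum_itv. Qed.

Lemma usum_shift n a b c f : usum n (a + c) (b + c) f = usum n a b (fun s => f (s + c)).
Proof.
rewrite /usum (_ : b + c - (a + c) = b - a); last by ring.
by apply: eq_bigr => i _; congr (_ *: f _); ring.
Qed.

Lemma usum0 n a f : usum n a a f = 0.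
Proof. by rewrite /usum subrr mul0r big1// => i _; rewrite scale0r. Qed.

Lemma usum_linear n a b f (T : X -> X) : linear T ->
  usum n a b (fun s => T (f s)) = T (usum n a b f).
Proof.
move=> lT; pose t := GRing.isLinear.Build _ _ _ _ T lT.
pose TT : {linear X -> X} := HB.pack T t.
by rewrite -[T]/(TT : X -> X) /usum linear_sum; apply: eq_bigr => i _; rewrite linearZ.
Qed.

(** Made for Duhamel integrals at two times c <= b, with T the semigroup over b - c: up to time c
    the later integrand is the image of the earlier one, and on [c, b] it is nearly constant. T
    commutes with the sums and with the limit. *)
Lemma is_integral_split a b c f g (I J v : X) (T : X -> X) (e : R) :
  a <= c <= b -> is_integral a b f I -> is_integral a c g J ->
  linear T -> continuous T ->
  (forall x, a <= x <= c -> f x = T (g x)) ->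
  (forall x, c <= x <= b -> `|f x - v| <= e) ->
  `|I - T J - (b - c) *: v| <= (b - c) * e.
Proof.
move=> /[dup] acb /andP[ac cb] fI gJ lT cT fT fv.
have cf := is_integral_usum acb fI.
have := is_integral_usum (_ : a <= c <= c) gJ; rewrite ac lexx => /(_ isT).
under eq_fun do rewrite usum0 addr0.
move=> /(cvg_comp _ T)/(_ (cT J)) cg.
have {}cg : usum n.+1 a c f @[n --> \oo] --> T J.
  rewrite (_ : (fun n => usum n.+1 a c f) = T \o (fun n => usum n.+1 a c g))//.
  by apply/funext => n /=; rewrite -usum_linear//; exact: eq_usum.
apply: (cvg_norm_le (cvgB (cvgB cf cg) (cvg_cst ((b - c) *: v)))) => n.
rewrite !fctE /= [usum _ _ _ f + _]addrC addrK -(usum_cst n) usumB.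
exact: usum_le.
Qed.

(** Compares the Duhamel integrals at times b and b - d after a shift of the variable; the piece
    [0, d] left over is only bounded. *)
Lemma is_integral_shift b d f g (I J : X) (M e : R) :
  0 <= d <= b -> is_integral 0 b f I -> is_integral 0 (b - d) g J ->
  (forall x, 0 <= x <= d -> `|f x| <= M) ->
  (forall x, 0 <= x <= b - d -> `|f (x + d) - g x| <= e) ->
  `|I - J| <= d * M + (b - d) * e.
Proof.
move=> /[dup] db /andP[d0 bd] fI gJ fM fg.
have cf := is_integral_usum db fI.
have bd0 : 0 <= b - d by lra.
have := is_integral_usum (_ : 0 <= b - d <= b - d) gJ; rewrite bd0 lexx => /(_ isT).
under eq_fun do rewrite usum0 addr0.
move=> cg; apply: (cvg_norm_le (cvgB cf cg)) => n.
rewrite !fctE /= -addrA.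
have -> : usum n.+1 d b f = usum n.+1 0 (b - d) (fun s => f (s + d)).
  by rewrite -usum_shift add0r subrK.
rewrite usumB (le_trans (ler_normD _ _))// lerD//.
  by have := usum_le n d0 fM; rewrite subr0.
by have := usum_le n bd0 fg; rewrite subr0.
Qed.

(** In a partition fine enough for sums to be within 1 of I, moving the single tag of the cell
    containing x changes the sum by h times [f x - f (p i)]; hence this difference is at most 2 /
    h. *)
Lemma is_integral_bounded a b f (I : X) : a <= b -> is_integral a b f I ->
  exists M, forall x, a <= x <= b -> `|f x| <= M.
Proof.
rewrite le_eqVlt => /predU1P[<- _|ab fI].
  by exists `|f a| => x; rewrite -eq_le => /eqP <-.
have [d d0 {}fI] := fI 1 ltr01.
have [n hn] : exists N : nat, (b - a) / d < N%:R.
  by exists (Num.truncn ((b - a) / d)).+1; exact: truncnS_gt.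
have n0 : (0 : R) < n%:R by apply: le_lt_trans hn; rewrite divr_ge0 ?ltW//; lra.
pose h := (b - a) / n%:R; pose p i := a + i%:R * h.
have h0 : 0 < h by rewrite divr_gt0//; lra.
have hd : h < d by rewrite ltr_pdivrMr// -ltr_pdivrMl// mulrC.
have dp i : p i.+1 - p i = h by rewrite /p -[i.+1]addn1 natrD; ring.
have pn : p n = b by rewrite /p /h; field; rewrite gt_eqF.
have pa : p 0%N = a by rewrite /p mul0r addr0.
exists (\sum_(i < n) `|f (p i)| + 2 / h) => x xab.
have [i ni xi] : exists2 i, (i < n)%N & p i <= x <= p i.+1.
  have : exists i, (i < n)%N && (x <= p i.+1).
    by exists n.-1; rewrite prednK -?(ltr0n R)// leqnn pn; case/andP: xab => _ ->.
  move=> /ex_minnP[i /andP[ni xi] mi]; exists i => //; rewrite xi andbT.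
  case: i ni xi mi => [|i] ni xi mi; first by rewrite pa; case/andP: xab.
  rewrite leNgt; apply/negP => xpi.
  by have := mi i; rewrite (ltnW ni) (ltW xpi) => /(_ isT); rewrite ltnn.
pose tau j := if j == i then x else p j.
have H1 := fI n p p pa pn.
have H2 := fI n p tau pa pn.
have {}H1 := H1 ltac:(move=> j _; have := dp j; split; lra).
have {}H2 : `|\sum_(i < n) (p i.+1 - p i) *: f (tau i) - I| < 1.
  apply: H2 => j _; have := dp j; rewrite /tau; case: eqP => [->|_]; split; lra.
have := ler_distD I (\sum_(i < n) (p i.+1 - p i) *: f (tau i)) (\sum_(i < n) (p i.+1 - p i) *: f (p i)).
rewrite -sumrB (bigD1 (Ordinal ni))//= big1 ?addr0; last first.
  by move=> j /negP ji; rewrite /tau ifN ?subrr//; apply/negP => /eqP e; apply: ji; apply/eqP/val_inj.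
rewrite -scalerBr normrZ dp gtr0_norm// /tau eqxx (distrC I) => H3.
have {H1 H2}H3 : `|f x - f (p i)| <= 2 / h by rewrite ler_pdivlMr// mulrC; lra.
have := ler_normD (f x - f (p i)) (f (p i)); rewrite subrK.
have : `|f (p i)| <= \sum_(i < n) `|f (p i)|.
  by rewrite (bigD1 (Ordinal ni))//= lerDl sumr_ge0.
lra.
Qed.

End riemann_sums.

Lemma subr_sub_sub (V : zmodType) (a b c d : V) : (a - b) - ((a - c) - (b - d)) = c - d.
Proof. by rewrite (opprD b) (addrACA a) -(opprD c) subKr. Qed.

(** * Continuity in time on the half-line *)

Lemma nbhs_continuous_right0 {R : realType} {X : normedModType R} (f : R -> X) (t : R) :
  f (t + h) @[h --> 0^'+] --> f t -> f (t - h) @[h --> 0^'+] --> f t ->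
  f x @[x --> t] --> f t.
Proof.
move=> /cvgrPdist_le fr /cvgrPdist_le fl; apply/left_right_continuousP; split; apply/cvgrPdist_le => e e0.
  by apply/nbhs_left0P; exact: fl.
by apply/nbhs_right0P; exact: fr.
Qed.

(** Freezing f at its value at 0 for negative times yields a function continuous on the whole line,
    as [dini_nonincr] requires. *)
Lemma continuous_max0 {R : realType} {X : normedModType R} (f : R -> X) :
  (forall t, 0 <= t -> f (t + h) @[h --> 0^'+] --> f t) ->
  (forall t, 0 < t -> f (t - h) @[h --> 0^'+] --> f t) ->
  continuous (fun t : R => f (Num.max 0 t)).
Proof.
move=> fr fl t; have [t0|t0|t0] := ltgtP 0 t.
- apply: nbhs_continuous_right0; rewrite (max_idPr (ltW t0)).
    apply: cvg_trans (fr t (ltW t0)); apply: near_eq_cvg; apply: near0_gt0 => h h0.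
    by rewrite (max_idPr _)//; lra.
  apply: cvg_trans (fl t t0); apply: near_eq_cvg; apply: (near0_lt t0) => h /andP[h0 ht].
  by rewrite (max_idPr _)//; lra.
- apply: nbhs_continuous_right0; rewrite (max_idPl (ltW t0)).
    have t0' : 0 < - t by lra.
    apply: cvg_near_cst; apply: (near0_lt t0') => h /andP[h0 ht]; rewrite (max_idPl _)//; lra.
  apply: cvg_near_cst; apply: near0_gt0 => h h0; rewrite (max_idPl _)//; lra.
- rewrite -t0; apply: nbhs_continuous_right0; rewrite maxxx.
    apply: cvg_trans (fr 0 (lexx _)); apply: near_eq_cvg; apply: near0_gt0 => h h0.
    by rewrite (max_idPr _)//; lra.
  apply: cvg_near_cst; apply: near0_gt0 => h h0; rewrite (max_idPl _)//; lra.
Qed.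

Lemma within_continuous_max0 {R : realType} {X : normedModType R} (f : R -> X) :
  {within `[0, +oo[, continuous f} -> continuous (fun t : R => f (Num.max 0 t)).
Proof.
move=> /continuous_within_itvcyP[cf c0].
have ct (t : R) : 0 < t -> f x @[x --> t] --> f t by move=> t0; apply: cf; rewrite in_itv/= t0.
have rt (t : R) : f x @[x --> t^'+] --> f t -> f (t + h) @[h --> 0^'+] --> f t.
  by move=> /cvgrPdist_le H; apply/cvgrPdist_le => e e0; apply/(nbhs_right0P t (fun y => `|f t - f y| <= e)); exact: H.
apply: continuous_max0 => t t0; last first.
  have /left_right_continuousP[/cvgrPdist_le H _] := ct t t0.
  by apply/cvgrPdist_le => e e0; apply/(nbhs_left0P t (fun y => `|f t - f y| <= e)); exact: H.
apply: rt; move: t0; rewrite le_eqVlt => /predU1P[<-//|t0].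
by have /left_right_continuousP[] := ct t t0.
Qed.

Lemma continuous_norm_sqr {R : realType} {X : normedModType R} (f : R -> X) :
  continuous f -> continuous (fun s : R => `|f s| ^+ 2).
Proof.
move=> cf s; have H : `|f x| @[x --> s] --> `|f s| by apply: cvg_norm; exact: cf.
by have := cvgM H H; apply.
Qed.

Lemma unif_continuous_right {R : realType} {X : normedModType R} (f : R -> X) (a b e : R) :
  continuous f -> 0 < e -> \forall h \near (0:R)^'+, forall x, a <= x <= b -> `|f (x + h) - f x| <= e.
Proof.
move=> cf e0; have /compact_near_coveringP := @segment_compact R a b.
move=> /(_ _ (0:R)^'+ (fun h x => `|f (x + h) - f x| <= e)) H.
have {}H : \forall h \near (0:R)^'+, `[a, b] `<=` (fun x => `|f (x + h) - f x| <= e).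
  apply: H => x _.
  have e2 : 0 < e / 2 by rewrite divr_gt0.
  have /cvgrPdist_le/(_ _ e2) /nbhs_ballP[d /= d0 Hd] := cf x.
  exists (ball x (d / 2), [set h | 0 < h < d / 2]) => /=.
    split; first by apply: nbhsx_ballx; rewrite divr_gt0.
    by apply: (@near0_lt _ (d / 2)); rewrite ?divr_gt0.
  move=> [y h] /=; rewrite /ball/= ltr_norml => -[xy /andP[h0 hd]].
  have H1 := Hd y; rewrite /ball/= ltr_norml in H1.
  have H2 := Hd (y + h); rewrite /ball/= ltr_norml in H2.
  have := ler_distD (f x) (f (y + h)) (f y).
  rewrite (distrC (f (y + h)) (f x)).
  have := H1 ltac:(lra); have := H2 ltac:(lra); lra.
by apply: filterS H => h H x xab; apply: H; rewrite /= in_itv.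
Qed.

(** * The inner product on the quotient, and the Dini derivative of a squared norm *)

Section inner_product.
Context {R : realType} {E : semiInnerType R}.
Notation X := (hquot E).
Implicit Types (x y z : X).

Lemma hipC x y : hip x y = hip y x. Proof. exact: sipC. Qed.

Lemma hip_linear (a : R) x y z : hip (a *: x + y) z = a * hip x z + hip y z.
Proof.
elim/hpi_ind: x => x; elim/hpi_ind: y => y; elim/hpi_ind: z => z.
by rewrite -hpi_linear !hip_pi sipDl sipZl.
Qed.

Lemma hipDl x y z : hip (x + y) z = hip x z + hip y z.
Proof. by rewrite -[x in LHS]scale1r hip_linear mul1r. Qed.

Lemma hipZl (a : R) x z : hip (a *: x) z = a * hip x z.
Proof.
have h0 : hip 0 z = 0 by have := hipDl 0 0 z; rewrite addr0; lra.
by rewrite -[a *: x]addr0 hip_linear h0 addr0.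
Qed.

Lemma hipDr x y z : hip x (y + z) = hip x y + hip x z.
Proof. by rewrite hipC hipDl !(hipC x). Qed.

Lemma hipZr (a : R) x z : hip x (a *: z) = a * hip x z.
Proof. by rewrite hipC hipZl hipC. Qed.

Lemma hnorm_sqr x : `|x| ^+ 2 = hip x x.
Proof. by rewrite hnormE sqr_sqrtr//; elim/hpi_ind: x => x; rewrite hip_pi sip_ge0. Qed.

Lemma hip_CS x y : `|hip x y| <= `|x| * `|y|.
Proof.
rewrite -(@ler_pXn2r _ 2) ?nnegrE ?mulr_ge0// exprMn !hnorm_sqr -normrX ger0_norm ?sqr_ge0//.
by elim/hpi_ind: x => x; elim/hpi_ind: y => y; rewrite !hip_pi sip_CS.
Qed.

(** Expand the square of U h (f t) + h F + r. Contractivity of U bounds the first square by that of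
    f t, so the linear part drops out without f t being in the domain of a generator. In the cross
    term U h (f t) tends to f t, and the other terms are o(h). *)
Lemma dini_hnorm_sqr (f : R -> X) (U : R -> X -> X) t F :
  (forall h x, 0 <= h -> `|U h x| <= `|x|) ->
  U h (f t) @[h --> 0^'+] --> f t ->
  (forall e, 0 < e -> \forall h \near 0^'+, `|f (t + h) - U h (f t) - h *: F| <= e * h) ->
  dini_le (fun s => `|f s| ^+ 2) t (2 * hip (f t) F).
Proof.
move=> cU Ut df e e0.
have A0 : 0 < 2 * `|f t| + 1 by rewrite ltr_wpDl ?mulr_ge0.
(* The bound 1 serves the quadratic term, the other bound the product of u with the remainder; each
   of the three errors gets e / 3. *)
have d0 : 0 < Num.min 1 (e / 3 / (2 * `|f t| + 1)) by rewrite lt_min ltr01 !divr_gt0.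
have B0 : 0 < (`|F| + 1) ^+ 2 by rewrite exprn_gt0// ltr_wpDl.
have C0 : 0 < 2 * `|F| + 1 by rewrite ltr_wpDl ?mulr_ge0.
have e3 : 0 < e / 3 / (2 * `|F| + 1) by rewrite !divr_gt0.
have hb : \forall h \near (0:R)^'+, 0 < h < e / 3 / (`|F| + 1) ^+ 2.
  by apply: (@near0_lt _ (e / 3 / (`|F| + 1) ^+ 2)); rewrite ?divr_gt0.
move/cvgrPdist_le/(_ _ e3) : Ut.
move: (df _ d0) hb; apply: filterS3 => h; set r := _ - h *: F.
move=> rd /andP[h0 hl] Ud.
have -> : f (t + h) = U h (f t) + (h *: F + r) by rewrite /r (addrC (h *: F)) subrK [RHS]addrC subrK.
set u := U h (f t) in Ud *.
have -> : `|u + (h *: F + r)| ^+ 2 = `|u| ^+ 2 + 2 * h * hip (f t) F - 2 * h * hip (f t - u) F +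
  2 * hip u r + `|h *: F + r| ^+ 2.
  move: r {rd} => r; rewrite -(scaleN1r u) !hnorm_sqr !(hipDl, hipDr, hipZl, hipZr).
  by rewrite (hipC F u) (hipC r u) (hipC r F); ring.
have uf : `|u| <= `|f t| by exact/cU/ltW.
have uf2 : `|u| ^+ 2 <= `|f t| ^+ 2 by rewrite ler_pXn2r// nnegrE.
have d1 : Num.min 1 (e / 3 / (2 * `|f t| + 1)) <= 1 by rewrite ge_min lexx.
have d2 : Num.min 1 (e / 3 / (2 * `|f t| + 1)) <= e / 3 / (2 * `|f t| + 1) by rewrite ge_min lexx orbT.
set d := Num.min _ _ in d0 rd d1 d2.
have H0 : - (2 * h * hip (f t - u) F) <= e / 3 * h.
  have : `|hip (f t - u) F| * (2 * `|F| + 1) <= e / 3 * `|F|.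
    rewrite (@le_trans _ _ ((e / 3 / (2 * `|F| + 1) * `|F|) * (2 * `|F| + 1)))//.
      by rewrite ler_wpM2r ?(ltW C0)// (le_trans (hip_CS _ _))// ler_wpM2r.
    by rewrite mulrAC divfK// gt_eqF.
  have := normr_ge0 F; have := ler_norm (- hip (f t - u) F); rewrite normrN.
  have := normr_ge0 (hip (f t - u) F).
  move: (hip _ _) => x; move: `|F| => y x0 xx y0 xy.
  have : `|x| <= e / 3 / 2 by nra.
  move=> ?; nra.
have H1 : 2 * hip u r <= e / 3 * h.
  apply: (@le_trans _ _ (2 * (`|f t| * (d * h)))).
    by rewrite ler_wpM2l// (le_trans (ler_norm _))// (le_trans (hip_CS _ _))// ler_pM.
  rewrite !mulrA ler_wpM2r ?(ltW h0)//.
  move: d2; rewrite ler_pdivlMr//; have := normr_ge0 (f t); nra.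
have H2 : `|h *: F + r| <= h * (`|F| + 1).
  rewrite (le_trans (ler_normD _ _))// normrZ gtr0_norm// mulrDr mulr1 lerD2l//.
  by apply: (le_trans rd); rewrite ler_piMl// ltW.
have H3 : `|h *: F + r| ^+ 2 <= e / 3 * h.
  apply: (@le_trans _ _ ((h * (`|F| + 1)) ^+ 2)).
    by apply: lerXn2r; rewrite ?nnegrE// mulr_ge0 ?(ltW h0)// addr_ge0.
  rewrite exprMn expr2 -mulrA mulrC ler_wpM2r ?(ltW h0)//.
  by rewrite -ler_pdivlMr// ltW.
nra.
Qed.

End inner_product.

(** * Semigroups and mild solutions with a nonlinearity of rank one *)

Section semigroup.
Context {R : realType} {E : semiInnerType R}.
Notation X := (hquot E).
Variable T : R -> X -> X.
Hypothesis hT : C0_semigroup T.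

Lemma sgD t x y : 0 <= t -> T t (x + y) = T t x + T t y.
Proof. by case: hT => lT _ _ _ t0; have [lin _] := lT t t0; have := lin 1 x y; rewrite !scale1r. Qed.

Lemma sg0v t : 0 <= t -> T t 0 = 0.
Proof. by move=> t0; have := sgD 0 0 t0; rewrite addr0 => /eqP; rewrite -subr_eq subrr eq_sym => /eqP. Qed.

Lemma sgZ t (a : R) x : 0 <= t -> T t (a *: x) = a *: T t x.
Proof.
move=> t0; case: hT => lT _ _ _; have [lin _] := lT t t0.
by have := lin a x 0; rewrite addr0 (sg0v t0) addr0.
Qed.

Lemma sgN t x : 0 <= t -> T t (- x) = - T t x.
Proof. by move=> t0; rewrite -scaleN1r sgZ// scaleN1r. Qed.

Lemma sgB t x y : 0 <= t -> T t (x - y) = T t x - T t y.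
Proof. by move=> t0; rewrite sgD// sgN. Qed.

Lemma generator_rderiv0 x z : generator T (x, z) ->
  forall e, 0 < e -> \forall h \near (0:R)^'+, `|T h x - x - h *: z| <= e * h.
Proof.
move=> /cvgrPdist_le H e e0; have := H e e0 => /=.
have : \forall h \near (0:R)^'+, 0 < h by exact: near0_gt0.
apply: filterS2 => h h0; rewrite distrC => Hh.
rewrite -(ler_pM2l (_ : 0 < h^-1)) ?invr_gt0// -[h^-1]gtr0_norm ?invr_gt0// -normrZ.
by rewrite gtr0_norm ?invr_gt0// scalerBr scalerA mulVf ?gt_eqF// scale1r mulrCA mulVf ?gt_eqF// mulr1.
Qed.

Lemma generator_linear (a : R) x z x' z' : generator T (x, z) -> generator T (x', z') ->
  generator T (a *: x + x', a *: z + z').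
Proof.
move=> g g'; rewrite /generator/=; apply: cvg_trans (cvgD (cvgZ (cvg_cst a) g) g').
apply: near_eq_cvg; apply: near0_gt0 => h h0; rewrite fctE /=.
have -> : T h (a *: x + x') - (a *: x + x') = a *: (T h x - x) + (T h x' - x').
  by rewrite sgD ?(ltW h0)// sgZ ?(ltW h0)// opprD addrACA scalerBr.
by rewrite [RHS]scalerDr !scalerA mulrC.
Qed.

Lemma generator_sg t x z : 0 <= t -> generator T (x, z) -> generator T (T t x, T t z).
Proof.
move=> t0 g; case: hT => lT _ Tst _; have [_ cT] := lT t t0.
rewrite /generator/=; have := cvg_comp _ _ g (cT z).
apply: cvg_trans; apply: near_eq_cvg; apply: near0_gt0 => h h0 /=.
by rewrite sgZ// sgB// -!Tst ?(ltW h0)// (addrC h).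
Qed.

Lemma sg_rcont t x : 0 <= t -> T (t + h) x @[h --> 0^'+] --> T t x.
Proof.
move=> t0; case: hT => lT T0 Tst Tc; have [_ cT] := lT t t0.
have := cvg_comp _ _ (Tc x) (cT x).
apply: cvg_trans; apply: near_eq_cvg; apply: near0_gt0 => h h0 /=.
by rewrite Tst// ltW.
Qed.

(** The nonlinearity acts along the fixed vector [e], so that, until T is known to be contractive,
    bounds on the single orbit of [e] suffice. They are read off a mild solution on which the
    coefficient [c] does not vanish initially. *)
Variables (c : X -> R) (e : X) (N : X -> X) (S : R -> X -> X).
Hypothesis cc : continuous c.
Hypothesis NE : forall y, N y = c y *: e.
Hypothesis hS : forall y0, mild_solution T N y0 (fun t => S t y0).
Hypothesis c_neq0 : exists y0, c y0 != 0.

Lemma mild_init y0 : S 0 y0 = y0.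
Proof.
have [_ /(_ 0 (lexx _)) I0] := hS y0; case: hT => _ T0 _ _.
have := is_integral_usum (_ : 0 <= 0 <= (0:R)) I0; rewrite lexx => /(_ isT).
under eq_fun do rewrite !usum0 addr0.
move=> /(cvg_norm_le (M := 0)); rewrite normr0 => /(_ (fun=> lexx _)).
by rewrite normr_le0 T0 subr_eq0 => /eqP.
Qed.

Lemma mild_continuous y0 : continuous (fun t : R => S (Num.max 0 t) y0).
Proof. by apply: (@within_continuous_max0 _ X (fun t => S t y0)); have [] := hS y0. Qed.

(* Without Banach-Steinhaus (the completeness of [X] is not available), local
   boundedness of an orbit is read off the Riemann integrability of the forcing. *)
Lemma sg_force_bounded b : 0 <= b -> exists M, forall s, 0 <= s <= b -> `|T s e| <= M.
Proof.
move=> b0; have [y0 c0] := c_neq0.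
have [eta eta0 Heta] : exists2 eta, 0 < eta &
    forall s, 0 <= s < eta -> `|c y0| / 2 <= `|c (S s y0)|.
  have c2 : 0 < `|c y0| / 2 by rewrite divr_gt0 ?normr_gt0.
  have ccY : continuous (c \o (fun t : R => S (Num.max 0 t) y0)).
    by move=> s; apply: continuous_comp; [exact: mild_continuous|exact: cc].
  have /cvgrPdist_le/(_ _ c2) := ccY 0; rewrite /= maxxx mild_init => /nbhs_ballP[d /= d0 Hd].
  exists d => // s /andP[s0 sd]; have := Hd s; rewrite /ball/= sub0r normrN ger0_norm//.
  move=> /(_ sd); rewrite (max_idPr s0) => H.
  by have := ler_distD (c (S s y0)) (c y0) 0; rewrite !subr0; lra.
(* The integrand of the Duhamel formula at time t is bounded, and at times t - s < eta its scalar
   factor is at least half of |c y0|: dividing bounds T s e for s within eta of t. The bound depends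
   on t, hence the finite chain of steps of length eta / 2 below. *)
have step t : 0 <= t -> exists M, forall s, 0 <= s -> t - eta < s <= t -> `|T s e| <= M.
  move=> t0; have [_ /(_ t t0) It] := hS y0.
  have [M HM] := is_integral_bounded t0 It.
  have c2 : 0 < `|c y0| / 2 by rewrite divr_gt0 ?normr_gt0.
  exists (M / (`|c y0| / 2)) => s s0 /andP[ts st].
  have := HM (t - s) ltac:(lra); rewrite NE subKr sgZ// normrZ ler_pdivlMr// => H.
  apply: le_trans H; rewrite mulrC ler_wpM2r//; apply: Heta; lra.
have {}step n : exists M, forall s, 0 <= s <= n%:R * (eta / 2) -> `|T s e| <= M.
  elim: n => [|n [M HM]].
    by exists `|T 0 e| => s; rewrite mul0r -eq_le => /eqP <-.
  have t0 : 0 <= n.+1%:R * (eta / 2) by rewrite mulr_ge0 ?ler0n// divr_ge0// ltW.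
  have [M' HM'] := step _ t0.
  exists (Num.max M M') => s /andP[s0 sn]; rewrite le_max.
  have [sn'|sn'] := leP s (n%:R * (eta / 2)); first by rewrite HM ?s0.
  apply/orP; right; apply: HM' => //; rewrite sn andbT.
  have : n.+1%:R * (eta / 2) = n%:R * (eta / 2) + eta / 2 by rewrite -natr1 mulrDl mul1r.
  by move: sn'; move: (n%:R * _) (n.+1%:R * _) => r r'; lra.
have [M HM] := step (Num.truncn (b / (eta / 2))).+1.
exists M => s /andP[s0 sb]; apply: HM; rewrite s0/= (le_trans sb)//.
by rewrite -ler_pdivrMr ?divr_gt0// ltW// truncnS_gt.
Qed.

(** T t x is S t x minus its Duhamel term. The mild solution is continuous by definition, and the
    Duhamel terms at t and t - h are close by [is_integral_shift], because T s e is bounded on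
    [0, t] and c is uniformly continuous along the solution. *)
Lemma sg_lcont t x : 0 < t -> T (t - h) x @[h --> 0^'+] --> T t x.
Proof.
move=> t0; pose Y s := S (Num.max 0 s) x.
have cY : continuous Y by exact: mild_continuous.
have [M HM] := sg_force_bounded (ltW t0).
have M0 : 0 <= M by apply: (le_trans (normr_ge0 _) (HM 0 _)); rewrite lexx/=; lra.
have [K HK] := is_integral_bounded (ltW t0) ((hS x).2 t (ltW t0)).
have K0 : 0 <= K by apply: (le_trans (normr_ge0 _) (HK 0 _)); rewrite lexx/=; lra.
have {}HK s : 0 <= s <= t -> `|T (t - s) (N (S s x))| <= K by exact: HK.
apply/cvgrPdist_le => ep ep0.
have ep3 : 0 < ep / 3 by rewrite divr_gt0.
have e1 : 0 < ep / 3 / (t * (M + 1)).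
  by rewrite !divr_gt0// mulr_gt0// ltr_wpDl.
have ccY : continuous (c \o Y) by move=> s; apply: continuous_comp; [exact: cY|exact: cc].
have := unif_continuous_right 0 t ccY e1.
have := unif_continuous_right 0 t cY ep3.
have d0 : 0 < Num.min t (ep / 3 / (K + 1)).
  by rewrite lt_min t0 !divr_gt0// ltr_wpDl.
have := near0_lt d0 (fun h H => H).
apply: filterS3 => h /andP[h0]; rewrite lt_min => /andP[ht hK] YH cH.
have th0 : 0 <= t - h by lra.
have := is_integral_shift (_ : 0 <= h <= t) ((hS x).2 t (ltW t0)) ((hS x).2 _ th0)
  (M := K) (e := ep / 3 / (t * (M + 1)) * M).
rewrite (ltW h0) (ltW ht) => /(_ isT) H.
have {}H : `|S t x - T t x - (S (t - h) x - T (t - h) x)| <= h * K + (t - h) * (ep / 3 / (t * (M + 1)) * M).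
  apply: H => s /andP[s0 sh]; first by apply: HK; lra.
  rewrite !NE (_ : t - (s + h) = t - h - s); last by ring.
  rewrite !sgZ; [|lra..]; rewrite -scalerBl normrZ ler_pM//; last by apply: HM; lra.
  have := cH s ltac:(lra); rewrite /Y/= !(max_idPr _)//; lra.
have H1 : h * K <= ep / 3.
  move: hK; rewrite ltr_pdivlMr ?ltr_wpDl//; nra.
have H2 : (t - h) * (ep / 3 / (t * (M + 1)) * M) <= ep / 3.
  have M1 : 0 < M + 1 by rewrite ltr_wpDl.
  apply: (@le_trans _ _ (t * (ep / 3 / (t * (M + 1)) * (M + 1)))).
    apply: ler_pM => //; [by rewrite mulr_ge0// ltW|lra|].
    by rewrite ler_wpM2l ?(ltW e1)//; lra.
  rewrite le_eqVlt; apply/orP; left; apply/eqP; field.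
  by rewrite !gt_eqF.
have H3 := YH (t - h) ltac:(lra); rewrite subrK /Y !(max_idPr _)// ?(ltW t0)// in H3.
have -> : T t x - T (t - h) x = (S t x - S (t - h) x) - (S t x - T t x - (S (t - h) x - T (t - h) x)).
  by rewrite subr_sub_sub.
rewrite (le_trans (ler_normB _ _))//; lra.
Qed.

Lemma sg_continuous x : continuous (fun t : R => T (Num.max 0 t) x).
Proof.
apply: (@continuous_max0 _ X (fun t => T t x)) => t t0; first exact: sg_rcont.
exact: sg_lcont.
Qed.

(** The substitute for the differential equation: [is_integral_split] between t and t + h, the
    integrand on the last stretch being N (S t y0) up to [ep] by continuity of c along the solution
    and of the orbit of [e] at 0. *)
Lemma mild_step y0 t ep : 0 <= t -> 0 < ep ->
  \forall h \near (0:R)^'+, `|S (t + h) y0 - T h (S t y0) - h *: N (S t y0)| <= ep * h.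
Proof.
move=> t0 ep0; pose Y s := S (Num.max 0 s) y0.
have cY : continuous Y by exact: mild_continuous.
have ccY : continuous (c \o Y) by move=> s; apply: continuous_comp; [exact: cY|exact: cc].
case: (hT) => lT T0 Tst Tc.
pose a := c (S t y0).
have [M HM] := sg_force_bounded ler01.
have M0 : 0 <= M by apply: (le_trans (normr_ge0 _) (HM 0 _)); rewrite lexx/=; lra.
have e1 : 0 < ep / 2 / (M + 1) by rewrite !divr_gt0// ltr_wpDl.
have e2 : 0 < ep / 2 / (`|a| + 1) by rewrite !divr_gt0// ltr_wpDl.
have /cvgrPdist_le/(_ _ e1)/nbhs_ballP[d1 /= d10 Hd1] := ccY t.
have /cvgrPdist_le/(_ _ e2)/near0_exists[d2 /= d20 Hd2] := Tc e.
(* The bound 1 is there because M controls T s e only for s in [0, 1]. *)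
apply: (@near0_lt _ (Num.min 1 (Num.min d1 d2))); first by rewrite !lt_min ltr01 d10 d20.
move=> h /andP[h0]; rewrite !lt_min => /and3P[h1 hd1 hd2].
have th0 : 0 <= t + h by lra.
have [lh ch] := lT h (ltW h0).
have := is_integral_split (_ : 0 <= t <= t + h) ((hS y0).2 _ th0) ((hS y0).2 t t0) lh ch
  (v := N (S t y0)) (e := ep).
rewrite t0 lerDl (ltW h0) (addrC t h) addrK => /(_ isT) H.
have -> : S (h + t) y0 - T h (S t y0) = S (h + t) y0 - T (h + t) y0 - T h (S t y0 - T t y0).
  by rewrite sgB ?(ltW h0)// -Tst ?(ltW h0)// opprB addrA subrK.
rewrite mulrC; apply: H => s /andP[s0 sh].
  by rewrite -addrA (Tst h (t - s)) ?(ltW h0) ?subr_ge0.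
rewrite !NE sgZ; last by lra.
rewrite -/a; have -> : c (S s y0) *: T (h + t - s) e - a *: e =
  (c (S s y0) - a) *: T (h + t - s) e + a *: (T (h + t - s) e - e).
  by rewrite scalerBl scalerBr addrA subrK.
rewrite (le_trans (ler_normD _ _))// !normrZ.
have H1 : `|c (S s y0) - a| * `|T (h + t - s) e| <= ep / 2.
  apply: (@le_trans _ _ (ep / 2 / (M + 1) * M)).
    rewrite ler_pM//; last by apply: HM; lra.
    have := Hd1 s; rewrite /ball/= /Y (max_idPr t0) (max_idPr (_ : 0 <= s)) ?(le_trans t0)//.
    by rewrite -/a [`|c (S s y0) - a|]distrC; apply; rewrite ltr_norml; lra.
  rewrite mulrAC ler_pdivrMr ?ltr_wpDl//; nra.
have H2 : `|a| * `|T (h + t - s) e - e| <= ep / 2.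
  apply: (@le_trans _ _ (`|a| * (ep / 2 / (`|a| + 1)))).
    rewrite ler_wpM2l//; move: (sh); rewrite le_eqVlt => /predU1P[->|sh'].
      by rewrite subrr T0 subrr normr0 ltW.
    by rewrite distrC Hd2//; lra.
  rewrite mulrA ler_pdivrMr ?ltr_wpDl//; have := normr_ge0 a; nra.
lra.
Qed.

Hypothesis dissipative : forall x z, generator T (x, z) -> hip x z <= 0.
Hypothesis surjective : forall z, exists x, generator T (x, z).
Hypothesis compact_resolvent : forall C : R, exists2 K : set X, compact K &
  forall x z, generator T (x, z) -> `|z| <= C -> K x.

(** On the domain, the squared norm of T s x has Dini derivative at most twice hip (T s x) (T s z)
    <= 0. The domain is dense by surjectivity: if A y = x, the quotients (T h y - y) / h lie in it
    and tend to x. *)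
Lemma sg_contraction t x : 0 <= t -> `|T t x| <= `|x|.
Proof.
move=> t0; wlog [z xz] : x / exists z, generator T (x, z).
  move=> H; have [y yx] := surjective x.
  have Hh h : 0 <= h -> `|T t (h^-1 *: (T h y - y))| <= `|h^-1 *: (T h y - y)|.
    move=> h0; apply: H; exists (h^-1 *: (T h x - x)).
    have := @generator_linear h^-1 _ _ _ _ (@generator_linear (-1) _ _ _ _ yx (generator_sg h0 yx))
      (@generator_linear 0 _ _ _ _ yx (@generator_linear (-1) _ _ _ _ yx yx)).
    by rewrite !scaleN1r !scale0r !addNr !addr0 ![- _ + _]addrC.
  have [_ cT] : linear (T t) /\ continuous (T t) by case: hT => lT _ _ _; exact: lT.
  apply/ler_addgt0Pr => ep ep0; have e2 : 0 < ep / 2 by rewrite divr_gt0.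
  have n1 : \forall h \near (0:R)^'+, `|T t x - T t (h^-1 *: (T h y - y))| <= ep / 2.
    by have /cvgrPdist_le/(_ _ e2) := cvg_comp _ _ yx (cT x).
  have /cvgrPdist_le/(_ _ e2) n2 := yx.
  have : \forall h \near (0:R)^'+, `|T t x - T t (h^-1 *: (T h y - y))| <= ep / 2 /\
      `|x - h^-1 *: (T h y - y)| <= ep / 2 by move: n1 n2; apply: filterS2.
  move=> /near0_exists[d d0 /(_ (d / 2))]; set u := _ *: _ => -[|H1 H2]; first by rewrite divr_gt0//=; lra.
  have := Hh (d / 2) ltac:(lra); rewrite -/u => H3.
  have := ler_distD (T t u) (T t x) 0; have := ler_distD x u 0.
  by rewrite !subr0 (distrC u); lra.
rewrite -(@ler_pXn2r _ 2)// ?nnegrE//.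
have cf : continuous (fun s : R => `|T (Num.max 0 s) x| ^+ 2).
  by apply: continuous_norm_sqr; exact: sg_continuous.
have := dini_nonincr cf t0; rewrite (max_idPr t0) maxxx.
case: (hT) => lT T0 _ _; rewrite T0; apply=> s /andP[s0 st].
(* With U the identity, the whole increment is carried by F = T s z, which is available because x is
   in the domain. *)
have := dini_hnorm_sqr (f := fun s : R => T (Num.max 0 s) x) (U := fun=> id) (t := s) (F := T s z).
rewrite (max_idPr s0) => /(_ (fun h x _ => lexx _) (cvg_cst _)) H.
apply: diniW; first apply: H; last first.
  by have := dissipative (generator_sg s0 xz); lra.
move=> ep ep0; have := generator_rderiv0 (generator_sg s0 xz) ep0.
have : \forall h \near (0:R)^'+, 0 < h by exact: near0_gt0.
apply: filterS2 => h h0; rewrite (max_idPr _) ?addr_ge0 ?(ltW h0)//.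
by case: hT => _ _ Tst _; rewrite (addrC s) Tst// ltW.
Qed.

Lemma mild_dini (f F : R -> X) t : 0 <= t ->
  (forall ep, 0 < ep -> \forall h \near (0:R)^'+,
     `|f (t + h) - T h (f t) - h *: F t| <= ep * h) ->
  dini_le (fun s => `|f s| ^+ 2) t (2 * hip (f t) (F t)).
Proof.
move=> t0 H; apply: (dini_hnorm_sqr (U := T)) => //.
  by move=> h x; exact: sg_contraction.
by case: hT.
Qed.

Lemma generator_lip x z t : 0 <= t -> generator T (x, z) -> `|T t x - x| <= t * `|z|.
Proof.
move=> t0 xz.
have cf : continuous (fun s : R => `|T (Num.max 0 s) x - x| - s * `|z|).
  move=> s; apply: cvgB; last by apply: cvgM; [exact: cvg_id|exact: cvg_cst].
  by apply: cvg_norm; apply: cvgB; [exact: sg_continuous|exact: cvg_cst].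
have := dini_nonincr cf t0; case: (hT) => lT T0 Tst _.
rewrite (max_idPr t0) maxxx T0 subrr normr0 mul0r subr0 subr_le0; apply=> s /andP[s0 st] ep ep0.
have := generator_rderiv0 xz ep0.
have : \forall h \near (0:R)^'+, 0 < h by exact: near0_gt0.
apply: filterS2 => h h0 Hh; rewrite !(max_idPr _)// ?addr_ge0 ?(ltW h0)//.
have H1 : `|T (s + h) x - x| <= `|T h x - x| + `|T s x - x|.
  rewrite Tst ?(ltW h0)//; apply: (le_trans (ler_distD (T s x) _ _)).
  by rewrite lerD2r -sgB// sg_contraction.
have H2 : `|T h x - x| <= ep * h + h * `|z|.
  have -> : T h x - x = (T h x - x - h *: z) + h *: z by rewrite subrK.
  by rewrite (le_trans (ler_normD _ _))// normrZ gtr0_norm// lerD2r.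
move: H1 H2; rewrite mulrDl; lra.
Qed.

(* the inverse of the generator, i.e. minus its resolvent at 0 *)
Definition resolvent z : X := xget 0 [set x | generator T (x, z)].

Lemma resolventP z : generator T (resolvent z, z).
Proof. by rewrite /resolvent; case: xgetP => //; have [x xz] := surjective z => /(_ x). Qed.

(* the kernel of the generator is a linear subspace contained in a compact set *)
Lemma generator0_inj x : generator T (x, 0) -> x = 0.
Proof.
move=> x0; have [K cK HK] := compact_resolvent 0.
have [M [_ HM]] := compact_bounded cK.
have {}HM a : `|a *: x| <= M + 1.
  apply: HM; first by rewrite ltrDl.
  apply: (HK _ 0); last by rewrite normr0.
  by have := @generator_linear a _ _ _ _ x0 (@generator_linear (-1) _ _ _ _ x0 x0);
    rewrite !scaleN1r !addNr scaler0 !addr0.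
apply/eqP; rewrite -normr_eq0; apply/negPn/negP => x_neq0.
have xp : 0 < `|x| by rewrite lt_def x_neq0 normr_ge0.
have := HM ((`|M| + 2) / `|x|); rewrite normrZ ger0_norm ?divr_ge0 ?addr_ge0//.
by rewrite divfK// => H; have := ler_norm M; lra.
Qed.

Lemma generator_inj x y z : generator T (x, z) -> generator T (y, z) -> x = y.
Proof.
move=> xz yz; apply/eqP; rewrite -subr_eq0; apply/eqP/generator0_inj.
have := @generator_linear (-1) _ _ _ _ yz xz; rewrite !scaleN1r addNr addrC.
by [].
Qed.

Lemma resolventD (a : R) y z : resolvent (a *: y + z) = a *: resolvent y + resolvent z.
Proof. exact: (@generator_inj _ _ _ (@resolventP _) (@generator_linear a _ _ _ _ (@resolventP y) (@resolventP z))). Qed.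

Lemma resolvent_sg t z : 0 <= t -> resolvent (T t z) = T t (resolvent z).
Proof. by move=> t0; exact: (@generator_inj _ _ _ (@resolventP _) (generator_sg t0 (@resolventP z))). Qed.

(** The image of the unit ball lies in a compact, hence bounded, set; homogeneity does the rest. *)
Lemma resolvent_bounded : exists2 M, 0 < M & forall z, `|resolvent z| <= M * `|z|.
Proof.
have [K cK HK] := compact_resolvent 1.
have [M [_ HM]] := compact_bounded cK.
exists (`|M| + 1); first by rewrite ltr_wpDl.
move=> z; have [->|z0] := eqVneq z 0.
  have -> : resolvent 0 = 0.
    by have := resolventD (-1) 0 0; rewrite !scaleN1r !addNr.
  by rewrite !normr0 mulr0.
have zp : 0 < `|z| by rewrite normr_gt0.
have : `|resolvent (`|z|^-1 *: z)| <= `|M| + 1.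
  apply: HM; first by have := ler_norm M; lra.
  apply: (HK _ _ (@resolventP _)); rewrite normrZ gtr0_norm ?invr_gt0// mulVf// gt_eqF//.
have -> : resolvent (`|z|^-1 *: z) = `|z|^-1 *: resolvent z.
  have := resolventD `|z|^-1 z 0; rewrite addr0 => ->.
  have := resolventD (-1) 0 0; rewrite !scaleN1r !addNr => ->.
  by rewrite addr0.
by rewrite normrZ gtr0_norm ?invr_gt0// mulrC ler_pdivrMr.
Qed.

(** Apply A^-1 to the expansion of [mild_step]. It commutes with T h, and A^-1 y lies in the domain,
    so T h (A^-1 y) - A^-1 y = h y + o(h): the smoothed trajectory is right differentiable. *)
Lemma mild_resolvent_rderiv y0 t : 0 <= t ->
  rderiv (fun s => resolvent (S s y0)) t (S t y0 + resolvent (N (S t y0))).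
Proof.
move=> t0 ep ep0; have [M M0 HM] := resolvent_bounded.
have e1 : 0 < ep / 2 by rewrite divr_gt0.
have e2 : 0 < ep / 2 / M by rewrite !divr_gt0.
have := mild_step y0 t0 e2.
have := generator_rderiv0 (@resolventP (S t y0)) e1.
have : \forall h \near (0:R)^'+, 0 < h by exact: near0_gt0.
have RB a b : resolvent (a - b) = resolvent a - resolvent b.
  by have := resolventD (-1) b a; rewrite !scaleN1r addrC => ->; rewrite addrC.
have RZ (a : R) b : resolvent (a *: b) = a *: resolvent b.
  by have := resolventD a b 0; rewrite addr0 => ->; have := RB 0 0; rewrite !subrr => ->; rewrite addr0.
apply: filterS3 => h h0 H1 H2.
have -> : resolvent (S (t + h) y0) - resolvent (S t y0) - h *: (S t y0 + resolvent (N (S t y0))) =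
  resolvent (S (t + h) y0 - T h (S t y0) - h *: N (S t y0)) +
  (T h (resolvent (S t y0)) - resolvent (S t y0) - h *: S t y0).
  rewrite !RB RZ resolvent_sg ?(ltW h0)// scalerDr.
  by rewrite [RHS]addrACA -opprD [in RHS]addrA subrK (addrC (h *: resolvent _)).
rewrite (le_trans (ler_normD _ _))//.
have := HM (S (t + h) y0 - T h (S t y0) - h *: N (S t y0)).
have : M * `|S (t + h) y0 - T h (S t y0) - h *: N (S t y0)| <= ep / 2 * h.
  by rewrite mulrC -ler_pdivlMr// mulrAC.
lra.
Qed.

Lemma mild_precompact y0 (C : R) :
  (forall t, 0 <= t -> `|N (S t y0)| <= C /\
     \forall h \near (0:R)^'+, `|S (t + h) y0 - S t y0| <= C * h) ->
  precompact (\bigcup_(t in `[0, +oo[) [set S t y0]).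
Proof.
move=> HC; have [K cK HK] := compact_resolvent (C + C).
have clK : closed K by apply: compact_closed cK; exact: norm_hausdorff.
apply: (@precompact_subset _ _ K); last by rewrite precompact_closed.
move=> _ [t /= + ->]; rewrite in_itv/= andbT => t0.
have [NC SC] := HC t t0.
(* The approximants have preimages of norm at most C + C, hence lie in the same compact [K] for all
   t and small h; [K] is closed, so it contains their limit. *)
suff H : resolvent (h^-1 *: (S (t + h) y0 - S t y0) - N (S t y0)) @[h --> (0:R)^'+] --> S t y0.
  apply: (closed_cvg K clK _ _ H).
  have : \forall h \near (0:R)^'+, 0 < h by exact: near0_gt0.
  move: SC; apply: filterS2 => h SC h0; apply: (HK _ _ (@resolventP _)).
  rewrite (le_trans (ler_normB _ _))// lerD// normrZ gtr0_norm ?invr_gt0//.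
  by rewrite mulrC ler_pdivrMr.
apply/cvgrPdist_le => ep ep0; have := mild_resolvent_rderiv y0 t0 ep0.
have : \forall h \near (0:R)^'+, 0 < h by exact: near0_gt0.
apply: filterS2 => h h0 Hh.
have RB a b : resolvent (a - b) = resolvent a - resolvent b.
  by have := resolventD (-1) b a; rewrite !scaleN1r addrC => ->; rewrite addrC.
have RZ (a : R) b : resolvent (a *: b) = a *: resolvent b.
  by have := resolventD a b 0; rewrite addr0 => ->; have := RB 0 0; rewrite !subrr => ->; rewrite addr0.
rewrite RB RZ RB -(ler_pM2r h0); apply: le_trans Hh.
rewrite mulrC -[X in X * `|_|](gtr0_norm h0) -normrZ distrC !scalerBr !scalerA divff ?gt_eqF// !scale1r.
by rewrite scalerDr (opprB (_ - _)) addrA.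
Qed.

End semigroup.

Lemma rderiv_linear {R : realType} {X : normedModType R} (l : X -> R) (C : R) (f : R -> X) t d :
  (forall (a : R) x y, l (a *: x + y) = a * l x + l y) ->
  (forall x, `|l x| <= C * `|x|) -> rderiv f t d -> rderiv (fun s => l (f s)) t (l d).
Proof.
move=> ll lC df ep ep0.
have C0 : 0 < `|C| + 1 by rewrite ltr_wpDl.
have e1 : 0 < ep / (`|C| + 1) by rewrite divr_gt0.
have := df _ e1; apply: filterS => h Hh.
have -> : l (f (t + h)) - l (f t) - h *: l d = l (f (t + h) - f t - h *: d).
  have lB a b : l (a - b) = l a - l b by rewrite addrC -scaleN1r ll; ring.
  have lZ (a : R) b : l (a *: b) = a * l b.
    by have := ll a b 0; rewrite addr0 => ->; have := lB 0 0; rewrite !subrr => ->; rewrite addr0.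
  by rewrite !lB lZ.
apply: (le_trans (lC _)).
apply: (@le_trans _ _ ((`|C| + 1) * `|f (t + h) - f t - h *: d|)).
  by rewrite ler_wpM2r//; have := ler_norm C; lra.
rewrite -ler_pdivlMl//; apply: (le_trans Hh).
by rewrite mulrA [X in _ <= X * _]mulrC.
Qed.

Lemma linear_bounded_continuous {R : realType} {X : normedModType R} (l : X -> R) (C : R) :
  (forall (a : R) x y, l (a *: x + y) = a * l x + l y) ->
  (forall x, `|l x| <= C * `|x|) -> continuous l.
Proof.
move=> ll lC x; apply/cvgrPdist_le => ep ep0.
have C0 : 0 < `|C| + 1 by rewrite ltr_wpDl.
have e1 : 0 < ep / (`|C| + 1) by rewrite divr_gt0.
apply/nbhs_ballP; exists (ep / (`|C| + 1)) => // y; rewrite -ball_normE/= => xy.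
have -> : l x - l y = l (x - y) by rewrite [x - y]addrC -(scaleN1r y) ll; ring.
apply: (le_trans (lC _)); apply: (@le_trans _ _ ((`|C| + 1) * `|x - y|)).
  by rewrite ler_wpM2r//; have := ler_norm C; lra.
by rewrite mulrC -ler_pdivlMr// ltW.
Qed.

Lemma rderiv_max0 {R : realType} {X : normedModType R} (f : R -> X) t l : 0 <= t ->
  rderiv f t l -> rderiv (fun s : R => f (Num.max 0 s)) t l.
Proof.
move=> t0 df ep ep0; have := df _ ep0.
have : \forall h \near (0:R)^'+, 0 < h by exact: near0_gt0.
by apply: filterS2 => h h0; rewrite !(max_idPr _) ?addr_ge0// ltW.
Qed.

(** * Energy estimates for an abstract beam *)

Section energy.
Context {R : realType} {E : semiInnerType R}.
Notation X := (hquot E).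
(** Here [q] and [p] stand for the position and the speed of the tip and [e] for a unit force at the
    tip. [hip_e] says that the power of this force is the tip speed, [q_gen] that the generator
    turns position into speed. *)
Variables (T : R -> X -> X) (e : X) (q p : X -> R) (k1 k2 K1 k1' : R -> R) (N : X -> X) (S : R -> X -> X).
Hypothesis hT : C0_semigroup T.
Hypothesis NE : forall y, N y = (- k1 (q y) - k2 (p y)) *: e.
Hypothesis hS : forall y0, mild_solution T N y0 (fun t => S t y0).
Hypothesis N_neq0 : exists y0, - k1 (q y0) - k2 (p y0) != 0.
Hypothesis dissipative : forall x z, generator T (x, z) -> hip x z <= 0.
Hypothesis surjective : forall z, exists x, generator T (x, z).
Hypothesis compact_resolvent : forall C : R, exists2 K : set X, compact K &
  forall x z, generator T (x, z) -> `|z| <= C -> K x.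
Hypothesis q_lin : forall (a : R) x y, q (a *: x + y) = a * q x + q y.
Hypothesis p_lin : forall (a : R) x y, p (a *: x + y) = a * p x + p y.
Variable B : R.
Hypothesis q_bnd : forall x, `|q x| <= B * `|x|.
Hypothesis p_bnd : forall x, `|p x| <= B * `|x|.
Hypothesis qe0 : q e = 0.
Hypothesis hip_e : forall y, 2 * hip y e = p y.
Hypothesis q_gen : forall x z, generator T (x, z) -> q z = p x.
Hypothesis K1_ge0 : forall z, 0 <= K1 z.
Hypothesis K1_derive : forall z : R, is_derive z (1 : R) K1 (k1 z).
Hypothesis k1_derive : forall z : R, is_derive z (1 : R) k1 (k1' z).
Hypothesis k2_cont : continuous k2.
Hypothesis k2_homo : {homo k2 : x y / x <= y}.
Hypothesis k1_taylor : forall M : R, exists2 C : R, 0 < C & forall a b, `|a| <= M -> `|b| <= M ->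
  `|k1 a - k1 b - k1' b * (a - b)| <= C * (a - b) ^+ 2 /\
  `|K1 a - K1 b - k1 b * (a - b)| <= C * (a - b) ^+ 2.
Hypothesis k2_coercive : forall M : R, exists2 C : R, 0 < C &
  forall z, `|z| <= M -> C * `|z| ^+ 3 <= k2 z * z.

Let k1_cont : continuous k1.
Proof. by move=> z; apply/differentiable_continuous/derivable1_diffP; have [] := k1_derive z. Qed.

Let K1_cont : continuous K1.
Proof. by move=> z; apply/differentiable_continuous/derivable1_diffP; have [] := K1_derive z. Qed.

Let c y := - k1 (q y) - k2 (p y).

Let c_cont : continuous c.
Proof.
move=> y.
have H1 : k1 (q x) @[x --> y] --> k1 (q y).
  by apply: continuous_comp; [exact: linear_bounded_continuous q_lin q_bnd _|exact: k1_cont].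
have H2 : k2 (p x) @[x --> y] --> k2 (p y).
  by apply: continuous_comp; [exact: linear_bounded_continuous p_lin p_bnd _|exact: k2_cont].
exact: (cvgB (cvgN H1) H2).
Qed.

Variables (y0 z0 : X).
Hypothesis yz0 : generator T (y0, z0).
Let Y s := S (Num.max 0 s) y0.
Let Q s := q (Y s).
Let P s := p (Y s).

Let Y_cont : continuous Y. Proof. exact: mild_continuous. Qed.
Let Q_cont : continuous Q.
Proof. by move=> s; apply: continuous_comp; [exact: Y_cont|exact: linear_bounded_continuous q_lin q_bnd _]. Qed.

Let Y_ge0 t : 0 <= t -> Y t = S t y0. Proof. by move=> t0; rewrite /Y (max_idPr t0). Qed.

Let Y_step t ep : 0 <= t -> 0 < ep ->
  \forall h \near (0:R)^'+, `|Y (t + h) - T h (Y t) - h *: N (Y t)| <= ep * h.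
Proof.
move=> t0 ep0; have := mild_step hT c_cont NE hS N_neq0 y0 t0 ep0.
have : \forall h \near (0:R)^'+, 0 < h by exact: near0_gt0.
by apply: filterS2 => h h0; rewrite !Y_ge0// addr_ge0// ltW.
Qed.

(** By [q_gen], q is p composed with the resolvent, so Q is a bounded linear image of the right
    differentiable resolvent trajectory. Its derivative is P plus q (N (Y t)), and the latter
    vanishes as q e = 0. *)
Let Q_rderiv t : 0 <= t -> rderiv Q t (P t).
Proof.
move=> t0.
have := mild_resolvent_rderiv hT c_cont NE hS N_neq0 surjective compact_resolvent y0 t0.
move=> /(rderiv_linear p_lin p_bnd)/(rderiv_max0 t0).
have pr z : p (resolvent T z) = q z.
  by rewrite (q_gen (@resolventP _ _ T surjective z)).
have -> : p (S t y0 + resolvent T (N (S t y0))) = P t.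
  rewrite -[S t y0]scale1r p_lin pr NE scale1r mul1r.
  have := q_lin (- k1 (q (S t y0)) - k2 (p (S t y0))) e 0; rewrite addr0 => ->.
  have := q_lin (-1) 0 0; rewrite scaleN1r addNr => q0.
  by rewrite qe0 mulr0 (_ : q 0 = 0) ?addr0 ?/P ?Y_ge0//; move: q0; lra.
by rewrite (_ : (fun s : R => p (resolvent T (S (Num.max 0 s) y0))) = Q)//; apply/funext => s; rewrite pr.
Qed.

Let V s := `|Y s| ^+ 2 + K1 (Q s).

Let V_cont : continuous V.
Proof.
move=> s; apply: cvgD; first exact: continuous_norm_sqr.
by apply: continuous_comp; [exact: Q_cont|exact: K1_cont].
Qed.

Let V_ge0 s : 0 <= V s. Proof. by rewrite addr_ge0. Qed.

(** The power of the force is -(k1 (Q t) + k2 (P t)) P t, and its k1 part cancels the derivative of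
    K1 (Q t). *)
Let V_dini t : 0 <= t -> dini_le V t (- (k2 (P t) * P t)).
Proof.
move=> t0.
have H1 := mild_dini hT c_cont NE hS N_neq0 dissipative surjective (F := fun s => N (Y s)) t0 (fun ep => Y_step t0).
have H2 := rderiv_dini (rderiv_comp (Q_rderiv t0) (K1_derive (Q t))).
apply: (diniW (diniD H1 H2)).
rewrite NE hipZr mulrCA hip_e -/(P t) -/(Q t); lra.
Qed.

Let k2z_ge0 z : 0 <= k2 z * z.
Proof.
have [C C0 H] := k2_coercive `|z|; apply: le_trans (H z (lexx _)).
by rewrite mulr_ge0 ?exprn_ge0// ltW.
Qed.

Let V_noninc s t : 0 <= s -> s <= t -> V t <= V s.
Proof.
move=> s0 st; apply: (dini_nonincr V_cont st) => r /andP[sr _].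
by apply: diniW (V_dini (le_trans s0 sr)) _; rewrite oppr_le0.
Qed.

(** A common bound for position and speed; V 0 + 1 replaces the square root of V 0, since r^2 <= a
    implies r <= a + 1. *)
Let M := `|B| * (V 0 + 1).

Let Y_bnd t : 0 <= t -> `|Y t| <= V 0 + 1.
Proof.
move=> t0; have := V_noninc (lexx _) t0; rewrite {1}/V => H.
have := K1_ge0 (Q t); have := normr_ge0 (Y t); have := V_ge0 0.
by move: H; move: `|Y t| (K1 _) (V 0) => a b d; nra.
Qed.

Let QP_bnd t : 0 <= t -> `|Q t| <= M /\ `|P t| <= M.
Proof.
move=> t0; have := Y_bnd t0 => H; split.
- apply: (le_trans (q_bnd _)); apply: (@le_trans _ _ (`|B| * `|Y t|)).
    by rewrite ler_wpM2r// ler_norm.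
  by rewrite ler_wpM2l.
- apply: (le_trans (p_bnd _)); apply: (@le_trans _ _ (`|B| * `|Y t|)).
    by rewrite ler_wpM2r// ler_norm.
  by rewrite ler_wpM2l.
Qed.

Let Q_lip s h : 0 <= s -> 0 <= h -> `|Q (s + h) - Q s| <= M * h.
Proof.
move=> s0 h0; have sh : s <= s + h by rewrite lerDl.
have H (g : R) : `|g| = 1 -> g * (Q (s + h) - Q s) <= M * h.
  move=> g1.
  have cf : continuous (fun t : R => g * Q t - M * t).
    move=> t; apply: cvgB; apply: cvgM; [exact: cvg_cst|exact: Q_cont|exact: cvg_cst|exact: cvg_id].
  suff : g * Q (s + h) - M * (s + h) <= g * Q s - M * s by rewrite mulrDr mulrBr; lra.
  apply: (dini_nonincr cf sh) => t /andP[st _]; have t0 := le_trans s0 st.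
  have D1 : rderiv (fun t : R => g * Q t) t (g * P t) by exact: rderivZ (Q_rderiv t0).
  have D2 : rderiv (fun t : R => M * t) t (M * 1) by exact: rderivZ (rderiv_id t).
  apply: diniW (rderiv_dini (rderivB D1 D2)) _.
  have [_ PM] := QP_bnd t0; rewrite mulr1 subr_le0 (le_trans (ler_norm _))//.
  by rewrite normrM g1 mul1r.
rewrite ler_norml; have := H 1 (normr1 _); have := H (-1) (normrN1 _); rewrite mul1r mulN1r; lra.
Qed.

(** The tangent inequality of the cube at x; with z = |y| it is the factorisation z^3 - 3 x^2 z + 2
    x^3 = (x - z)^2 (2 x + z). *)
Let young (x y : R) : 0 <= x -> 3 * x ^+ 2 * y <= `|y| ^+ 3 + 2 * x ^+ 3.
Proof.
move=> x0; apply: (@le_trans _ _ (3 * x ^+ 2 * `|y|)).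
  by rewrite ler_wpM2l ?ler_norm// mulr_ge0// exprn_ge0.
have := normr_ge0 y; move: `|y| => z z_ge0.
have : 0 <= (x - z) ^+ 2 * (2 * x + z) by rewrite mulr_ge0 ?sqr_ge0//; lra.
by rewrite !exprS !expr0; nra.
Qed.

(* Jensen's inequality for the cube of the tip speed over [s, s + h], in the
   form of its tangent inequality at the mean speed x (see young) *)
Let V_drop C : 0 < C -> (forall z, `|z| <= M -> C * `|z| ^+ 3 <= k2 z * z) ->
  forall s h, 0 <= s -> 0 < h -> V (s + h) - V s <= - (C * (`|Q (s + h) - Q s| ^+ 3 / h ^+ 2)).
Proof.
move=> C0 HC s h s0 h0; have sh : s <= s + h by rewrite lerDl ltW.
set D := Q (s + h) - Q s; pose x := `|D| / h.
have x0 : 0 <= x by rewrite divr_ge0// ltW.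
pose g : R := Num.sg D.
(* By [young], adding C times 3 x^2 g Q - 2 x^3 t to V gives a function that is still nonincreasing.
   Between s and s + h the added term grows by C (3 x^2 |D| - 2 x^3 h) = C x^3 h, which V must
   lose. *)
have cf : continuous (fun t : R => V t + (3 * C * x ^+ 2 * g * Q t - 2 * C * x ^+ 3 * t)).
  move=> t; apply: cvgD; first exact: V_cont.
  by apply: cvgB; apply: cvgM; [exact: cvg_cst|exact: Q_cont|exact: cvg_cst|exact: cvg_id].
have H : V (s + h) + (3 * C * x ^+ 2 * g * Q (s + h) - 2 * C * x ^+ 3 * (s + h)) <=
   V s + (3 * C * x ^+ 2 * g * Q s - 2 * C * x ^+ 3 * s).
  apply: (dini_nonincr cf sh) => t /andP[st _]; have t0 := le_trans s0 st.
  have D1 : rderiv (fun t : R => 3 * C * x ^+ 2 * g * Q t) t (3 * C * x ^+ 2 * g * P t) by exact: rderivZ (Q_rderiv t0).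
  have D2 : rderiv (fun t : R => 2 * C * x ^+ 3 * t) t (2 * C * x ^+ 3 * 1) by exact: rderivZ (rderiv_id t).
  apply: diniW (diniD (V_dini t0) (rderiv_dini (rderivB D1 D2))) _.
  have [_ PM] := QP_bnd t0; have := HC _ PM.
  have := young (g * P t) x0; rewrite normrM.
  have : `|g| * `|P t| <= `|P t|.
    by rewrite ler_piMl// /g normr_sg; case: (D != 0).
  move=> gP; have {}gP : (`|g| * `|P t|) ^+ 3 <= `|P t| ^+ 3.
    by rewrite lerXn2r// nnegrE// mulr_ge0.
  move=> H1 H2.
  have H3 : C * (3 * x ^+ 2 * (g * P t)) <= C * (`|P t| ^+ 3 + 2 * x ^+ 3).
    by rewrite ler_wpM2l ?(ltW C0)// (le_trans H1)// lerD2r.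
  move: H2 H3; rewrite mulrDr; nra.
have gD : g * D = `|D| by rewrite /g -normrEsg.
have -> : `|D| ^+ 3 / h ^+ 2 = x ^+ 3 * h by rewrite /x; field; rewrite gt_eqF.
have xD : x ^+ 2 * `|D| = x ^+ 3 * h by rewrite /x; field; rewrite gt_eqF.
have : 3 * C * x ^+ 2 * g * Q (s + h) - 3 * C * x ^+ 2 * g * Q s = 3 * C * (x ^+ 3 * h).
  by rewrite -xD -gD /D; ring.
move: H; rewrite mulrDr; nra.
Qed.

Let N_bnd : exists C, forall t, 0 <= t -> `|N (Y t)| <= C.
Proof.
have M0 : 0 <= M by rewrite mulr_ge0// addr_ge0.
have [C1 C10 HC1] := k1_taylor M.
exists ((`|k1 0| + `|k1' 0| * M + C1 * M ^+ 2 + (`|k2 M| + `|k2 (- M)|)) * `|e|) => t t0.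
have [QM PM] := QP_bnd t0.
rewrite NE -/(Q t) -/(P t) normrZ ler_wpM2r// (le_trans (ler_normB _ _))// lerD// ?normrN.
  have [+ _] := HC1 (Q t) 0 QM ltac:(by rewrite normr0); rewrite subr0 => H.
  have -> : k1 (Q t) = (k1 (Q t) - k1 0 - k1' 0 * Q t) + (k1 0 + k1' 0 * Q t) by ring.
  rewrite (le_trans (ler_normD _ _))// addrC lerD//.
    by rewrite (le_trans (ler_normD _ _))// lerD2l normrM ler_wpM2l.
  apply: (le_trans H); rewrite ler_wpM2l ?(ltW C10)//.
  by rewrite -[_ ^+ 2]ger0_norm ?sqr_ge0// normrX lerXn2r ?nnegrE.
move: PM; rewrite ler_norml => /andP[/k2_homo H1 /k2_homo H2].
have := ler_norm (k2 M); have := ler_norm (- k2 (- M)); rewrite normrN ler_norml.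
have := normr_ge0 (k2 M); have := normr_ge0 (k2 (- M)); lra.
Qed.

(** Here the assumption that y0 is in the domain enters: since T is contractive, |Y t - y0| grows at
    a rate at most |z0| plus the bound on the force. *)
Let Y_init : exists C, forall h, 0 <= h -> `|Y h - Y 0| <= C * h.
Proof.
have [C HC] := N_bnd; exists (`|z0| + C) => h h0.
have Y00 : Y 0 = y0 by rewrite Y_ge0// (mild_init hT hS).
have cf : continuous (fun t : R => `|Y t - y0| - (`|z0| + C) * t).
  move=> t; apply: cvgB; last by apply: cvgM; [exact: cvg_cst|exact: cvg_id].
  by apply: cvg_norm; apply: cvgB; [exact: Y_cont|exact: cvg_cst].
have := dini_nonincr cf h0; rewrite Y00 subrr normr0 mulr0 subr0 subr_le0; apply=> t /andP[t0 _] ep ep0.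
have := Y_step t0 ep0.
have : \forall h \near (0:R)^'+, 0 < h by exact: near0_gt0.
apply: filterS2 => d d0 Hd.
have -> : Y (t + d) - y0 = (Y (t + d) - T d (Y t) - d *: N (Y t)) + (T d (Y t) - T d y0) + (T d y0 - y0) + d *: N (Y t).
  move: (Y (t + d)) (T d (Y t)) (T d y0) (d *: N (Y t)) => a b b' g.
  by rewrite -(addrA (a - b - g)) (addrA (b - b')) subrK addrAC subrK addrA subrK.
have H1 : `|T d (Y t) - T d y0| <= `|Y t - y0|.
  rewrite -(sgB hT) ?(ltW d0)//.
  exact: (sg_contraction hT c_cont NE hS N_neq0 dissipative surjective _ (ltW d0)).
have H2 := generator_lip hT c_cont NE hS N_neq0 dissipative surjective (ltW d0) yz0.
have H3 : `|d *: N (Y t)| <= d * C by rewrite normrZ gtr0_norm// ler_wpM2l ?(ltW d0)// HC.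
have := ler_normD (Y (t + d) - T d (Y t) - d *: N (Y t) + (T d (Y t) - T d y0) + (T d y0 - y0)) (d *: N (Y t)).
have := ler_normD (Y (t + d) - T d (Y t) - d *: N (Y t) + (T d (Y t) - T d y0)) (T d y0 - y0).
have := ler_normD (Y (t + d) - T d (Y t) - d *: N (Y t)) (T d (Y t) - T d y0).
rewrite !mulrDr !mulrDl; lra.
Qed.

(* The Lyapunov function f is |w|^2 plus the Taylor remainder W, plus two
   dissipated quantities: V(s) weighted by h^2, and the integral of V over
   [s, s + h] weighted by h.  All its terms are O(h^2) at s = 0. *)
Let Y_lip : exists C, forall h t, 0 < h <= 1 -> 0 <= t -> `|Y (t + h) - Y t| <= C * h.
Proof.
have [Ci HCi] := Y_init.
have [C C0 HC] := k2_coercive M.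
have [C1 C10 HC1] := k1_taylor M.
pose U x := oriented_integral 0 x V.
have HU (x : R) : is_derive x (1 : R) U (V x) by exact: is_derive_oriented_integral.
(* Since al C = C1, the dissipated terms of f decrease at rates at least C1 h^2 |P|^3 and C1 h^2
   x^3, where x = |Q(s + h) - Q s| / h, and together these dominate C1 h^2 x^2 |P|. *)
pose al := C1 / C; have al0 : 0 < al by rewrite divr_gt0.
(* Z collects, in units of h^2, the initial |w|^2, the remainder W at times 0 and t, and the two
   dissipated terms at time 0, each at most al V 0. *)
pose Z := Ci ^+ 2 + 2 * (C1 * M ^+ 2) + 2 * (al * V 0).
exists (Num.sqrt Z) => h t /andP[h0 h1] t0.
pose w s : X := Y (s + h) - Y s.
pose D s := Q (s + h) - Q s.
pose W s := K1 (Q (s + h)) - K1 (Q s) - k1 (Q s) * (Q (s + h) - Q s).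
pose f s := `|w s| ^+ 2 + W s + al * h ^+ 2 * V s + al * h * (U (s + h) - U s).
have Z0 : 0 <= Z.
  have CM : 0 <= C1 * M ^+ 2 by rewrite mulr_ge0 ?sqr_ge0// ltW.
  have aV : 0 <= al * V 0 by rewrite mulr_ge0// ltW.
  by have := sqr_ge0 Ci; rewrite /Z; lra.
suff : `|w t| ^+ 2 <= Z * h ^+ 2.
  move=> H; rewrite -(ler_pXn2r (_ : 0 < 2)%N) ?nnegrE ?mulr_ge0 ?sqrtr_ge0 ?(ltW h0)//.
  by rewrite exprMn (sqr_sqrtr Z0).
have sh_cont (g : R -> X) : continuous g -> continuous (fun s : R => g (s + h)).
  by move=> cg s; apply: continuous_comp; [apply: cvgD; [exact: cvg_id|exact: cvg_cst]|exact: cg].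
have sh_contR (g : R -> R) : continuous g -> continuous (fun s : R => g (s + h)).
  by move=> cg s; apply: continuous_comp; [apply: cvgD; [exact: cvg_id|exact: cvg_cst]|exact: cg].
have comp_cont (g1 g2 : R -> R) : continuous g1 -> continuous g2 -> continuous (fun s : R => g2 (g1 s)).
  by move=> c1 c2 s; apply: continuous_comp; [exact: c1|exact: c2].
have cw : continuous w by move=> s; apply: cvgB; [exact: sh_cont|exact: Y_cont].
have cQh : continuous (fun s : R => Q (s + h)) by exact: sh_contR.
have cW : continuous W.
  move=> s; apply: cvgB.
    by apply: cvgB; [exact: (comp_cont _ _ cQh K1_cont)|exact: (comp_cont _ _ Q_cont K1_cont)].
  apply: cvgM; first exact: (comp_cont _ _ Q_cont k1_cont).
  by apply: cvgB; [exact: cQh|exact: Q_cont].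
have cU : continuous U.
  by move=> s; apply/differentiable_continuous/derivable1_diffP; have [] := HU s.
have cf : continuous f.
  move=> s; apply: cvgD.
    apply: cvgD; first by apply: cvgD; [exact: continuous_norm_sqr|exact: cW].
    by apply: cvgM; [exact: cvg_cst|exact: V_cont].
  apply: cvgM; first exact: cvg_cst.
  by apply: cvgB; [exact: sh_contR|exact: cU].
have U_mono s : 0 <= s -> 0 <= U (s + h) - U s <= h * V 0.
  move=> s0; have sh : s <= s + h by rewrite lerDl ltW.
  apply/andP; split.
    have cNU : continuous (fun s : R => - U s) by move=> r; apply: cvgN; exact: cU.
    have := dini_nonincr cNU sh; rewrite lerN2 subr_ge0; apply=> r /andP[sr _].
    apply: diniW (rderiv_dini (rderivN (is_derive_rderiv (HU r)))) _.
    by rewrite oppr_le0.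
  have cUV : continuous (fun s : R => U s - V 0 * s).
    by move=> r; apply: cvgB; [exact: cU|apply: cvgM; [exact: cvg_cst|exact: cvg_id]].
  have := dini_nonincr cUV sh => H.
  have {}H : U (s + h) - V 0 * (s + h) <= U s - V 0 * s.
    apply: H => r /andP[sr _].
    have D2 : rderiv (fun t : R => V 0 * t) r (V 0 * 1) by exact: rderivZ (rderiv_id r).
    apply: diniW (rderiv_dini (rderivB (is_derive_rderiv (HU r)) D2)) _.
    by rewrite mulr1 subr_le0; apply: V_noninc => //; exact: le_trans sr.
  by move: H; rewrite mulrDr; lra.
have w_dini s : 0 <= s -> dini_le (fun s => `|w s| ^+ 2) s
    ((- (k1 (Q (s + h)) - k1 (Q s)) - (k2 (P (s + h)) - k2 (P s))) * (P (s + h) - P s)).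
  move=> s0; have sh0 : 0 <= s + h by rewrite addr_ge0// ltW.
  have step ep : 0 < ep -> \forall d \near (0:R)^'+,
      `|w (s + d) - T d (w s) - d *: (N (Y (s + h)) - N (Y s))| <= ep * d.
    move=> ep0; have e2 : 0 < ep / 2 by rewrite divr_gt0.
    have := Y_step sh0 e2; have := Y_step s0 e2.
    have : \forall d \near (0:R)^'+, 0 < d by exact: near0_gt0.
    apply: filterS3 => d d0 H1 H2.
    have -> : w (s + d) - T d (w s) - d *: (N (Y (s + h)) - N (Y s)) =
       (Y (s + h + d) - T d (Y (s + h)) - d *: N (Y (s + h))) -
       (Y (s + d) - T d (Y s) - d *: N (Y s)).
      rewrite /w (sgB hT) ?(ltW d0)// (addrAC s) scalerBr.
      by rewrite !opprD !opprK (addrACA (Y _)) [RHS]addrACA; congr (_ + _); rewrite [RHS]addrACA.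
    by rewrite (le_trans (ler_normB _ _))//; lra.
  have := mild_dini hT c_cont NE hS N_neq0 dissipative surjective (F := fun s => N (Y (s + h)) - N (Y s)) s0 step.
  move/diniW; apply.
  rewrite !NE -scalerBl hipZr mulrCA hip_e.
  have -> : p (w s) = P (s + h) - P s by rewrite /w addrC -scaleN1r p_lin /P; ring.
  by rewrite -!/(P _) -!/(Q _) le_eqVlt; apply/orP; left; apply/eqP; ring.
have f_dini s : 0 <= s -> dini_le f s 0.
  move=> s0; have sh0 : 0 <= s + h by rewrite addr_ge0// ltW.
  have dQ := Q_rderiv s0; have dQh := rderiv_shift (Q_rderiv sh0).
  have dW : rderiv W s (k1 (Q (s + h)) * P (s + h) - k1 (Q s) * P s -
      (k1' (Q s) * P s * (Q (s + h) - Q s) + k1 (Q s) * (P (s + h) - P s))).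
    apply: rderivB.
      by apply: rderivB; [exact: rderiv_comp dQh (K1_derive _)|exact: rderiv_comp dQ (K1_derive _)].
    by apply: rderivM; [exact: rderiv_comp dQ (k1_derive _)|exact: rderivB].
  have dV := diniZ (_ : 0 <= al * h ^+ 2) (V_dini s0).
  have {}dV := dV ltac:(by rewrite mulr_ge0 ?sqr_ge0// ltW).
  have dU : rderiv (fun s => al * h * (U (s + h) - U s)) s (al * h * (V (s + h) - V s)).
    apply: (@rderivZ _ R (al * h)); apply: rderivB; last exact: is_derive_rderiv.
    by apply: rderiv_shift; exact: is_derive_rderiv.
  apply: diniW (diniD (diniD (diniD (w_dini s s0) (rderiv_dini dW)) dV) (rderiv_dini dU)) _.
  have [QM PM] := QP_bnd s0; have [QhM PhM] := QP_bnd sh0.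
  have [R1 _] := HC1 _ _ QhM QM.
  have VD := V_drop C0 HC s0 h0.
  have k2P := HC _ PM.
  have mono : 0 <= (k2 (P (s + h)) - k2 (P s)) * (P (s + h) - P s).
    have [PP|/ltW PP] := leP (P s) (P (s + h)).
      by rewrite mulr_ge0// subr_ge0// k2_homo.
    by rewrite -mulrNN mulr_ge0// oppr_ge0 subr_le0// k2_homo.
  pose x := `|Q (s + h) - Q s| / h.
  have x0 : 0 <= x by rewrite divr_ge0// ltW.
  have Dx : `|Q (s + h) - Q s| = x * h by rewrite /x divfK// gt_eqF.
  have D2 : (Q (s + h) - Q s) ^+ 2 = x ^+ 2 * h ^+ 2.
    by rewrite -exprMn -Dx -normrX ger0_norm// sqr_ge0.
  have alC : al * C = C1 by rewrite /al divfK// gt_eqF.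
  have T1 : (k1 (Q (s + h)) - k1 (Q s) - k1' (Q s) * (Q (s + h) - Q s)) * P s <=
      C1 * (x ^+ 2 * h ^+ 2) * `|P s|.
    by rewrite (le_trans (ler_norm _))// normrM ler_wpM2r// -D2.
  have T2 : al * h ^+ 2 * - (k2 (P s) * P s) <= - (C1 * h ^+ 2 * `|P s| ^+ 3).
    rewrite mulrN lerN2 -alC (_ : al * C * _ * _ = al * h ^+ 2 * (C * `|P s| ^+ 3)); last by ring.
    by rewrite ler_wpM2l// mulr_ge0 ?sqr_ge0// ltW.
  (* The derivative of the integral of V over [s, s + h] is the difference of V at its ends, so
     [V_drop] supplies the cube of the mean speed. *)
  have T3 : al * h * (V (s + h) - V s) <= - (C1 * h ^+ 2 * x ^+ 3).
    have -> : - (C1 * h ^+ 2 * x ^+ 3) = al * h * - (C * (`|Q (s + h) - Q s| ^+ 3 / h ^+ 2)).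
      by rewrite Dx -alC; field; rewrite gt_eqF.
    by rewrite ler_wpM2l// mulr_ge0 ?ltW.
  have T4 : C1 * (x ^+ 2 * h ^+ 2) * `|P s| <= C1 * h ^+ 2 * `|P s| ^+ 3 + C1 * h ^+ 2 * x ^+ 3.
    have := young `|P s| x0; rewrite normr_id => yg.
    have : x ^+ 2 * `|P s| <= `|P s| ^+ 3 + x ^+ 3.
      have x3 := exprn_ge0 3 x0; have P3 : 0 <= `|P s| ^+ 3 by rewrite exprn_ge0.
      by move: yg x3 P3; rewrite -mulrA; move: (_ * `|P s|) (x ^+ 3) (`|P s| ^+ 3) => ? ? ?; lra.
    move=> H; have : C1 * h ^+ 2 * (x ^+ 2 * `|P s|) <= C1 * h ^+ 2 * (`|P s| ^+ 3 + x ^+ 3).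
      by rewrite ler_wpM2l// mulr_ge0 ?sqr_ge0// ltW.
    by rewrite mulrDr; apply: le_trans; rewrite le_eqVlt; apply/orP; left; apply/eqP; ring.
  move: mono T1 T2 T3 T4.
  move: (k1 (Q (s + h))) (k1 (Q s)) (k2 (P (s + h))) (k2 (P s)) (k1' (Q s))
    (Q (s + h) - Q s) (P (s + h)) (P s) => A1 A2 B1 B2 G D' P1 P2.
  move: (al * h ^+ 2 * _) (al * h * _) (C1 * _ * `|P2|) (C1 * h ^+ 2 * `|P2| ^+ 3)
    (C1 * h ^+ 2 * x ^+ 3) => X1 X2 X3 X4 X5.
  (* With W added, the product of the differences of k1 and of P cancels; what remains is the Taylor
     remainder of k1 times P s and the k2 term, which has a sign by monotonicity. *)
  rewrite [X in X + X1 + X2](_ : _ = (A1 - A2 - G * D') * P2 - (k2 P1 - k2 P2) * (P1 - P2)); last by ring.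
  by move: (_ * P2) ((k2 P1 - k2 P2) * _) => r m; lra.
have ft0 : f t <= f 0 by apply: (dini_nonincr cf t0) => s /andP[s0 _]; exact: f_dini.
have W_bnd s : 0 <= s -> `|W s| <= C1 * M ^+ 2 * h ^+ 2.
  move=> s0; have sh0 : 0 <= s + h by rewrite addr_ge0// ltW.
  have [QM _] := QP_bnd s0; have [QhM _] := QP_bnd sh0.
  have [_ H] := HC1 _ _ QhM QM; apply: (le_trans H).
  rewrite -mulrA -exprMn ler_wpM2l ?(ltW C10)//.
  rewrite -[leLHS]ger0_norm ?sqr_ge0// normrX lerXn2r ?nnegrE ?Q_lip ?(ltW h0)//.
  exact: le_trans (Q_lip s0 (ltW h0)).
have /andP[U1 _] := U_mono t t0; have /andP[_ U2] := U_mono 0 (lexx _).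
have w0 : `|w 0| ^+ 2 <= Ci ^+ 2 * h ^+ 2.
  have := HCi h (ltW h0); rewrite /w add0r -exprMn => H.
  by rewrite lerXn2r ?nnegrE// (le_trans _ H).
have W1 := W_bnd t t0; have W2 := W_bnd 0 (lexx _).
move: W1 W2; rewrite !ler_norml => /andP[W1 _] /andP[_ W2].
have ah : 0 <= al * h by rewrite mulr_ge0// ltW.
have V1 : 0 <= al * h ^+ 2 * V t by rewrite expr2 mulrA mulr_ge0// mulr_ge0// ltW.
have U3 : 0 <= al * h * (U (t + h) - U t) by exact: mulr_ge0.
have U4 : al * h * (U (0 + h) - U 0) <= al * h * (h * V 0) by exact: ler_wpM2l.
move: ft0; rewrite /f.
have -> : Z * h ^+ 2 = Ci ^+ 2 * h ^+ 2 + 2 * (C1 * M ^+ 2 * h ^+ 2) + al * h ^+ 2 * V 0 + al * h * (h * V 0).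
  by rewrite /Z; ring.
lra.
Qed.

Lemma energy_precompact : precompact (\bigcup_(t in `[0, +oo[) [set S t y0]).
Proof.
have [C HC] := Y_lip; have [C' HC'] := N_bnd.
apply: (mild_precompact hT c_cont NE hS N_neq0 surjective compact_resolvent (C := Num.max C C')) => t t0.
split; first by have := HC' t t0; rewrite Y_ge0// le_max => ->; rewrite orbT.
apply: (near0_lt ltr01) => h /andP[h0 h1].
have := HC h t ltac:(by rewrite h0 ltW) t0; rewrite !Y_ge0//; last by rewrite addr_ge0// ltW.
by move/le_trans; apply; rewrite ler_wpM2r ?(ltW h0)// le_max lexx.
Qed.

End energy.

(** * Consequences of the assumptions (K) *)

Section regularity.
Context {R : realType}.
Notation mu := (@lebesgue_measure R).
Implicit Types (f g k : R -> R).

Lemma primitive_on_is_derive a b f g x : primitive_on a b f g -> x \in `]a, b[ ->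
  {for x, continuous g} -> is_derive x (1 : R) f (g x).
Proof.
move=> [gi fE] xab cg; have /andP[ax xb] : a < x < b by move: xab; rewrite in_itv.
have [d1 d2] := continuous_FTC1_closed xb gi ax cg.
have H : is_derive x (1 : R) (fun y => \int[mu]_(t in `[a, y]) g t) (g x).
  by split; [exact: d1|rewrite -d2 derive1E].
have := is_deriveD (is_derive_cst (f a) x (1 : R)) H; rewrite add0r.
apply: near_eq_is_derive.
have : nbhs x `]a, b[%classic by apply: near_in_itvoo.
by apply: filterS => y yab; rewrite fctE/= (fE y)//; move: yab; exact: subset_itv_oo_cc.
Qed.

Lemma Linfty_ae_bounded f : f \in Lfun mu +oo%E ->
  exists C, {ae mu, forall x, `|f x| <= C}.
Proof.
move=> /andP[/[!inE]/= mf]; rewrite /finite_norm unlock /Lnorm.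
case: ifPn => [_|/negP mu0 _]; last first.
  exists 0, setT; split => //; apply/eqP; rewrite eq_le measure_ge0 andbT leNgt; exact/negP.
move=> H; exact: (@ess_supr_bounded _ _ _ mu (fun x => `|f x|) H).
Qed.

Lemma primitive_on_lipschitz a b f g C x y : primitive_on a b f g ->
  {ae mu, forall t, t \in `]a, b[ -> `|g t| <= C} ->
  a < x -> x <= y -> y < b -> `|f y - f x| <= C * (y - x).
Proof.
move=> fg gC ax xy yb.
rewrite (primitive_onB fg (ltW ax) xy (ltW yb)).
have gi : mu.-integrable `[x, y] (EFin \o g) by exact: (integrable_subitv (ltW ax) (ltW yb) fg.1).
apply: (le_trans (le_normr_Rintegral (measurable_set_itv _) gi)).
rewrite -(Rintegral_itv_cst _ xy).
have gni : mu.-integrable `[x, y] (EFin \o (fun t => `|g t|)) by have := integrable_norm gi.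
have ci : mu.-integrable `[x, y] (EFin \o cst C).
  by apply: continuous_itv_integrable; exact: cst_continuous.
rewrite /Rintegral; apply: fine_le.
- exact: (integrable_fin_num (measurable_set_itv _) gni).
- exact: (integrable_fin_num (measurable_set_itv _) ci).
(* Were C negative, the bound would fail at every point of ]x, b[, which has positive measure even
   when x = y, as y < b. *)
have C0 : 0 <= C.
  rewrite leNgt; apply/negP => C0.
  have : (mu `]x, b[ = 0)%E.
    apply/eqP; rewrite eq_le measure_ge0 andbT.
    case: gC => Z [mZ Z0 HZ]; rewrite -Z0; apply: le_measure; rewrite ?inE//.
    move=> t /= txb; apply: HZ => /= H; have := normr_ge0 (g t); rewrite leNgt => /negP; apply.
    apply: le_lt_trans C0; apply: H; move: txb; rewrite !in_itv/=; lra.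
  have := @lebesgue_measure_itv R `]x, b[; rewrite /= lte_fin (le_lt_trans xy yb) => H1 H2.
  have : (b%:E - x%:E = 0 :> \bar R)%E by rewrite -H1 -H2.
  by move=> [] /eqP; rewrite subr_eq0 => /eqP bx; move: (le_lt_trans xy yb); rewrite bx ltxx.
apply: ae_ge0_le_integral => //.
- exact: (measurable_int mu gni).
- move: gC; apply: filterS; first exact: (ae_filter_ringOfSetsType mu).
  move=> t H; rewrite /= in_itv/= => txy; rewrite lee_fin; apply: H; rewrite in_itv/=; lra.
Qed.

Lemma lipschitz_taylor (f f' : R -> R) (C M : R) : 0 <= C ->
  (forall z : R, is_derive z (1 : R) f (f' z)) ->
  (forall x y, `|x| <= M -> `|y| <= M -> `|f' x - f' y| <= C * `|x - y|) ->
  forall x y, `|x| <= M -> `|y| <= M -> `|f x - f y - f' y * (x - y)| <= C * (x - y) ^+ 2.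
Proof.
move=> C0 df lf x y xM yM.
have cf : continuous f.
  by move=> z; apply/differentiable_continuous/derivable1_diffP; have [] := df z.
have aux a b : a <= b -> `|a| <= M -> `|b| <= M -> exists2 c : R, f b - f a = f' c * (b - a) &
    a <= c <= b /\ `|c| <= M.
  move=> ab aM bM.
  have [c cab E] := MVT_segment ab (fun z _ => df z) (continuous_subspaceT cf).
  exists c => //; move: cab aM bM; rewrite in_itv/= !ler_norml; lra.
have sq : (x - y) ^+ 2 = `|x - y| * `|x - y| by rewrite -normrM -expr2 ger0_norm ?sqr_ge0.
have [xy|/ltW xy] := leP y x.
  have [c -> [cxy cM]] := aux _ _ xy yM xM.
  rewrite -mulrBl normrM sq mulrA ler_wpM2r// (le_trans (lf _ _ cM yM))// ler_wpM2l//.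
  by rewrite !ger0_norm//; lra.
have [c E [cxy cM]] := aux _ _ xy xM yM.
have -> : f x - f y = f' c * (x - y) by rewrite -opprB E; ring.
rewrite -mulrBl normrM sq mulrA ler_wpM2r// (le_trans (lf _ _ cM yM))// ler_wpM2l//.
by rewrite distrC (distrC x) !ger0_norm//; lra.
Qed.

Lemma derive_lipschitz (f f' : R -> R) (C M : R) : 0 <= M ->
  (forall z : R, is_derive z (1 : R) f (f' z)) ->
  (forall x y, `|x| <= M -> `|y| <= M -> `|f' x - f' y| <= C * `|x - y|) ->
  forall x y, `|x| <= M -> `|y| <= M -> `|f x - f y| <= (`|f' 0| + `|C| * M) * `|x - y|.
Proof.
move=> M0 df lf.
have cf : continuous f.
  by move=> z; apply/differentiable_continuous/derivable1_diffP; have [] := df z.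
have aux a b : a <= b -> `|a| <= M -> `|b| <= M -> `|f b - f a| <= (`|f' 0| + `|C| * M) * `|b - a|.
  move=> ab aM bM.
  have [c cab ->] := MVT_segment ab (fun z _ => df z) (continuous_subspaceT cf).
  have cM : `|c| <= M by move: cab aM bM; rewrite in_itv/= !ler_norml; lra.
  rewrite normrM ler_wpM2r//.
  have := lf c 0 cM ltac:(by rewrite normr0); rewrite subr0 => H.
  have := ler_normD (f' 0) (f' c - f' 0); rewrite addrC subrK => /le_trans; apply.
  rewrite lerD2l (le_trans H)// (@le_trans _ _ (`|C| * `|c|))//.
    by rewrite ler_wpM2r// ler_norm.
  by rewrite ler_wpM2l.
move=> x y xM yM; have [xy|/ltW xy] := leP y x; first exact: aux.
by rewrite distrC (distrC x); exact: aux.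
Qed.

(** On each bounded interval k is a primitive of a continuous function, hence differentiable inside;
    that derivative is a primitive of an essentially bounded function, hence Lipschitz. The local
    derivatives all agree with [derive1 k]. *)
Lemma W2oo_loc_C11 k : W2oo_loc k -> exists k' : R -> R,
  (forall z : R, is_derive z (1 : R) k (k' z)) /\
  forall M, exists2 C, 0 < C & forall x y, `|x| <= M -> `|y| <= M -> `|k' x - k' y| <= C * `|x - y|.
Proof.
move=> hk; exists (derive1 k).
have H a b : a < b -> exists k', exists2 k'', (forall z : R, z \in `]a, b[ -> is_derive z (1 : R) k (k' z)) &
    primitive_on a b k' k'' /\ Lp_on +oo%E a b k''.
  move=> ab; have [D [D0 Dk D2]] := hk a b ab.
  exists (D 1%N), (D 2%N); last by split => //; exact: Dk.
  move=> z zab; rewrite -D0; apply: (primitive_on_is_derive (Dk 0%N isT) zab).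
  exact: primitive_on_continuous (Dk 1%N isT) zab.
split=> [z|M].
  have [|k' [k'' H1 _]] := H (z - 1) (z + 1); first lra.
  have [d1 d2] := H1 z ltac:(rewrite in_itv/=; lra).
  by split => //; rewrite derive1E.
have MM : - (`|M| + 1) < `|M| + 1 by have := normr_ge0 M; lra.
have [k' [k'' H1 [H2 H3]]] := H _ _ MM.
have [C HC] := Linfty_ae_bounded H3.
exists (`|C| + 1); first by rewrite ltr_wpDl.
have kE z : `|z| <= M -> derive1 k z = k' z.
  move=> zM; have [d1 d2] := H1 z ltac:(move: zM; rewrite in_itv/= ler_norml; have := ler_norm M; lra).
  by rewrite derive1E.
have {}HC : {ae mu, forall t, t \in `]- (`|M| + 1), `|M| + 1[ -> `|k'' t| <= `|C| + 1}.
  move: HC; apply: filterS; first exact: (ae_filter_ringOfSetsType mu).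
  move=> t + tM; rewrite patchE mem_set// => /le_trans; apply; have := ler_norm C; lra.
have aux x y : `|x| <= M -> `|y| <= M -> x <= y -> `|k' y - k' x| <= (`|C| + 1) * (y - x).
  move=> xM yM xy; apply: (primitive_on_lipschitz H2 HC _ xy); move: xM yM; rewrite !ler_norml;
    have := ler_norm M; lra.
move=> x y xM yM; rewrite !kE//; have [xy|/ltW xy] := leP x y.
  by rewrite distrC (le_trans (aux _ _ xM yM xy))// distrC ler_wpM2l ?ler_norm// addr_ge0.
by rewrite (le_trans (aux _ _ yM xM xy))// ler_wpM2l ?ler_norm// addr_ge0.
Qed.

(** The quadratic bound holds only near 0; farther out, monotonicity gives |k z| at least its bound
    at distance d / 2, which still dominates a multiple of z^2 as z is bounded. Monotonicity and k 0
    = 0 also make k z and z have the same sign. *)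
Lemma assumption_K_coercive k : continuous k -> {homo k : x y / x <= y} -> k 0 = 0 ->
  (exists K delta : R, [/\ 0 < K, 0 < delta &
     forall z, z \in `]- delta, delta[ -> K * z ^+ 2 <= `|k z|]) ->
  forall M : R, exists2 C : R, 0 < C & forall z, `|z| <= M -> C * `|z| ^+ 3 <= k z * z.
Proof.
move=> ck mk k0 [K [d [K0 d0 HK]]] M.
have kz z : k z * z = `|k z| * `|z|.
  rewrite -normrM; have [z0|/ltW z0] := leP 0 z.
    by rewrite ger0_norm// mulr_ge0// -k0 mk.
  by rewrite ger0_norm// -mulrNN mulr_ge0// oppr_ge0// -k0 mk.
have M0 : 0 < (`|M| + 1) ^+ 2 by rewrite exprn_gt0// ltr_wpDl.
(* The factor for |z| >= d: the lower bound at d / 2, a point of the open interval, divided by an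
   upper bound of z^2. *)
pose c2 := K * (d / 2) ^+ 2 / (`|M| + 1) ^+ 2.
have c20 : 0 < c2 by rewrite divr_gt0// mulr_gt0// exprn_gt0// divr_gt0.
exists (Num.min K c2); first by rewrite lt_min K0.
move=> z zM; rewrite kz exprSr mulrA ler_wpM2r//.
have [zd|dz] := ltP `|z| d.
  apply: le_trans (HK z _); last by rewrite in_itv/= -ltr_norml.
  by rewrite -normrX [`|_ ^+ _|]ger0_norm ?sqr_ge0// ler_wpM2r ?sqr_ge0// ge_min lexx.
have H1 : K * (d / 2) ^+ 2 <= `|k z|.
  have [z0|/ltW z0] := leP 0 z.
    have := HK (d / 2) ltac:(rewrite in_itv/=; lra) => /le_trans; apply.
    rewrite ger0_norm; last by rewrite -k0 mk//; lra.
    rewrite ger0_norm; last by rewrite -k0 mk.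
    by apply: mk; move: dz; rewrite ger0_norm//; lra.
  have := HK (- (d / 2)) ltac:(rewrite in_itv/=; lra); rewrite sqrrN => /le_trans; apply.
  rewrite ler0_norm; last by rewrite -k0 mk//; lra.
  rewrite ler0_norm; last by rewrite -k0 mk.
  by rewrite lerN2; apply: mk; move: dz; rewrite ler0_norm//; lra.
apply: le_trans H1; apply: (@le_trans _ _ (c2 * `|z| ^+ 2)).
  by rewrite ler_wpM2r ?exprn_ge0// ge_min lexx orbT.
rewrite /c2 mulrAC ler_pdivrMr// ler_wpM2l//; first by rewrite mulr_ge0 ?sqr_ge0// ltW.
rewrite lerXn2r ?nnegrE ?addr_ge0//; have := ler_norm M; lra.
Qed.

End regularity.

(** * Absolutely continuous functions: integrability, integration by parts, sup bounds *)

Section primitives.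
Context {R : realType}.
Notation mu := (@lebesgue_measure R).
Implicit Types (a b c x y : R) (f g h : R -> R).

Lemma Rintegral_oo_cc a b f : mu.-integrable `[a, b] (EFin \o f) ->
  \int[mu]_(t in `]a, b[) f t = \int[mu]_(t in `[a, b]) f t.
Proof.
move=> fi.
have fi1 : mu.-integrable `]a, b] (EFin \o f).
  by apply: (integrableS (measurable_set_itv _) (measurable_set_itv _) _ fi); apply: subset_itv; rewrite bnd_simp.
have fi2 : mu.-integrable `]a, b[ (EFin \o f).
  by apply: (integrableS (measurable_set_itv _) (measurable_set_itv _) _ fi); apply: subset_itv; rewrite bnd_simp.
by rewrite Rintegral_itv_bndo_bndc// Rintegral_itv_obnd_cbnd.
Qed.

Lemma primitive_on_bounded a b f g : primitive_on a b f g ->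
  exists M, forall x, a <= x <= b -> `|f x| <= M.
Proof.
move=> fg; exists (`|f a| + \int[mu]_(t in `[a, b]) `|g t|) => x /andP[ax xb].
have gi := fg.1.
have gi' := integrable_subitv (lexx a) xb gi.
have := primitive_onB fg (lexx _) ax xb => E.
have -> : f x = f a + (f x - f a) by ring.
rewrite (le_trans (ler_normD _ _))// lerD2l E.
apply: (le_trans (le_normr_Rintegral (measurable_set_itv _) gi')).
have gn : mu.-integrable `[a, b] (EFin \o (fun t => `|g t|)) by have := integrable_norm gi.
by rewrite (@Rintegral_split _ a x b) ?ax// lerDl; apply: Rintegral_ge0.
Qed.

Lemma primitive_on_within_continuous a b f g : a <= b -> primitive_on a b f g ->
  {within `[a, b], continuous f}.
Proof.
move=> ab [gi fE].
have H : {within `[a, b], continuous (fun x => f a + \int[mu]_(t in `[a, x]) g t)}.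
  move=> x; apply: cvgD; first exact: cvg_cst.
  exact: (parameterized_integral_continuous ab gi).
apply: (subspace_eq_continuous _ H) => x; rewrite inE/= => xab.
by rewrite /from_subspace (fE x).
Qed.

Lemma primitive_on_measurable a b f g : a <= b -> primitive_on a b f g ->
  measurable_fun (`[a, b]%classic : set (measurableTypeR R)) f.
Proof.
move=> ab fg; apply: subspace_continuous_measurable_fun; first exact: measurable_set_itv.
exact: primitive_on_within_continuous fg.
Qed.

Lemma primitive_on_mul_integrable a b f g h : a <= b -> primitive_on a b f g ->
  mu.-integrable `[a, b] (EFin \o h) -> mu.-integrable `[a, b] (EFin \o (fun x => f x * h x)).
Proof.
move=> ab fg hi; have [M HM] := primitive_on_bounded fg.
have := integrableMr (measurable_set_itv _) (primitive_on_measurable ab fg) _ hi.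
apply; exists M; split; first exact: num_real.
by move=> N MN x /=; rewrite in_itv/= => xab; apply: le_trans (ltW MN); exact: HM.
Qed.

Lemma primitive_on_integrable a b f g : a <= b -> primitive_on a b f g ->
  mu.-integrable `[a, b] (EFin \o f).
Proof.
move=> ab fg; have c1 : mu.-integrable `[a, b] (EFin \o (cst 1 : R -> R)).
  by apply: continuous_itv_integrable; exact: cst_continuous.
have := primitive_on_mul_integrable ab fg c1.
by apply: eq_integrable => [|x _]; [exact: measurable_set_itv|rewrite /= mulr1].
Qed.

Lemma Lp_on2_bounded a b f M : measurable_fun (`]a, b[%classic : set (measurableTypeR R)) f ->
  (forall x, a < x < b -> `|f x| <= M) -> Lp_on 2%:E a b f.
Proof.
move=> mf fM.
have mfD : measurable_fun [set: measurableTypeR R] (f \_ `]a, b[).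
  by apply/(measurable_restrictT _ (measurable_set_itv _)).
rewrite /Lp_on inE; apply/andP; split; rewrite inE//=.
rewrite /finite_norm unlock /Lnorm poweR_lty//.
have : mu.-integrable setT (EFin \o (fun x => `|(f \_ `]a, b[) x| `^ 2)).
  have : mu.-integrable `]a, b[ (EFin \o (fun x => `|f x| `^ 2)).
    apply: measurable_bounded_integrable.
    - exact: measurable_set_itv.
    - have := @lebesgue_measure_itv R `]a, b[ => H.
      by rewrite [X in (X < _)%E]H/=; case: ifP => _; rewrite ?ltry// -EFinB ltry.
    - apply: (measurableT_comp (f := fun y : R => y `^ 2)); first exact: measurable_powR.
      exact: measurableT_comp.
    - exists (M ^+ 2); split; first exact: num_real.
      move=> N MN x /=; rewrite in_itv/= => /fM fxM; apply: le_trans (ltW MN).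
      rewrite ger0_norm ?powR_ge0// powR_mulrn// lerXn2r ?nnegrE//.
      exact: le_trans fxM.
  move/(integrable_mkcond _ (measurable_set_itv _)); apply: eq_integrable => // x _ /=.
  by rewrite !patchE; case: ifPn => //= _; rewrite normr0 powR0.
move=> /integrable_lty => /(_ measurableT); apply: le_lt_trans.
by [].
Qed.

Lemma primitive_on_Lp2 a b f g : a <= b -> primitive_on a b f g -> Lp_on 2%:E a b f.
Proof.
move=> ab fg; have [M HM] := primitive_on_bounded fg.
apply: (@Lp_on2_bounded _ _ _ M).
  by apply: measurable_funS (primitive_on_measurable ab fg) => //; exact: subset_itv_oo_cc.
by move=> x /andP[ax xb]; rewrite HM// !ltW.
Qed.

Lemma Lp_on2_integrable a b f : Lp_on 2%:E a b f ->
  mu.-integrable setT (EFin \o (f \_ `]a, b[)).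
Proof.
move=> lf; have l1 : Lp_on 2%:E a b (cst 1 : R -> R).
  by apply: (@Lp_on2_bounded _ _ _ 1) => // x _; rewrite /= normr1.
have /Lfun1_integrable := Lfun2_mul_Lfun1 lf l1.
apply: eq_integrable => // x _ /=.
by rewrite !patchE; case: ifPn => // _; rewrite /= ?mulr1// mul0r.
Qed.

Lemma Lp_on2_mul_integrable a b f g : Lp_on 2%:E a b f -> Lp_on 2%:E a b g ->
  mu.-integrable `]a, b[ (EFin \o (fun x => f x * g x)).
Proof.
move=> hf hg; apply/(integrable_mkcond _ (measurable_set_itv _)).
have /Lfun1_integrable := Lfun2_mul_Lfun1 hf hg.
apply: eq_integrable => // x _ /=.
by rewrite !patchE; case: ifPn => // _; rewrite mulr0.
Qed.

(** Cauchy-Schwarz against the constant 1: integrate 2 c |f| <= f^2 + c^2 and take the optimal c = I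
    / (b - a). *)
Lemma L1_norm_sqr_le a b f : a < b -> Lp_on 2%:E a b f ->
  (\int[mu]_(t in `]a, b[) `|f t|) ^+ 2 <= (b - a) * \int[mu]_(t in `]a, b[) (f t * f t).
Proof.
move=> ab lf; set I := \int[mu]_(t in _) `|_|; set N := \int[mu]_(t in _) _.
have fi : mu.-integrable `]a, b[ (EFin \o (fun t => `|f t|)).
  have : mu.-integrable `]a, b[ (EFin \o f).
    apply/(integrable_mkcond _ (measurable_set_itv _)); rewrite restrict_EFin.
    exact: Lp_on2_integrable.
  by move=> /integrable_norm.
have fi2 := Lp_on2_mul_integrable lf lf.
have ci c : mu.-integrable `]a, b[ (EFin \o (cst c : R -> R)).
  have := @continuous_itv_integrable _ (cst c) a b (@cst_continuous _ _ c).
  apply: (integrableS (measurable_set_itv _) (measurable_set_itv _)).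
  exact: subset_itv_oo_cc.
have I0 : 0 <= I by apply: Rintegral_ge0.
have H c : 0 <= c -> 2 * c * I <= N + c ^+ 2 * (b - a).
  move=> c0; rewrite -(Rintegral_itv_cst (c ^+ 2) (ltW ab)) -Rintegral_oo_cc; last first.
    by apply: continuous_itv_integrable; exact: cst_continuous.
  rewrite -(RintegralD (measurable_set_itv _) fi2 (ci _)) -(RintegralZl _ (measurable_set_itv _) fi).
  apply: le_Rintegral; first exact: measurable_set_itv.
  - by have := integrableZl (measurable_set_itv _) (2 * c) fi; apply: eq_integrable => //.
  - by have := integrableD (measurable_set_itv _) fi2 (ci (c ^+ 2)); apply: eq_integrable => //.
  - move=> x _; change (2 * c * `|f x| <= f x * f x + c ^+ 2); have := sqr_ge0 (`|f x| - c).
    have -> : f x * f x = `|f x| ^+ 2 by rewrite -normrX ger0_norm ?sqr_ge0// expr2.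
    rewrite sqrrB; lra.
have ba : 0 < b - a by rewrite subr_gt0.
have := H (I / (b - a)) (divr_ge0 I0 (ltW ba)).
have -> : (I / (b - a)) ^+ 2 * (b - a) = I ^+ 2 / (b - a) by field; rewrite gt_eqF.
have -> : 2 * (I / (b - a)) * I = 2 * (I ^+ 2 / (b - a)) by field; rewrite gt_eqF.
move=> H2; have : I ^+ 2 / (b - a) <= N by lra.
by rewrite ler_pdivrMr// mulrC.
Qed.

(* Phi has increments o(1) times those of G on fine partitions, where G need not
   be Lipschitz: a substitute for differentiating Phi almost everywhere *)
Lemma small_increments_eq (Phi G : R -> R) a b C : a <= b -> 0 <= C ->
  (forall x y, a <= x -> x <= y -> y <= b -> `|Phi y - Phi x| <= C * (y - x) * (G y - G x)) ->
  Phi b = Phi a.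
Proof.
move=> ab C0 H; apply/eqP; rewrite -subr_eq0 -normr_le0; apply/ler_addgt0Pr => e e0; rewrite add0r.
have [n hn] : exists N : nat, `|C * (b - a) * (G b - G a)| / e < N%:R.
  by exists (Num.truncn (`|C * (b - a) * (G b - G a)| / e)).+1; exact: truncnS_gt.
have n0 : (0 : R) < n%:R by apply: le_lt_trans hn; rewrite divr_ge0 ?normr_ge0// ltW.
pose p i := a + i%:R * ((b - a) / n%:R).
have pn : p n = b by rewrite /p mulrC divfK ?gt_eqF// addrC subrK.
have p0 : p 0%N = a by rewrite /p mul0r addr0.
have h0 : 0 <= (b - a) / n%:R by rewrite divr_ge0 ?ler0n// subr_ge0.
have dp i : p i.+1 - p i = (b - a) / n%:R by rewrite /p -natr1; ring.
have pab i : (i <= n)%N -> a <= p i <= b.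
  by move=> ni; rewrite -[X in _ <= _ <= X]pn /p lerDl mulr_ge0 ?ler0n//= lerD2l ler_wpM2r// ler_nat.
rewrite -pn -p0 -(telescope_sumr (fun i => Phi (p i)) (leq0n n)) (le_trans (ler_norm_sum _ _ _))//.
rewrite (@le_trans _ _ (\sum_(0 <= i < n) C * ((b - a) / n%:R) * (G (p i.+1) - G (p i))))//.
  rewrite big_nat [leRHS]big_nat; apply: ler_sum => i /andP[_ ni].
  rewrite -(dp i); apply: H; [by have /andP[] := pab i (ltnW ni)| |by have /andP[] := pab i.+1 ni].
  by rewrite -subr_ge0 dp.
rewrite -mulr_sumr (telescope_sumr (fun i => G (p i)) (leq0n n)) pn p0.
have -> : C * ((b - a) / n%:R) * (G b - G a) = C * (b - a) * (G b - G a) / n%:R by ring.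
rewrite ler_pdivrMr// (le_trans (ler_norm _))// ltW// (mulrC e).
by move: hn; rewrite ltr_pdivrMr.
Qed.

(** Let Phi be the defect of the identity on [a, x]. Its increment over [x, y] is the integral of (f
    - f x) g' - f' (g y - g), at most 2 M (y - x) times the integral of |g'| over [x, y];
    [small_increments_eq] then makes Phi constant. *)
Lemma primitive_on_by_parts a b f f' g g' M : a <= b ->
  primitive_on a b f f' -> primitive_on a b g g' -> (forall x, a <= x <= b -> `|f' x| <= M) ->
  \int[mu]_(t in `[a, b]) (f t * g' t) + \int[mu]_(t in `[a, b]) (f' t * g t) = f b * g b - f a * g a.
Proof.
move=> ab fF gG fM.
have fgi := primitive_on_mul_integrable ab fF gG.1.
have gfi : mu.-integrable `[a, b] (EFin \o (fun x => f' x * g x)).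
  have := primitive_on_mul_integrable ab gG fF.1.
  by apply: eq_integrable => [|x _]; [exact: measurable_set_itv|rewrite /= mulrC].
have g'i : mu.-integrable `[a, b] (EFin \o (fun t => `|g' t|)) by have := integrable_norm gG.1.
pose Phi x := \int[mu]_(t in `[a, x]) (f t * g' t) + \int[mu]_(t in `[a, x]) (f' t * g t) - f x * g x.
have M0 : 0 <= M by apply: le_trans (fM a _); rewrite ?lexx.
suff : Phi b = Phi a.
  by rewrite /Phi !Rintegral_itv1; lra.
apply: (@small_increments_eq _ (fun x => \int[mu]_(t in `[a, x]) `|g' t|) _ _ (2 * M)) => //.
  by rewrite mulr_ge0.
move=> x y ax xy yb.
have S h : mu.-integrable `[a, b] (EFin \o h) -> mu.-integrable `[x, y] (EFin \o h).
  exact: integrable_subitv.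
have S' h : mu.-integrable `[a, b] (EFin \o h) -> mu.-integrable `[a, y] (EFin \o h).
  exact: integrable_subitv.
have axy : a <= x <= y by rewrite ax.
have -> : \int[mu]_(t in `[a, y]) `|g' t| - \int[mu]_(t in `[a, x]) `|g' t| = \int[mu]_(t in `[x, y]) `|g' t|.
  by rewrite (Rintegral_split axy (S' _ g'i)); ring.
set Gam := \int[mu]_(t in `[x, y]) `|g' t|.
have mi := measurable_set_itv `[x, y].
have i1 := S _ fgi; have i2 := S _ gfi; have i3 := S _ gG.1; have i4 := S _ fF.1.
have i3' : mu.-integrable `[x, y] (EFin \o (fun t => f x * g' t)).
  by have := integrableZl mi (f x) i3; apply: eq_integrable.
have i4' : mu.-integrable `[x, y] (EFin \o (fun t => g y * f' t)).
  by have := integrableZl mi (g y) i4; apply: eq_integrable.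
have i12 : mu.-integrable `[x, y] (EFin \o (fun t => f t * g' t + f' t * g t)).
  by have := integrableD mi i1 i2; apply: eq_integrable.
have i34 : mu.-integrable `[x, y] (EFin \o (fun t => f x * g' t + g y * f' t)).
  by have := integrableD mi i3' i4'; apply: eq_integrable.
have -> : Phi y - Phi x = \int[mu]_(t in `[x, y]) (f t * g' t + f' t * g t - (f x * g' t + g y * f' t)).
  rewrite (RintegralB mi i12 i34) (RintegralD mi i1 i2) (RintegralD mi i3' i4').
  rewrite (RintegralZl _ mi i3) (RintegralZl _ mi i4).
  rewrite -(primitive_onB fF ax xy yb) -(primitive_onB gG ax xy yb).
  rewrite /Phi (Rintegral_split axy (S' _ fgi)) (Rintegral_split axy (S' _ gfi)); ring.
have i5 : mu.-integrable `[x, y] (EFin \o (fun t => f t * g' t + f' t * g t - (f x * g' t + g y * f' t))).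
  by have := integrableB mi i12 i34; apply: eq_integrable.
apply: (le_trans (le_normr_Rintegral mi i5)).
have i6 : mu.-integrable `[x, y] (EFin \o (fun t => M * (y - x) * `|g' t|)).
  by have := integrableZl mi (M * (y - x)) (S _ g'i); apply: eq_integrable.
have i7 : mu.-integrable `[x, y] (EFin \o (cst (M * Gam) : R -> R)).
  by apply: continuous_itv_integrable; exact: cst_continuous.
have i8 : mu.-integrable `[x, y] (EFin \o (fun t => M * (y - x) * `|g' t| + M * Gam)).
  by have := integrableD mi i6 i7; apply: eq_integrable.
apply: (@le_trans _ _ (\int[mu]_(t in `[x, y]) (M * (y - x) * `|g' t| + M * Gam))).
  apply: le_Rintegral => //; first by have := integrable_norm i5.
  move=> t; rewrite /= in_itv/= => /andP[xt ty].
  have -> : f t * g' t + f' t * g t - (f x * g' t + g y * f' t) = (f t - f x) * g' t - f' t * (g y - g t) by ring.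
  rewrite (le_trans (ler_normB _ _))// !normrM lerD//.
    rewrite ler_wpM2r// (primitive_onB fF ax xt (le_trans ty yb)).
    apply: (@le_trans _ _ (M * (t - x))).
      apply: Rintegral_itv_le => //; first exact: (integrable_subitv (lexx x) ty i4).
      by move=> r /andP[xr rt]; apply: fM; lra.
    by rewrite ler_wpM2l//; lra.
  rewrite ler_pM//; first by apply: fM; lra.
  rewrite (primitive_onB gG (le_trans ax xt) ty yb).
  apply: (le_trans (le_normr_Rintegral (measurable_set_itv _) (integrable_subitv xt (lexx y) i3))).
  by rewrite /Gam (@Rintegral_split _ x t y) ?xt ?ty ?(S _ g'i)// lerDr; apply: Rintegral_ge0.
rewrite (RintegralD mi i6 i7) (RintegralZl _ mi (S _ g'i)) Rintegral_itv_cst// -/Gam.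
by rewrite le_eqVlt; apply/orP; left; apply/eqP; ring.
Qed.

Lemma primitive_exists a b g c : mu.-integrable `[a, b] (EFin \o g) ->
  exists2 f, primitive_on a b f g & f a = c.
Proof.
move=> gi; have fa : c + \int[mu]_(t in `[a, a]) g t = c by rewrite Rintegral_itv1 addr0.
exists (fun x => c + \int[mu]_(t in `[a, x]) g t) => //.
by split => // x xab; rewrite fa.
Qed.

End primitives.

Section primitive_bounds.
Context {R : realType}.
Notation mu := (@lebesgue_measure R).
Implicit Types (a b c x y : R) (f g h : R -> R).

Lemma primitive_on_increment_le a b f g x y : primitive_on a b f g -> a <= x <= b -> a <= y <= b ->
  `|f y - f x| <= \int[mu]_(t in `[a, b]) `|g t|.
Proof.
move=> fg; have gn : mu.-integrable `[a, b] (EFin \o (fun t => `|g t|)).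
  by have := integrable_norm fg.1.
have aux r s : a <= r -> r <= s -> s <= b -> `|f s - f r| <= \int[mu]_(t in `[a, b]) `|g t|.
  move=> ar rs sb; rewrite (primitive_onB fg ar rs sb).
  have ab : a <= b by lra.
  apply: (le_trans (le_normr_Rintegral (measurable_set_itv _) (integrable_subitv ar sb fg.1))).
  rewrite (@Rintegral_split _ a r b) ?ar ?(le_trans rs)//.
  rewrite (@Rintegral_split _ r s b) ?rs//; last exact: (integrable_subitv ar (lexx b) gn).
  have : 0 <= \int[mu]_(t in `[a, r]) `|g t| by apply: Rintegral_ge0.
  have : 0 <= \int[mu]_(t in `[s, b]) `|g t| by apply: Rintegral_ge0.
  lra.
move=> /andP[ax xb] /andP[ay yb]; have [xy|/ltW xy] := leP x y; first exact: aux.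
by rewrite distrC; exact: aux.
Qed.

(** The embedding of H^1 into the bounded functions, in quantitative form. *)
Lemma primitive_on_increment_sqr_le a b f g x y : a < b -> primitive_on a b f g -> Lp_on 2%:E a b g ->
  a <= x <= b -> a <= y <= b ->
  (f y - f x) ^+ 2 <= (b - a) * \int[mu]_(t in `]a, b[) (g t * g t).
Proof.
move=> ab fg lg xab yab; apply: le_trans (L1_norm_sqr_le ab lg).
have gn : mu.-integrable `[a, b] (EFin \o (fun t => `|g t|)).
  by have := integrable_norm fg.1.
rewrite (Rintegral_oo_cc gn) -[leLHS]ger0_norm ?sqr_ge0// normrX lerXn2r ?nnegrE//.
  by apply: Rintegral_ge0.
exact: primitive_on_increment_le.
Qed.

Lemma primitive_on_bound_at a b f g M c x0 : a <= b -> primitive_on a b f g ->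
  (forall x, a <= x <= b -> `|g x| <= M) -> a <= x0 <= b -> `|f x0| <= c ->
  (forall x, a <= x <= b -> `|f x| <= c + M * (b - a)) /\
  (forall x y, a <= x <= b -> a <= y <= b -> `|f x - f y| <= M * `|x - y|).
Proof.
move=> ab fg gM xab fc.
have M0 : 0 <= M by apply: le_trans (gM a _); rewrite // lexx ab.
have aux x y : a <= x -> x <= y -> y <= b -> `|f y - f x| <= M * (y - x).
  move=> ax xy yb; rewrite (primitive_onB fg ax xy yb); apply: Rintegral_itv_le => //.
    exact: (integrable_subitv ax yb fg.1).
  by move=> t /andP[xt ty]; apply: gM; lra.
have lip x y : a <= x <= b -> a <= y <= b -> `|f x - f y| <= M * `|x - y|.
  move=> /andP[ax xb] /andP[ay yb]; have [xy|/ltW xy] := leP x y.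
    by rewrite distrC (distrC x) (ger0_norm (_ : 0 <= y - x)) ?subr_ge0//; exact: aux.
  by rewrite (ger0_norm (_ : 0 <= x - y)) ?subr_ge0//; exact: aux.
split => // x xab'; have -> : f x = f x0 + (f x - f x0) by ring.
rewrite (le_trans (ler_normD _ _))// lerD// (le_trans (lip _ _ xab' xab))// ler_wpM2l//.
by rewrite ler_norml; lra.
Qed.

Lemma primitive_on_cumulative a b g : mu.-integrable `[a, b] (EFin \o g) ->
  primitive_on a b (fun x => \int[mu]_(t in `[a, x]) g t) g.
Proof. by move=> gi; split => // x _; rewrite Rintegral_itv1 add0r. Qed.

End primitive_bounds.

(** * The energy space and its tip functionals *)

Section states.
Context {R : realType} {rho Lam L m J : {posnum R}}.
Notation mu := (@lebesgue_measure R).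
Notation state := (state rho Lam L m J).
Notation H := (H rho Lam L m J).
Notation ell := (L%:num).
Implicit Types (w : state) (y z : H).

(** The energy inner product as a function of u'' itself, so that any list of weak derivatives can
    stand for the chosen [wderiv]. *)
Definition energy_ip (f v : R -> R) (xi psi : R) (g v' : R -> R) (xi' psi' : R) : R :=
  Lam%:num / 2 * dot_L2 L f g + rho%:num / 2 * dot_L2 L v v'
  + (2 * J%:num)^-1 * (xi * xi') + (2 * m%:num)^-1 * (psi * psi').

Lemma sipE w1 w2 D1 D2 : sobolev_derivs 2%:E 2 0 ell (st_u w1) D1 ->
  sobolev_derivs 2%:E 2 0 ell (st_u w2) D2 ->
  sip w1 w2 = energy_ip (D1 2%N) (st_v w1) (st_xi w1) (st_psi w1)
                        (D2 2%N) (st_v w2) (st_xi w2) (st_psi w2).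
Proof.
move=> h1 h2; rewrite /energy_ip; congr (_ * _ + _ + _ + _).
have [_ _ l1] := h1; have [_ _ l2] := h2.
have [_ _ g1] := wderivP (ex_intro _ D1 h1); have [_ _ g2] := wderivP (ex_intro _ D2 h2).
have [_ e1] := wderiv_unique h1; have [_ e2] := wderiv_unique h2.
by rewrite (dot_L2_ae g1 l1 g2 e1) dot_L2C (dot_L2_ae g2 l2 l1 e2) dot_L2C.
Qed.

Lemma clamped_state w : exists D, clamped 2 ell (st_u w) D.
Proof. by have /asboolP[] := valP w. Qed.

Lemma st_v_Lp w : Lp_on 2%:E 0 ell (st_v w).
Proof. by have /asboolP[] := valP w. Qed.

Lemma st_u_linear (a : R) w1 w2 : st_u (a *: w1 + w2) = a *: st_u w1 + st_u w2.
Proof. by []. Qed.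

Lemma st_psi_linear (a : R) w1 w2 : st_psi (a *: w1 + w2) = a * st_psi w1 + st_psi w2.
Proof. by []. Qed.

Lemma energy_ip_components_le f v xi psi N : energy_ip f v xi psi f v xi psi <= N ->
  [/\ Lam%:num / 2 * dot_L2 L f f <= N, rho%:num / 2 * dot_L2 L v v <= N,
      (2 * J%:num)^-1 * (xi * xi) <= N & (2 * m%:num)^-1 * (psi * psi) <= N].
Proof.
rewrite /energy_ip => H1.
have h1 : 0 <= Lam%:num / 2 * dot_L2 L f f by rewrite mulr_ge0 ?dot_L2_ge0 ?divr_ge0.
have h2 : 0 <= rho%:num / 2 * dot_L2 L v v by rewrite mulr_ge0 ?dot_L2_ge0 ?divr_ge0.
have h3 : 0 <= (2 * J%:num)^-1 * (xi * xi) by rewrite -expr2 mulr_ge0 ?sqr_ge0.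
have h4 : 0 <= (2 * m%:num)^-1 * (psi * psi) by rewrite -expr2 mulr_ge0 ?sqr_ge0.
split; lra.
Qed.

(** As u'(0) = u(0) = 0, u' is bounded by the L^2 norm of u'', and u(L) by L times the sup of u'.
    Vectors of zero seminorm thus have zero tip values, so these descend to the quotient. *)
Lemma trace_bound : exists2 B : R, 0 <= B &
  forall w, `|st_u w ell| <= B * snorm w /\ `|st_psi w / m%:num| <= B * snorm w.
Proof.
have ell0 : (0:R) < ell by [].
(* B1 comes from u(L)^2 <= L^2 sup u'^2 <= L^3 times the integral of u''^2, and B2 from psi^2 / m^2
   = (2 / m) psi^2 / (2 m). *)
pose B1 : R := ell ^+ 3 * (2 / Lam%:num); pose B2 : R := 2 / m%:num.
have B10 : 0 <= B1 by rewrite mulr_ge0 ?exprn_ge0 ?divr_ge0.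
have B20 : 0 <= B2 by rewrite divr_ge0.
exists (Num.sqrt (B1 + B2)); first exact: sqrtr_ge0.
move=> w; have [D [hD D0 D1]] := clamped_state w.
have sq : snorm w ^+ 2 = sip w w by rewrite /snorm sqr_sqrtr ?sip_ge0.
have := sipE hD hD; set N := sip w w => NE.
have [n1 _ _ n4] := energy_ip_components_le (eq_ind N (fun t => t <= N) (lexx N) _ NE).
have N0 : 0 <= N by exact: sip_ge0.
have toroot (x : R) : x ^+ 2 <= (B1 + B2) * N -> `|x| <= Num.sqrt (B1 + B2) * snorm w.
  move=> h; rewrite -(@ler_pXn2r _ 2)// ?nnegrE ?mulr_ge0 ?sqrtr_ge0//.
  by rewrite exprMn sqr_sqrtr ?addr_ge0// sq -normrX ger0_norm ?sqr_ge0.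
split; apply: toroot.
- apply: (@le_trans _ _ (B1 * N)); last by rewrite ler_wpM2r// lerDl.
  have [E0 Dk D2] := hD.
  have zl : 0 <= (0:R) <= ell by rewrite lexx ltW.
  have ll : (0:R) <= ell <= ell by rewrite lexx ltW.
  have bd x : 0 <= x <= ell -> (D 1%N x) ^+ 2 <= ell * (2 / Lam%:num * N).
    move=> xl; have := primitive_on_increment_sqr_le ell0 (Dk 1%N isT) D2 zl xl.
    rewrite D1 !subr0 => /le_trans; apply; rewrite ler_wpM2l ?(ltW ell0)//.
    rewrite -/(dot_L2 L (D 2%N) (D 2%N)); have l0 : (Lam%:num : R) != 0 by [].
    have -> : dot_L2 L (D 2%N) (D 2%N) = 2 / Lam%:num * (Lam%:num / 2 * dot_L2 L (D 2%N) (D 2%N)) by field.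
    by rewrite ler_wpM2l// divr_ge0.
  have bd' x : 0 <= x <= ell -> `|D 1%N x| <= Num.sqrt (ell * (2 / Lam%:num * N)).
    by move=> /bd h; rewrite -sqrtr_sqr ler_wsqrtr.
  have [H1 _] := primitive_on_bound_at (ltW ell0) (Dk 0%N isT) bd' zl (c := 0) ltac:(by rewrite D0 normr0).
  have := H1 _ ll; rewrite E0 add0r subr0 => H2.
  have -> : (st_u w ell) ^+ 2 = `|st_u w ell| ^+ 2 by rewrite -normrX ger0_norm ?sqr_ge0.
  apply: (@le_trans _ _ ((Num.sqrt (ell * (2 / Lam%:num * N)) * ell) ^+ 2)).
    by rewrite lerXn2r ?nnegrE ?mulr_ge0 ?sqrtr_ge0.
  rewrite exprMn sqr_sqrtr ?mulr_ge0 ?divr_ge0//.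
  by rewrite /B1 le_eqVlt; apply/orP; left; apply/eqP; ring.
- apply: (@le_trans _ _ (B2 * N)); last by rewrite ler_wpM2r// lerDr.
  rewrite /B2; have m0 : (0:R) < m%:num by [].
  have -> : (st_psi w / m%:num) ^+ 2 =
      (2 / m%:num) * ((2 * m%:num)^-1 * (st_psi w * st_psi w)) by field; rewrite gt_eqF.
  by rewrite ler_wpM2l.
Qed.

Definition tip_displacement y : R := st_u (repr y) ell.
Definition tip_velocity y : R := st_psi (repr y) / m%:num.

Lemma tip_displacement_pi w : tip_displacement (hpi w) = st_u w ell.
Proof.
have [B _ HB] := trace_bound.
have [h _] := HB (repr (hpi w) - w); move: h; rewrite hpi_repr mulr0 normr_le0.
by rewrite -scaleN1r addrC st_u_linear /= scaleN1r addrC subr_eq0 => /eqP.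
Qed.

Lemma tip_velocity_pi w : tip_velocity (hpi w) = st_psi w / m%:num.
Proof.
have [B _ HB] := trace_bound.
have [_ h] := HB (repr (hpi w) - w); move: h; rewrite hpi_repr mulr0 normr_le0.
have m0 : m%:num != 0 :> R by [].
rewrite mulf_eq0 invr_eq0 (negbTE m0) orbF -scaleN1r addrC st_psi_linear mulN1r addrC subr_eq0.
by rewrite /tip_velocity => /eqP ->.
Qed.

Lemma tip_displacement_linear (a : R) y z :
  tip_displacement (a *: y + z) = a * tip_displacement y + tip_displacement z.
Proof.
elim/hpi_ind: y => w1; elim/hpi_ind: z => w2.
by rewrite -hpi_linear !tip_displacement_pi.
Qed.

Lemma tip_velocity_linear (a : R) y z :
  tip_velocity (a *: y + z) = a * tip_velocity y + tip_velocity z.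
Proof.
elim/hpi_ind: y => w1; elim/hpi_ind: z => w2.
by rewrite -hpi_linear !tip_velocity_pi mulrA -mulrDl.
Qed.

Lemma tip_bound : exists B : R,
  (forall y, `|tip_displacement y| <= B * `|y|) /\ (forall y, `|tip_velocity y| <= B * `|y|).
Proof.
have [B _ HB] := trace_bound; exists B; split; elim/hpi_ind => w.
  by rewrite tip_displacement_pi [X in _ <= _ * X](hnorm_pi w); have [] := HB w.
by rewrite tip_velocity_pi [X in _ <= _ * X](hnorm_pi w); have [] := HB w.
Qed.

Lemma forceE (c : R) : force rho Lam L m J c = c *: force rho Lam L m J 1.
Proof.
rewrite /force -[RHS]/(hscale c _) hscale_pi; congr hpi; apply: val_inj.
rewrite -[c *: _]addr0 linearP /= addr0.
by congr (_, _, _, _); rewrite ?scaler0//; exact/esym/mulr1.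
Qed.

Lemma tip_displacement_force : tip_displacement (force rho Lam L m J 1) = 0.
Proof. by rewrite tip_displacement_pi. Qed.

Lemma tip_velocity_force (c : R) : tip_velocity (force rho Lam L m J c) = c / m%:num.
Proof. by rewrite tip_velocity_pi. Qed.

Lemma hip_force y : 2 * hip y (force rho Lam L m J 1) = tip_velocity y.
Proof.
elim/hpi_ind: y => w; rewrite hip_pi tip_velocity_pi.
have [D [hD _ _]] := clamped_state w.
have p1 : (1 <= 2%:E :> \bar R)%E by rewrite lee_fin ler1n.
have h0 : sobolev_derivs 2%:E 2 0 ell (st_u (State rho Lam m J (force_subproof L 1))) (fun=> 0).
  exact: sobolev_derivs0.
rewrite (sipE hD h0) /energy_ip.
have d0 f : dot_L2 L f (0 : R -> R) = 0.
  rewrite /dot_L2 (_ : (fun x => _) = cst 0); first by rewrite (Rintegral_cst mu (measurable_set_itv _)) mul0r.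
  by apply/funext => x; rewrite mulr0.
have -> : st_v (State rho Lam m J (force_subproof L 1)) = 0 by [].
rewrite !d0; have -> : st_xi (State rho Lam m J (force_subproof L 1)) = 0 by [].
have -> : st_psi (State rho Lam m J (force_subproof L 1)) = 1 by [].
have m0 : (m%:num : R) != 0 by [].
by rewrite !mulr0 !add0r mulr1; field.
Qed.

End states.

(** * The beam operator: conservation, surjectivity, a priori bounds *)

Section operator.
Context {R : realType} {rho Lam L m J : {posnum R}}.
Notation mu := (@lebesgue_measure R).
Notation state := (state rho Lam L m J).
Notation H := (H rho Lam L m J).
Notation opA := (opA rho Lam L m J).
Notation ell := (L%:num).
Implicit Types (w : state) (y z : H) (u v f g : R -> R) (D : nat -> R -> R).

Let ell0 : (0 : R) < ell. Proof. by []. Qed.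

Lemma sobolev_derivs_le (n k : nat) a b f D : (k < n)%N -> a <= b ->
  sobolev_derivs 2%:E n a b f D -> sobolev_derivs 2%:E k a b f D.
Proof.
move=> kn ab [D0 Dk Dn]; split => // [i ik|]; first exact: Dk (ltn_trans ik kn).
exact: primitive_on_Lp2 ab (Dk k kn).
Qed.

Lemma Lp_on2_integrable_cc a b f : Lp_on 2%:E a b f -> mu.-integrable `[a, b] (EFin \o f).
Proof.
move=> /Lp_on2_integrable; rewrite -restrict_EFin => /(integrable_mkcond _ (measurable_set_itv _)).
move=> /integrableP[mf If]; apply/integrableP; split.
  exact: emeasurable_fun_itv_cc mf.
rewrite -integral_itv_obnd_cbnd; last first.
  apply/emeasurable_fun_itv_bndo_bndcP.
  by apply: measurableT_comp => //; exact: mf.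
rewrite -integral_itv_bndo_bndc//.
by apply: measurableT_comp => //; exact: mf.
Qed.

Lemma hip_is_state y1 y2 u1 u2 v1 v2 xi1 xi2 psi1 psi2 D1 D2 :
  is_state y1 u1 v1 xi1 psi1 -> is_state y2 u2 v2 xi2 psi2 ->
  sobolev_derivs 2%:E 2 0 ell u1 D1 -> sobolev_derivs 2%:E 2 0 ell u2 D2 ->
  hip y1 y2 = @energy_ip _ rho Lam L m J (D1 2%N) v1 xi1 psi1 (D2 2%N) v2 xi2 psi2.
Proof.
move=> [w1 E1 ->] [w2 E2 ->] h1 h2; rewrite hip_pi.
have e1 : st_u w1 = u1 by rewrite /st_u E1.
have e2 : st_u w2 = u2 by rewrite /st_u E2.
rewrite (@sipE _ _ _ _ _ _ w1 w2 D1 D2) ?e1 ?e2//.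
by rewrite /st_v /st_xi /st_psi E1 E2.
Qed.

Lemma tip_displacement_is_state y u v xi psi : is_state y u v xi psi -> tip_displacement y = u ell.
Proof. by move=> [w E ->]; rewrite tip_displacement_pi /st_u E. Qed.

Lemma tip_velocity_is_state y u v xi psi : is_state y u v xi psi -> tip_velocity y = psi / m%:num.
Proof. by move=> [w E ->]; rewrite tip_velocity_pi /st_psi E. Qed.

Lemma opA_tip y z : opA (y, z) -> tip_displacement z = tip_velocity y.
Proof.
move=> [u [v [Du [Dv [[_ _ hy] hz]]]]].
rewrite (tip_displacement_is_state hz) (tip_velocity_is_state hy).
have m0 : (m%:num : R) != 0 by [].
by field.
Qed.

(** Integrating by parts once reduces both the integral of u'' v'' and that of v u'''' to that of
    u''' v'. The boundary terms at 0 vanish as v is clamped; those at L cancel the xi and psi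
    terms. *)
Lemma opA_conservative y z : opA (y, z) -> hip y z = 0.
Proof.
move=> [u [v [Du [Dv [[[hu _ _] [hv v0 v'0] hy] hz]]]]].
rewrite (hip_is_state hy hz (sobolev_derivs_le _ (ltW ell0) hu) hv)//.
have [_ Duk _] := hu; have [Dv0 Dvk _] := hv.
have pv := Dvk 0%N isT; rewrite Dv0 in pv v0.
have pv1 := Dvk 1%N isT; have pu2 := Duk 2%N isT; have pu3 := Duk 3%N isT.
have [M1 HM1] := primitive_on_bounded pv1.
have [M2 HM2] := primitive_on_bounded pu3.
have B1 := primitive_on_by_parts (ltW ell0) pv pu3 HM1.
have B2 := primitive_on_by_parts (ltW ell0) pu2 pv1 HM2.
rewrite v0 mul0r subr0 in B1; rewrite v'0 mulr0 subr0 in B2.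
rewrite /energy_ip.
have -> : dot_L2 L (Du 2%N) (Dv 2%N) = \int[mu]_(t in `[0, ell]) (Du 2%N t * Dv 2%N t).
  apply: (@Rintegral_oo_cc _ 0 ell (fun t => Du 2%N t * Dv 2%N t)).
  exact: primitive_on_mul_integrable (ltW ell0) pu2 pv1.1.
have vi := primitive_on_mul_integrable (ltW ell0) pv pu3.1.
have -> : dot_L2 L v (fun x => - (Lam%:num / rho%:num) * Du 4%N x) =
    - (Lam%:num / rho%:num) * \int[mu]_(t in `[0, ell]) (v t * Du 4%N t).
  rewrite -(RintegralZl _ (measurable_set_itv _) vi) /dot_L2 -Rintegral_oo_cc.
    by apply: eq_Rintegral => x _; ring.
  by have := integrableZl (measurable_set_itv _) (- (Lam%:num / rho%:num)) vi; apply: eq_integrable.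
have E : \int[mu]_(t in `[0, ell]) (Dv 1%N t * Du 3%N t) = \int[mu]_(t in `[0, ell]) (Du 3%N t * Dv 1%N t).
  by apply: eq_Rintegral => x _; rewrite mulrC.
rewrite E in B1; move: B1 B2.
set i1 := \int[mu]_(t in _) (v t * _); set i2 := \int[mu]_(t in _) (Du 2%N t * _).
set i3 := \int[mu]_(t in _) _ => B1 B2.
have -> : i1 = v ell * Du 3%N ell - i3 by rewrite -B1 addrK.
have -> : i2 = Du 2%N ell * Dv 1%N ell - i3 by rewrite -B2 addrK.
have m0 : (m%:num : R) != 0 by []. have J0 : (J%:num : R) != 0 by []. have r0 : (rho%:num : R) != 0 by [].
by field; rewrite m0 J0 r0.
Qed.

Lemma in_domA_opA y : domA rho Lam L m J y -> exists z, opA (y, z).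
Proof.
move=> [u [v [Du [Dv [cu cv hy]]]]].
have [[D0 Dk Dn] _ _] := cu.
have hz : (v, (fun x => - (Lam%:num / rho%:num) * Du 4%N x), - Lam%:num * Du 2%N ell, Lam%:num * Du 3%N ell)
    \in state_pred ell.
  apply/asboolP; split; first by exists Dv.
  have p1 : (1 <= 2%:E :> \bar R)%E by rewrite lee_fin ler1n.
  have := Lp_on_lin (- (Lam%:num / rho%:num)) p1 Dn (Lp_on0 0 ell p1).
  by rewrite addr0.
by exists (hpi (State rho Lam m J hz)), u, v, Du, Dv; split => //; exists (State rho Lam m J hz).
Qed.

(** The first component of z dictates v. The equation for u is integrated four times: u''' and u''
    from L, where psi and xi prescribe them, u' and u from 0, where they vanish. *)
Lemma opA_surjective z : exists y, opA (y, z).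
Proof.
elim/hpi_ind: z => w; have [Dv cv] := clamped_state w.
have l0 : (Lam%:num : R) != 0 by []. have r0 : (rho%:num : R) != 0 by [].
have p1 : (1 <= 2%:E :> \bar R)%E by rewrite lee_fin ler1n.
pose D4 : R -> R := - (rho%:num / Lam%:num) *: st_v w.
have D4L : Lp_on 2%:E 0 ell D4.
  by have := Lp_on_lin (- (rho%:num / Lam%:num)) p1 (st_v_Lp w) (Lp_on0 0 ell p1); rewrite addr0.
have prim g c : mu.-integrable `[0, ell] (EFin \o g) -> exists2 f, primitive_on 0 ell f g & f ell = c.
  move=> gi; have [f fP fa] := primitive_exists (c - \int[mu]_(t in `[0, ell]) g t) gi.
  have := primitive_onB fP (lexx _) (ltW ell0) (lexx _) => fE.
  by exists f => //; move: fE; rewrite fa; move: (\int[mu]_(t in _) _) => I; lra.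
have [D3 P3 D3l] := prim _ (st_psi w / Lam%:num) (Lp_on2_integrable_cc D4L).
have [D2 P2 D2l] := prim _ (- st_xi w / Lam%:num) (primitive_on_integrable (ltW ell0) P3).
have [D1 P1 D10] := primitive_exists 0 (primitive_on_integrable (ltW ell0) P2).
have [D0 P0 D00] := primitive_exists 0 (primitive_on_integrable (ltW ell0) P1).
pose Du (k : nat) := nth D4 [:: D0; D1; D2; D3] k.
have cu : clamped 4 ell D0 Du.
  by split => //; split => // -[|[|[|[|//]]]].
have hy : (D0, st_u w, J%:num * Dv 1%N ell, m%:num * st_u w ell) \in state_pred ell.
  have [cu1 cu2 cu3] := cu; have [[v0 vk _] _ _] := cv.
  apply/asboolP; split; first by exists Du; split => //; exact: sobolev_derivs_le (ltW ell0) cu1.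
  by rewrite /= -v0; exact: primitive_on_Lp2 (ltW ell0) (vk 0%N isT).
exists (hpi (State rho Lam m J hy)), D0, (st_u w), Du, Dv; split.
  by split => //; exists (State rho Lam m J hy).
exists w => //; rewrite [LHS](surjective_pairing (val w)) (surjective_pairing (val w).1).
rewrite (surjective_pairing (val w).1.1).
congr (_, _, _, _).
- apply/funext => x; rewrite -/(st_v w).
  have -> : Du 4%N x = - (rho%:num / Lam%:num) * st_v w x by [].
  by field; rewrite l0 r0.
- by rewrite [Du 2%N ell]D2l -/(st_xi w); field.
- by rewrite [Du 3%N ell]D3l -/(st_psi w); field.
Qed.

(** The norm of z controls v'' and u'''' in L^2 and, through xi and psi, the values of u'' and u'''
    at L. Hence v' and u''' are bounded, which makes v and u'' bounded and Lipschitz. *)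
Lemma opA_bounds (C : R) : exists2 M : R, 0 <= M & forall z u v Du Dv,
  clamped 4 ell u Du -> clamped 2 ell v Dv ->
  is_state z v (fun x => - (Lam%:num / rho%:num) * Du 4%N x)
    (- Lam%:num * Du 2%N ell) (Lam%:num * Du 3%N ell) ->
  `|z| <= C ->
  [/\ forall x : R, 0 <= x <= ell -> `|Du 2%N x| <= M /\ `|v x| <= M,
      forall x y : R, 0 <= x <= ell -> 0 <= y <= ell ->
        `|Du 2%N x - Du 2%N y| <= M * `|x - y| /\ `|v x - v y| <= M * `|x - y|,
      `|J%:num * Dv 1%N ell| <= M & `|m%:num * v ell| <= M].
Proof.
(* Crude, but it avoids square roots in the constants below. *)
have norm_sqr (x a : R) : x ^+ 2 <= a -> `|x| <= a + 1.
  move=> xa; have : `|x| <= `|x| ^+ 2 + 1.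
    by have := sqr_ge0 (`|x| - 2^-1); rewrite sqrrB; lra.
  by rewrite -normrX [`|_ ^+ _|]ger0_norm ?sqr_ge0//; lra.
have l0 : 0 < Lam%:num :> R by [].
have r0 : 0 < rho%:num :> R by [].
set l : R := Lam%:num in l0 *; set r : R := rho%:num in r0 *.
have j0 : 0 < J%:num :> R by [].
have m0 : 0 < m%:num :> R by [].
pose b1 := ell * (2 / l * C ^+ 2) + 1.
pose b2 := 2 * J%:num / l ^+ 2 * C ^+ 2 + 1.
pose b4 := 2 * m%:num / l ^+ 2 * C ^+ 2 + 1.
pose b3 := b4 + (ell * (2 * r / l ^+ 2 * C ^+ 2) + 1).
have C2 : 0 <= C ^+ 2 by exact: sqr_ge0.
have l2 : 0 < l ^+ 2 by exact: exprn_gt0.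
have b10 : 0 <= b1 by rewrite addr_ge0// mulr_ge0// mulr_ge0 ?divr_ge0 ?(ltW l0).
have b20 : 0 <= b2 by rewrite addr_ge0// mulr_ge0 ?divr_ge0// ltW.
have b40 : 0 <= b4 by rewrite addr_ge0// mulr_ge0 ?divr_ge0// ltW.
have b30 : 0 <= b3 by rewrite addr_ge0// addr_ge0// mulr_ge0// mulr_ge0// divr_ge0 ?mulr_ge0// ltW.
(* A sum of nonnegative bounds: b3 for u''', b2 + b3 L for u'', b1 for v', b1 L for v, and the last
   two for xi and psi. *)
pose M := b3 + (b2 + b3 * ell) + b1 + b1 * ell + J%:num * b1 + m%:num * (b1 * ell).
have t1 : 0 <= b3 * ell by rewrite mulr_ge0.
have t2 : 0 <= b1 * ell by rewrite mulr_ge0.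
have t3 : 0 <= J%:num * b1 by rewrite mulr_ge0.
have t4 : 0 <= m%:num * (b1 * ell) by rewrite mulr_ge0.
have ME : M = b3 + (b2 + b3 * ell) + b1 + b1 * ell + J%:num * b1 + m%:num * (b1 * ell) by [].
clearbody M.
exists M; first lra.
move=> z u v Du Dv [hu _ _] [hv v0 v'0] hz zC.
have [_ Duk Du4] := hu; have [Dv0 Dvk Dv2] := hv.
have NE := hip_is_state hz hz hv hv.
have NC : hip z z <= C ^+ 2.
  have <- : `|z| ^+ 2 = hip z z by rewrite hnormE sqr_sqrtr ?sip_ge0.
  by rewrite lerXn2r ?nnegrE// (le_trans _ zC).
rewrite NE in NC; have [n1 n2 n3 n4] := energy_ip_components_le NC.
have zl : 0 <= (0 : R) <= ell by rewrite lexx ltW.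
have ll : (0 : R) <= ell <= ell by rewrite lexx ltW.
have Dv1b x : 0 <= x <= ell -> `|Dv 1%N x| <= b1.
  move=> xl; apply: norm_sqr.
  have := primitive_on_increment_sqr_le ell0 (Dvk 1%N isT) Dv2 zl xl.
  rewrite v'0 !subr0 => /le_trans; apply; rewrite ler_wpM2l ?(ltW ell0)//.
  rewrite -/(dot_L2 L (Dv 2%N) (Dv 2%N)).
  have -> : dot_L2 L (Dv 2%N) (Dv 2%N) = 2 / l * (l / 2 * dot_L2 L (Dv 2%N) (Dv 2%N)) by field; rewrite gt_eqF.
  by rewrite ler_wpM2l// divr_ge0// ltW.
have Du2b : `|Du 2%N ell| <= b2.
  apply: norm_sqr.
  have -> : Du 2%N ell ^+ 2 =
      2 * J%:num / l ^+ 2 * ((2 * J%:num)^-1 * (- l * Du 2%N ell * (- l * Du 2%N ell))).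
    by field; rewrite !gt_eqF.
  by rewrite ler_wpM2l// divr_ge0 ?mulr_ge0// ltW.
have Du3l : `|Du 3%N ell| <= b4.
  apply: norm_sqr.
  have -> : Du 3%N ell ^+ 2 =
      2 * m%:num / l ^+ 2 * ((2 * m%:num)^-1 * (l * Du 3%N ell * (l * Du 3%N ell))).
    by field; rewrite !gt_eqF.
  by rewrite ler_wpM2l// divr_ge0 ?mulr_ge0// ltW.
have Du3b x : 0 <= x <= ell -> `|Du 3%N x| <= b3.
  move=> xl; have -> : Du 3%N x = Du 3%N ell + (Du 3%N x - Du 3%N ell) by ring.
  rewrite (le_trans (ler_normD _ _))// lerD//; apply: norm_sqr.
  have := primitive_on_increment_sqr_le ell0 (Duk 3%N isT) Du4 ll xl.
  move=> /le_trans; apply; rewrite subr0 ler_wpM2l ?(ltW ell0)//.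
  rewrite -/(dot_L2 L (Du 4%N) (Du 4%N)).
  have E : dot_L2 L (fun x => - (l / r) * Du 4%N x) (fun x => - (l / r) * Du 4%N x) =
      (l / r) ^+ 2 * dot_L2 L (Du 4%N) (Du 4%N).
    rewrite /dot_L2 -(RintegralZl _ (measurable_set_itv _) (Lp_on2_mul_integrable Du4 Du4)).
    by apply: eq_Rintegral => t _; ring.
  rewrite E in n2.
  have -> : dot_L2 L (Du 4%N) (Du 4%N) = 2 * r / l ^+ 2 * (r / 2 * ((l / r) ^+ 2 * dot_L2 L (Du 4%N) (Du 4%N))).
    by field; rewrite !gt_eqF.
  by rewrite ler_wpM2l// divr_ge0 ?mulr_ge0// ltW.
have [Du2B Du2L] := primitive_on_bound_at (ltW ell0) (Duk 2%N isT) Du3b ll Du2b.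
have pv := Dvk 0%N isT; rewrite Dv0 in pv v0.
have [vB vL] := primitive_on_bound_at (ltW ell0) pv Dv1b zl (c := 0) ltac:(by rewrite v0 normr0).
rewrite subr0 in Du2B vB.
split.
- by move=> x xl; have := Du2B x xl; have := vB x xl; split; lra.
- move=> x y xl yl; split.
    by rewrite (le_trans (Du2L _ _ xl yl))// ler_wpM2r//; lra.
  by rewrite (le_trans (vL _ _ xl yl))// ler_wpM2r//; lra.
- rewrite normrM gtr0_norm// (@le_trans _ _ (J%:num * b1))//; last lra.
  by rewrite ler_wpM2l ?(ltW j0)// Dv1b.
- rewrite normrM gtr0_norm// (@le_trans _ _ (m%:num * (b1 * ell)))//; last lra.
  by rewrite ler_wpM2l ?(ltW m0)//; have := vB _ ll; rewrite add0r.
Qed.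

End operator.

(** * Compactness of families of Lipschitz functions *)

Section lipschitz_functions.
Context {R : realType}.
Notation mu := (@lebesgue_measure R).
Implicit Types (a b x y M : R) (f g : R -> R).

Lemma lipschitz_within_continuous a b M f : a <= b ->
  (forall x y, a <= x <= b -> a <= y <= b -> `|f x - f y| <= M * `|x - y|) ->
  {within `[a, b], continuous f}.
Proof.
move=> ab fL; pose clamp x := Num.min b (Num.max a x).
have clampab x : a <= clamp x <= b.
  by rewrite /clamp; case: (leP a x) => ax; case: (leP b _) => xb; lra.
have clampid x : x \in `[a, b] -> clamp x = x.
  by rewrite in_itv/= => /andP[ax xb]; rewrite /clamp (max_idPr ax) (min_idPr xb).
have clampL x y : `|clamp x - clamp y| <= `|x - y|.
  by rewrite /clamp; case: (leP a x) => ?; case: (leP a y) => ?; (do ?case: (leP b _) => ?);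
    rewrite ler_norml; have := ler_norm (x - y); have := ler_norm (y - x); rewrite (distrC y); lra.
have fc : continuous (f \o clamp).
  move=> x; apply/cvgrPdist_lt => /= e e0; near=> y.
  have := fL _ _ (clampab x) (clampab y) => /le_lt_trans; apply.
  apply: (@le_lt_trans _ _ (`|M| * `|x - y|)).
    apply: (@le_trans _ _ (`|M| * `|clamp x - clamp y|)); first by rewrite ler_wpM2r// ler_norm.
    by rewrite ler_wpM2l.
  apply: (@le_lt_trans _ _ ((`|M| + 1) * `|x - y|)); first by rewrite ler_wpM2r// lerDl.
  rewrite mulrC -ltr_pdivlMr ?ltr_wpDl//.
  by near: y; apply: cvgr_dist_lt => //; rewrite divr_gt0// ltr_wpDl.
apply: (subspace_eq_continuous _ (continuous_subspaceT fc)) => x.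
by rewrite inE => /= xab; rewrite /from_subspace /= clampid.
Unshelve. all: by end_near. Qed.

Lemma within_continuous_Lp2 a b f : a <= b -> {within `[a, b], continuous f} -> Lp_on 2%:E a b f.
Proof.
move=> ab fc; have [M HM] : exists M, forall x, a <= x <= b -> `|f x| <= M.
  have fn : {within `[a, b], continuous (fun x => `|f x|)}.
    move=> x; apply: continuous_comp; first exact: fc.
    exact: norm_continuous.
  have [c _ Hc] := EVT_max ab fn.
  by exists `|f c| => x xab; apply: Hc; rewrite in_itv.
apply: (@Lp_on2_bounded _ _ _ _ M) => [|x /andP[ax xb]]; last by rewrite HM// !ltW.
apply: (@measurable_funS _ _ _ _ (`[a, b]%classic : set (measurableTypeR R))).
- exact: measurable_set_itv.
- exact: subset_itv_oo_cc.
- by apply: subspace_continuous_measurable_fun; [exact: measurable_set_itv|].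
Qed.

Lemma grid_approx (n : nat) (l x : R) : (0 < n)%N -> 0 < l -> 0 <= x <= l ->
  exists k : 'I_n.+1, `|x - k%:R * (l / n%:R)| <= l / n%:R /\ 0 <= k%:R * (l / n%:R) <= l.
Proof.
move=> n0 l0 /andP[x0 xl]; have n0' : (0 : R) < n%:R by rewrite ltr0n.
have h0 : 0 < l / n%:R by rewrite divr_gt0.
have y0 : 0 <= x / (l / n%:R) by rewrite divr_ge0// ltW.
have /andP[k1 k2] := truncn_itv y0; set k := Num.truncn _ in k1 k2.
rewrite ler_pdivlMr// in k1; rewrite ltr_pdivrMr// -natr1 mulrDl mul1r in k2.
have kn : (k < n.+1)%N.
  rewrite ltnS -(ler_nat R) -(ler_pM2r h0) (le_trans k1)// (le_trans xl)//.
  by rewrite mulrC divfK// gt_eqF.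
exists (Ordinal kn) => /=; rewrite ler_norml; move: k1 k2.
have : 0 <= k%:R * (l / n%:R) by rewrite mulr_ge0// ltW.
set r := k%:R * _; set s := l / _ => h1 h2 h3; split; lra.
Qed.

(** An Arzela-Ascoli statement for pointwise convergence: Tychonoff for the bounds, and closedness
    of each Lipschitz constraint, which involves two coordinates only. *)
Lemma compact_lipschitz_box (I : eqType) M (r : set (I * I)) (d : I * I -> R) :
  compact [set F : prod_topology (fun _ : I => R) |
    (forall i, `|F i| <= M) /\ (forall ij, r ij -> `|F ij.1 - F ij.2| <= d ij)].
Proof.
have H1 : compact [set F : prod_topology (fun _ : I => R) | forall i, `|F i| <= M].
  have := @tychonoff I (fun _ => R) (fun _ => `[- M, M]%classic) (fun _ => @segment_compact R (- M) M).
  by congr compact; apply/seteqP; split => F H i; have := H i; rewrite /= in_itv/= ler_norml.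
have H2 : closed [set F : prod_topology (fun _ : I => R) | forall ij, r ij -> `|F ij.1 - F ij.2| <= d ij].
  have -> : [set F : prod_topology (fun _ : I => R) | forall ij, r ij -> `|F ij.1 - F ij.2| <= d ij] =
      \bigcap_(ij in r) ((fun F : prod_topology (fun _ : I => R) => `|F ij.1 - F ij.2|) @^-1` [set t | t <= d ij]).
    by apply/seteqP; split => F H ij rij; exact: H.
  apply: closed_bigI => ij _; apply: closed_comp => [F _|]; last exact: closed_le.
  have pc i : G i @[G --> F] --> F i by exact: (@proj_continuous _ (fun _ : I => R) i F).
  exact: cvg_norm (cvgB (pc _) (pc _)).
exact: compact_closedI H1 H2.
Qed.

Lemma near_coordinate_lt (I : eqType) (F : prod_topology (fun _ : I => R)) (i : I) (e : R) : 0 < e ->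
  \forall G \near F, `|F i - G i| < e.
Proof.
move=> e0; have pc : continuous_at F (proj i) by exact: (@proj_continuous _ (fun _ : I => R) i F).
have := pc (ball (F i) e) (nbhsx_ballx _ _ e0); apply.
Qed.

End lipschitz_functions.

(** * Compactness of the resolvent *)

Section resolvent.
Context {R : realType} {rho Lam L m J : {posnum R}}.
Notation mu := (@lebesgue_measure R).
Notation state := (state rho Lam L m J).
Notation H := (H rho Lam L m J).
Notation opA := (opA rho Lam L m J).
Notation ell := (L%:num).
Implicit Types (w : state) (y z : H) (u v f g : R -> R) (D : nat -> R -> R).

Let ell0 : (0 : R) < ell. Proof. by []. Qed.

Lemma dot_L2_le f (eps : R) : Lp_on 2%:E 0 ell f -> (forall x, 0 < x < ell -> `|f x| <= eps) ->
  dot_L2 L f f <= ell * eps ^+ 2.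
Proof.
move=> fL fe; rewrite /dot_L2.
have -> : ell * eps ^+ 2 = \int[mu]_(t in `]0, ell[) (eps ^+ 2).
  rewrite Rintegral_oo_cc; last by apply: continuous_itv_integrable; exact: cst_continuous.
  by rewrite Rintegral_itv_cst ?(ltW ell0)// subr0 mulrC.
apply: le_Rintegral; first exact: measurable_set_itv.
- exact: Lp_on2_mul_integrable.
- have := @continuous_itv_integrable _ (cst (eps ^+ 2)) 0 ell (@cst_continuous _ _ _).
  by apply: (integrableS (measurable_set_itv _) (measurable_set_itv _)); exact: subset_itv_oo_cc.
- move=> t; rewrite /= in_itv/= => /fe fte.
  have -> : f t * f t = `|f t| ^+ 2 by rewrite -normrX ger0_norm ?sqr_ge0// expr2.
  by rewrite lerXn2r ?nnegrE// (le_trans _ fte).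
Qed.

Lemma snormB_le : exists2 C : R, 0 <= C & forall w1 w2 D1 D2 (eps : R),
  sobolev_derivs 2%:E 2 0 ell (st_u w1) D1 -> sobolev_derivs 2%:E 2 0 ell (st_u w2) D2 ->
  (forall x, 0 < x < ell -> `|D1 2%N x - D2 2%N x| <= eps /\ `|st_v w1 x - st_v w2 x| <= eps) ->
  `|st_xi w1 - st_xi w2| <= eps -> `|st_psi w1 - st_psi w2| <= eps ->
  snorm (w1 - w2) <= C * eps.
Proof.
pose K := Lam%:num / 2 * ell + rho%:num / 2 * ell + (2 * J%:num)^-1 + (2 * m%:num)^-1 : R.
have K0 : 0 <= K by rewrite !addr_ge0// mulr_ge0// divr_ge0.
exists (Num.sqrt K); first exact: sqrtr_ge0.
move=> w1 w2 D1 D2 eps h1 h2 hx hxi hpsi.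
have e0 : 0 <= eps by exact: le_trans hxi.
have p1 : (1 <= 2%:E :> \bar R)%E by rewrite lee_fin ler1n.
have wE : w1 - w2 = -1 *: w2 + w1 by rewrite scaleN1r addrC.
have hD := sobolev_derivs_lin (-1) p1 h2 h1.
rewrite -st_u_linear -wE in hD; have [_ _ hD2] := hD.
rewrite -(@ler_pXn2r _ 2)// ?nnegrE ?mulr_ge0 ?sqrtr_ge0// exprMn !sqr_sqrtr ?sip_ge0//.
rewrite (sipE hD hD) /energy_ip.
have sq (t : R) : `|t| <= eps -> t * t <= eps ^+ 2.
  move=> te; have -> : t * t = `|t| ^+ 2 by rewrite -normrX ger0_norm ?sqr_ge0// expr2.
  by rewrite lerXn2r ?nnegrE.
have -> : K * eps ^+ 2 = Lam%:num / 2 * (ell * eps ^+ 2) + rho%:num / 2 * (ell * eps ^+ 2) +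
   (2 * J%:num)^-1 * eps ^+ 2 + (2 * m%:num)^-1 * eps ^+ 2 by rewrite /K; ring.
apply: lerD; first apply: lerD; first apply: lerD.
- rewrite ler_wpM2l ?divr_ge0//; apply: dot_L2_le hD2 _ => x xl.
  by rewrite !fctE scaleN1r addrC; have [] := hx x xl.
- rewrite ler_wpM2l ?divr_ge0//; apply: dot_L2_le (st_v_Lp _) _ => x xl.
  have -> : st_v (w1 - w2) x = st_v w1 x - st_v w2 x by [].
  by have [] := hx x xl.
- by rewrite ler_wpM2l//; apply: sq.
- by rewrite ler_wpM2l//; apply: sq.
Qed.

(* a state [u, v, xi, psi] with u'' and v Lipschitz is coded by the values of u''
   (at (true, Some x)) and v (at (false, Some x)), and by xi and psi (at None) *)
Notation code := (prod_topology (fun _ : bool * option R => R)).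

(** The clamped u is the double primitive of u''. A code too irregular to give a state is sent to 0
    by default; this never happens in [code_box]. *)
Definition state_of_code (F : code) : state :=
  insubd (0 : state) ((fun x => \int[mu]_(t in `[0, x]) \int[mu]_(s in `[0, t]) F (true, Some s)),
    (fun x => F (false, Some x)), F (true, None), F (false, None)).

(** The constraints concern only pairs of points of [0, L], so the default in [odflt] is never
    reached under them. *)
Definition code_box (M : R) : set code :=
  [set F | (forall i, `|F i| <= M) /\
    (forall ij, (exists b (x y : R), [/\ 0 <= x <= ell, 0 <= y <= ell & ij = ((b, Some x), (b, Some y))]) ->
      `|F ij.1 - F ij.2| <= (fun ij => M * `|odflt 0 ij.1.2 - odflt 0 ij.2.2|) ij)].

Lemma compact_code_box M : compact (code_box M).
Proof. exact: compact_lipschitz_box. Qed.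

Lemma code_box_lipschitz M F b (x y : R) : code_box M F -> 0 <= x <= ell -> 0 <= y <= ell ->
  `|F (b, Some x) - F (b, Some y)| <= M * `|x - y|.
Proof. by move=> [_ HF] xl yl; apply: (HF ((b, Some x), (b, Some y))); exists b, x, y. Qed.

Definition code_derivs (F : code) (k : nat) : R -> R :=
  if k is k.+1 then if k is 0%N then fun x => \int[mu]_(t in `[0, x]) F (true, Some t)
    else fun x => F (true, Some x)
  else fun x => \int[mu]_(t in `[0, x]) \int[mu]_(s in `[0, t]) F (true, Some s).

Lemma code_box_clamped M F : code_box M F -> clamped 2 ell (code_derivs F 0%N) (code_derivs F).
Proof.
move=> MF; have fc : {within `[0, ell], continuous (fun x => F (true, Some x))}.
  by apply: (lipschitz_within_continuous (ltW ell0)) => x y; exact: (code_box_lipschitz true MF).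
have fi : mu.-integrable `[0, ell] (EFin \o (fun x => F (true, Some x))).
  by apply: continuous_compact_integrable => //; exact: segment_compact.
have P1 := primitive_on_cumulative fi.
have P0 := primitive_on_cumulative (primitive_on_integrable (ltW ell0) P1).
split; [split => // |exact: Rintegral_itv1|exact: Rintegral_itv1].
- by move=> [|[|//]] _.
- exact: within_continuous_Lp2 (ltW ell0) fc.
Qed.

Lemma state_of_codeE M F : code_box M F -> val (state_of_code F) =
  (code_derivs F 0%N, (fun x => F (false, Some x)), F (true, None), F (false, None)).
Proof.
move=> MF; rewrite /state_of_code val_insubd ifT//.
apply/asboolP; split; first by exists (code_derivs F); exact: code_box_clamped MF.
apply: within_continuous_Lp2 (ltW ell0) _; apply: (lipschitz_within_continuous (ltW ell0)) => x y.
exact: (code_box_lipschitz false MF).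
Qed.

Lemma state_of_code_dist M : exists2 C : R, 0 <= C & forall F G (eps : R), code_box M F -> code_box M G ->
  (forall b x, 0 <= x <= ell -> `|F (b, Some x) - G (b, Some x)| <= eps) ->
  (forall b, `|F (b, None) - G (b, None)| <= eps) ->
  `|(hpi (state_of_code F) : H) - hpi (state_of_code G)| <= C * eps.
Proof.
have [C C0 HC] := snormB_le; exists C => // F G eps MF MG h1 h2.
have EF := state_of_codeE MF; have EG := state_of_codeE MG.
have -> : (hpi (state_of_code F) : H) - hpi (state_of_code G) = hpi (state_of_code F - state_of_code G).
  by rewrite -scaleN1r addrC -hpi_linear scaleN1r addrC.
rewrite [X in X <= _](hnorm_pi _).
apply: (HC _ _ (code_derivs F) (code_derivs G)).
- by rewrite /st_u EF; have [] := code_box_clamped MF.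
- by rewrite /st_u EG; have [] := code_box_clamped MG.
- move=> x /andP[x0 xl]; have xl' : 0 <= x <= ell by rewrite !ltW.
  by rewrite /st_v EF EG; split; exact: h1.
- by rewrite /st_xi EF EG; exact: h2.
- by rewrite /st_psi EF EG; exact: h2.
Qed.

(** Codes in the box share one Lipschitz constant, so closeness at the finitely many points of a
    fine grid, an open condition in the product topology, forces uniform closeness on [0, L] and
    hence closeness in energy. *)
Lemma state_of_code_continuous M : 0 <= M ->
  {within code_box M, continuous (fun F : code => hpi (state_of_code F) : H)}.
Proof.
move=> M0; have [C C0 HC] := state_of_code_dist M.
apply/subspace_continuousP => F MF; apply/cvgrPdist_lt => e e0.
pose d := e / (2 * (C + 1)).
have d0 : 0 < d by rewrite divr_gt0// mulr_gt0// ltr_wpDl.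
(* The mesh L / n is such that passing to a grid point costs at most d / 4 for each of the two
   codes, and the grid values take the remaining d / 2. *)
have [n0 hn] : exists n : nat, 4 * M * ell / d < n%:R.
  by exists (Num.truncn (4 * M * ell / d)).+1; exact: truncnS_gt.
pose n := n0.+1.
have hn' : 2 * (M * (ell / n%:R)) <= d / 2.
  have n0' : (0 : R) < n%:R by rewrite ltr0n.
  have : 4 * M * ell / d <= n%:R by rewrite (le_trans (ltW hn))// ler_nat.
  rewrite ler_pdivrMr// => H1.
  have -> : 2 * (M * (ell / n%:R)) = (4 * M * ell) / n%:R / 2 by field; rewrite gt_eqF.
  by rewrite ler_pM2r ?invr_gt0// ler_pdivrMr// (mulrC d).
pose pt (i : bool * option 'I_n.+1) : bool * option R := (i.1, omap (fun k : 'I_n.+1 => k%:R * (ell / n%:R)) i.2).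
have : \forall G \near F, forall i, `|F (pt i) - G (pt i)| < d / 2.
  apply: (@filter_forall _ _ (fun i (G : code) => `|F (pt i) - G (pt i)| < d / 2) (nbhs (F : code)) _) => i.
  by apply: near_coordinate_lt; exact: divr_gt0.
rewrite near_withinE; apply: filterS => G HG MG.
apply: (@le_lt_trans _ _ (C * d)); last first.
  rewrite /d mulrA ltr_pdivrMr ?mulr_gt0 ?ltr_wpDl// mulrC ltr_pM2l//; lra.
apply: HC => // [b x xl|b]; last first.
  by have := HG (b, None); rewrite /pt/=; lra.
have [k [xk kl]] := grid_approx (ltn0Sn n0) ell0 xl.
have := HG (b, Some k); rewrite /pt/=; set xx := _ * _ in xk kl *.
have h1 := code_box_lipschitz b MF xl kl; have h2 := code_box_lipschitz b MG xl kl.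
have h3 : M * `|x - xx| <= M * (ell / n%:R) by rewrite ler_wpM2l.
move=> h4; have -> : F (b, Some x) - G (b, Some x) = (F (b, Some x) - F (b, Some xx)) +
  (F (b, Some xx) - G (b, Some xx)) - (G (b, Some x) - G (b, Some xx)) by ring.
rewrite (le_trans (ler_normB _ _))//.
have h5 := ler_normD (F (b, Some x) - F (b, Some xx)) (F (b, Some xx) - G (b, Some xx)).
by move: h1 h2 h3 h5 hn' h4; move: (M * (_ / _)) => s; lra.
Qed.

Lemma opA_compact_resolvent (C : R) : exists2 K : set H, compact K &
  forall y z, opA (y, z) -> `|z| <= C -> K y.
Proof.
have [M M0 HM] := @opA_bounds _ rho Lam L m J C.
exists ((fun F : code => hpi (state_of_code F) : H) @` code_box M).
  apply: continuous_compact; first exact: state_of_code_continuous.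
  exact: compact_code_box.
move=> y z [u [v [Du [Dv [[cu cv hy] hz]]]]] zC.
have [B1 B2 B3 B4] := HM z u v Du Dv cu cv hz zC.
(* Off [0, L] the code is set to 0: no bound on u'' or v is known there, while the box bounds every
   coordinate. *)
pose F : code := fun i => match i with
  | (b, Some x) => if 0 <= x <= ell then (if b then Du 2%N x else v x) else 0
  | (b, None) => if b then J%:num * Dv 1%N ell else m%:num * v ell end.
have MF : code_box M F.
  split=> [[b [x|]]|ij [b [x [y' [xl yl ->]]]]] /=.
  - by case: ifPn => [/B1[? ?]|_]; [case: b|rewrite normr0].
  - by case: b.
  - by rewrite xl yl; have [? ?] := B2 _ _ xl yl; case: b.
exists F => //; case: hy => w wE /= ->; apply/hpi_eqP/eqP.
have [K _ HK] := snormB_le.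
rewrite eq_le sqrtr_ge0 andbT.
have EF := state_of_codeE MF; have [hF _ _] := code_box_clamped MF.
have [hu _ _] := cu; have hu2 := sobolev_derivs_le (isT : (2 < 4)%N) (ltW ell0) hu.
(* Taking eps = 0: since u'', v, xi and psi agree, the two states are equal in the quotient. *)
have {HK}HK := HK (state_of_code F) w (code_derivs F) Du 0; rewrite mulr0 in HK; apply: HK.
- by rewrite /st_u EF.
- by rewrite /st_u wE.
- move=> x /andP[x0 xl]; rewrite /st_v EF wE/= ?(ltW x0) ?(ltW xl)/=.
  by rewrite !subrr normr0.
- by rewrite /st_xi EF wE /= subrr normr0.
- by rewrite /st_psi EF wE /= subrr normr0.
Qed.

End resolvent.

(** * Application to the beam *)

Lemma derive1_ge0_homo (R : realType) (k k' : R -> R) :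
  (forall z : R, is_derive z (1 : R) k (k' z)) -> (forall z, 0 <= k' z) -> {homo k : x y / x <= y}.
Proof.
move=> dk k'0 x y xy.
have ck : continuous k.
  by move=> z; apply/differentiable_continuous/derivable1_diffP; have [] := dk z.
have [c _ E] := MVT_segment xy (fun z _ => dk z) (continuous_subspaceT ck).
by rewrite -subr_ge0 E mulr_ge0// subr_ge0.
Qed.

(** Either the state 0 feels the force -k1 0, or, if k1 0 = 0, a state at rest shape whose tip moves
    at speed d / 2 feels the damping. *)
Lemma exists_force_neq0 (R : realType) (rho Lam L m J : {posnum R}) (k1 k2 : R -> R) :
  k2 0 = 0 -> (exists K delta : R, [/\ 0 < K, 0 < delta &
     forall z, z \in `]- delta, delta[ -> K * z ^+ 2 <= `|k2 z|]) ->
  exists y : H rho Lam L m J, - k1 (tip_displacement y) - k2 (tip_velocity y) != 0.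
Proof.
move=> k20 [K [d [K0 d0 HK]]].
have m0 : m%:num != 0 :> R by [].
pose z := d / 2.
have [k10|k10] := eqVneq (k1 0) 0; last first.
  exists (force rho Lam L m J 0); rewrite tip_velocity_force tip_displacement_pi mul0r k20 subr0 oppr_eq0.
  exact: k10.
exists (force rho Lam L m J (m%:num * z)); rewrite tip_velocity_force tip_displacement_pi.
have -> : k1 (st_u (State rho Lam m J (force_subproof L (m%:num * z))) L%:num) = 0 by exact: k10.
rewrite oppr0 add0r oppr_eq0 mulrAC divff// mul1r -normr_gt0.
apply: lt_le_trans (HK z _); first by rewrite mulr_gt0// exprn_gt0// divr_gt0.
by rewrite in_itv/= /z; lra.
Qed.

Theorem lemma4p1 (R : realType) (rho Lam L m J : {posnum R}) (k1 k2 : R -> R)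
  (hK : assumption_K k1 k2)
  (T : R -> H rho Lam L m J -> H rho Lam L m J)
  (hT : C0_semigroup T) (hA : generator T = opA rho Lam L m J)
  (S : R -> H rho Lam L m J -> H rho Lam L m J)
  (hS : forall y0 : H rho Lam L m J, mild_solution T (opN rho Lam L m J k1 k2) y0 (fun t => S t y0)) :
  forall y0, y0 \in domA rho Lam L m J ->
    precompact (\bigcup_(t in `[0, +oo[) [set S t y0]).
Proof.
move=> y0 /[!inE] /in_domA_opA[z0 yz0].
have [hk1 hk2 K1_ge0 [dk2 k20] hco] := hK.
have [k1' [dk1 lk1]] := W2oo_loc_C11 hk1.
have [k2' [dk2' _]] := W2oo_loc_C11 hk2.
have c1 : continuous k1.
  by move=> z; apply/differentiable_continuous/derivable1_diffP; have [] := dk1 z.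
have c2 : continuous k2.
  by move=> z; apply/differentiable_continuous/derivable1_diffP; have [] := dk2' z.
have k2m : {homo k2 : x y / x <= y}.
  by apply: (derive1_ge0_homo dk2') => z; have [_ <-] := dk2' z; rewrite -derive1E.
have [B [qB pB]] := @tip_bound _ rho Lam L m J.
apply: (@energy_precompact R (state rho Lam L m J) T (force rho Lam L m J 1)
  (@tip_displacement R rho Lam L m J) (@tip_velocity R rho Lam L m J) k1 k2
  (fun z => oriented_integral 0 z k1) k1' (opN rho Lam L m J k1 k2) S hT _ hS
  _ _ _ _ _ _ B qB pB _ _ _ K1_ge0 _ dk1 c2 k2m _ _ y0 z0).
- by move=> y; rewrite /opN forceE.
- exact: exists_force_neq0.
- by move=> x z; rewrite hA => /opA_conservative ->.
- by move=> z; have [x xz] := opA_surjective z; exists x; rewrite hA.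
- by move=> C; have [K cK HK] := @opA_compact_resolvent R rho Lam L m J C; exists K => // x z; rewrite hA; exact: HK.
- exact: tip_displacement_linear.
- exact: tip_velocity_linear.
- exact: tip_displacement_force.
- exact: hip_force.
- by move=> x z; rewrite hA; exact: opA_tip.
- by move=> z; exact: is_derive_oriented_integral.
(* M may be negative, hence its absolute value. The Lipschitz constant of k1' gives the expansion of
   k1, and that of k1, denoted [C2], the expansion of its primitive. *)
- move=> M; have [C C0 HC] := lk1 `|M|.
  have MM : M <= `|M| by exact: ler_norm.
  have t1 := lipschitz_taylor (ltW C0) dk1 HC.
  have l2 := derive_lipschitz (normr_ge0 M) dk1 HC.
  pose C2 : R := `|k1' 0| + `|C| * `|M|.
  have C20 : 0 <= C2 by rewrite addr_ge0// mulr_ge0.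
  have t2 := lipschitz_taylor C20 (fun z => is_derive_oriented_integral z c1) l2.
  exists (C + C2); first by rewrite ltr_pwDl.
  move=> a b aM bM; have {}aM := le_trans aM MM; have {}bM := le_trans bM MM.
  split; [apply: le_trans (t1 a b aM bM) _|apply: le_trans (t2 a b aM bM) _];
    by rewrite ler_wpM2r ?sqr_ge0// (lerDl, lerDr)// ltW.
- exact: assumption_K_coercive.
- by rewrite hA.
Qed.
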